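(* Suppose both $m$ and $N$ are even. Let $H_0$ and $H_1$ be the defect $0$ and defect $1$ homology of the two-loop hairy graph-complex $0\to\mathcal C_2\to\mathcal C_1\to\mathcal C_0\to 0$ with rational coefficients. Let $a_k$ and $b_k$ ($k\ge 1$) be the dimensions of the Hodge degree $k$ parts of $H_0$ and $H_1$ respectively, and let $\chi_k$ be the Euler characteristic of the Hodge degree $k$ part of the complex. Then the generating functions $h_0(t)=\sum_{k\ge1}a_kt^k$, $h_1(t)=\sum_{k\ge1}b_kt^k$, $\chi(t)=\sum_{k\ge1}\chi_kt^k$ are $$h_0(t)=\frac{t^6}{(1-t^2)(1-t^6)},\qquad h_1(t)=\frac{t^7}{(1-t^2)(1-t^6)},\qquad \chi(t)=-\frac{t^6}{(1+t)(1-t^6)}.$$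
   Context: Let $m,N$ be positive integers; all coefficients are in $\mathbb Q$. Graph-complex $\mathcal E^{m,N}_\pi$. It is spanned by connected graphs (self-loops and multiple edges allowed) with a non-empty finite set of unlabeled external vertices of valence $1$ and a possibly empty finite set of unlabeled internal vertices of valence $\ge3$. The orientation set of a graph is the union of its external vertices (each of degree $-m$), internal vertices (each of degree $-N$) and edges (each of degree $N-1$). An orientation of a graph is a total order of its orientation set together with an orientation of every edge. Isomorphic oriented graphs (isomorphism respecting adjacency, edge orientations and the order) are identified. One takes the quotient of the $\mathbb Q$-vector space spanned by isomorphism classes of oriented graphs by the relations: reversing the orientation of one edge multiplies by $(-1)^N$; permuting the orientation set multiplies by the Koszul sign of the permutation, computed from the degrees of the elements. The total degree of a graph is the sum of the degrees of all elements of its orientation set. The differential $\partial\Upsilon$ is the sum, over all internal vertices $v$ and all unordered partitions of the half-edges at $v$ into two sets of size $\ge2$, of the graph obtained by replacing $v$ by a new edge joining two vertices, the half-edges of one set being attached to one endpoint and those of the other set to the other endpoint; one endpoint is regarded as the old vertex $v$, the other one as the new vertex; the new vertex and the new edge are added as the first and second elements of the ordered orientation set, and the new edge is oriented from the old vertex to the new one (the choice of which endpoint is new does not matter). Hairy graphs. An edge of a connected graph is tree-type if removing it disconnects the graph into two parts, exactly one of which is a tree. The frame is the subgraph generated by the edges that are not tree-type. A hair is a tree-type edge one of whose endpoints is univalent and whose other endpoint lies in the frame and has no other tree-type edges adjacent to it. A vertex is a cut vertex if removing it (as a point of the topological space) disconnects the graph. A two-loop hairy graph is a connected graph (self-loops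 and multiple edges allowed) with a non-empty finite set of unlabeled external vertices of valence $1$ and a finite set of unlabeled internal vertices of valence $\ge3$, of first Betti number $2$, whose frame has no cut vertices and all of whose tree-type edges are hairs; its frame is a (subdivided) $\Theta$-graph. The Hodge degree is the number of external vertices (i.e. of hairs). The defect is $\sum_v(|v|-3)$ over the internal vertices $v$, where $|v|$ is the valence; for two-loop hairy graphs it is $0$, $1$ or $2$. Let $\mathcal C_i\subset\mathcal E^{m,N}_\pi$ be the span of the two-loop hairy graphs of defect $i$. The differential $\partial$ preserves Hodge degree and lowers both the defect and the total degree by $1$, giving the two-loop hairy graph-complex $0\to\mathcal C_2\xrightarrow{\partial_2}\mathcal C_1\xrightarrow{\partial_1}\mathcal C_0\to0$, with $H_i=\ker\partial_i/\operatorname{im}\partial_{i+1}$. The Euler characteristic $\chi_k$ of the Hodge degree $k$ part is taken with respect to the total degree: $\chi_k=\sum_d(-1)^d\dim(\text{part of Hodge degree }k\text{ and total degree }d)$. *)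

(* Defs.v *)
From HB Require Import structures.
From mathcomp Require Import all_boot all_order all_algebra all_fingroup.
From mathcomp Require Import zify.
Set Implicit Arguments.
Unset Strict Implicit.
Unset Printing Implicit Defensive.
Import Order.TTheory GRing.Theory Num.Theory.
Local Open Scope ring_scope.

Section QuotientSpace.
Variables (F : fieldType) (V : vectType F) (R : {vspace V}).

(* V / R, realised on the library's complement of R.  Only the properties of
   quot_pi proved below matter: it is linear, onto, and has kernel R. *)
Definition quot : vectType F := subvs_of (R^C)%VS.

Definition quot_pi : 'Hom(V, quot) :=
  linfun (vsproj (R^C)%VS \o daddv_pi (R^C)%VS R).

Lemma compl_cap : (R^C :&: R = 0)%VS.
Proof. by rewrite capvC capv_compl. Qed.

Lemma quot_piE v : vsval (quot_pi v) = daddv_pi (R^C)%VS R v.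
Proof. by rewrite lfunE /= vsprojK // memv_pi. Qed.

Lemma quot_pi_add v : daddv_pi (R^C)%VS R v + daddv_pi R (R^C)%VS v = v.
Proof. by apply: daddv_pi_add compl_cap _; rewrite addvC addv_complf memvf. Qed.

Lemma lker_quot_pi : lker quot_pi = R.
Proof.
apply/vspaceP=> v; rewrite memv_ker -(inj_eq val_inj) /= quot_piE.
apply/eqP/idP => [pv0 | vR].
  by rewrite -(quot_pi_add v) pv0 add0r memv_pi.
have := quot_pi_add v; rewrite (daddv_pi_id (capv_compl R) vR).
by move/(congr1 (fun w => w - v)); rewrite addrK subrr.
Qed.

Lemma limg_quot_pi : limg quot_pi = fullv.
Proof.
apply/vspaceP=> w; rewrite memvf; apply/memv_imgP; exists (vsval w) => //.
  by rewrite memvf.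
by apply: val_inj; rewrite /= quot_piE daddv_pi_id ?compl_cap ?subvsP.
Qed.

End QuotientSpace.

Section InducedMap.
Variables (F : fieldType) (V W : vectType F).
Variables (R : {vspace V}) (S : {vspace W}).

(* For f mapping R into S this is the map V / R -> W / S induced by f, see
   quot_mapE. *)
Definition quot_map (f : 'Hom(V, W)) : 'Hom(quot R, quot S) :=
  (quot_pi S \o f \o (quot_pi R)^-1)%VF.

Lemma quot_mapE f v : (f @: R <= S)%VS ->
  quot_map f (quot_pi R v) = quot_pi S (f v).
Proof.
move=> fRS; rewrite !comp_lfunE; set w := (quot_pi R)^-1%VF _.
have wv : w - v \in R.
  rewrite -(lker_quot_pi R) memv_ker linearB /= limg_lfunVK ?subrr //.
  by rewrite memv_img ?memvf.
apply/eqP; rewrite -subr_eq0 -linearB /= -memv_ker lker_quot_pi -linearB /=.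
by rewrite (subvP fRS) // memv_img.
Qed.

End InducedMap.

Section FreeSpace.
Variable T : finType.

Definition free_space : vectType rat := {ffun T -> rat^o}.

Definition delta (x : T) : free_space := [ffun y => (y == x)%:R].

Definition extend_fun (V : vectType rat) (f : T -> V) (c : free_space) : V :=
  \sum_x (c x : rat) *: f x.

Lemma extend_fun_linear V f : linear (@extend_fun V f).
Proof.
move=> a c d; rewrite /extend_fun scaler_sumr -big_split /=.
by apply: eq_bigr => x _; rewrite !ffunE scalerDl scalerA.
Qed.

HB.instance Definition _ (V : vectType rat) (f : T -> V) := GRing.isSemilinear.Build rat
  free_space V _ (@extend_fun V f)
  (GRing.semilinear_linear (@extend_fun_linear V f)).

Definition extend (V : vectType rat) (f : T -> V) : 'Hom(free_space, V) :=
  linfun (extend_fun f).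

Lemma extend_delta V f x : @extend V f (delta x) = f x.
Proof.
rewrite lfunE /= /extend_fun (bigD1 x) //= ffunE eqxx scale1r.
rewrite big1 ?addr0 // => y /negPf yx.
by rewrite ffunE yx scale0r.
Qed.

End FreeSpace.

Lemma memv_sum_match (V : vectType rat) (U : {vspace V}) (I T : finType)
    (P P' : I -> {set T}) (E E' : I -> T -> V) (a : rat)
    (h : I -> I) (f : T -> T) :
  injective h -> injective f ->
  (forall i x, (f x \in P' (h i)) = (x \in P i)) ->
  (forall i x, x \in P i -> E' (h i) (f x) - a *: E i x \in U) ->
  (\sum_i \sum_(x in P' i) E' i x) - a *: (\sum_i \sum_(x in P i) E i x) \in U.
Proof.
move=> h_inj f_inj PP' EE'.
rewrite (reindex_inj h_inj) /= scaler_sumr -sumrB; apply: memv_suml => i _.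
rewrite (reindex_inj f_inj) /= scaler_sumr (eq_bigl _ _ (PP' i)) -sumrB.
by apply: memv_suml => x; apply: EE'.
Qed.

Lemma extend_line_sub (T : finType) (W : vectType rat) (f : T -> W)
    (U : {vspace W}) x y a :
  f x - a *: f y \in U -> (extend f @: <[delta x - a *: delta y]> <= U)%VS.
Proof.
by move=> fU; rewrite limg_line -memvE linearB linearZ_LR /= !extend_delta.
Qed.

Lemma extend_line_sub1 (T : finType) (W : vectType rat) (f : T -> W)
    (U : {vspace W}) x y :
  f x - 1 *: f y \in U -> (extend f @: <[delta x - delta y]> <= U)%VS.
Proof. by move/extend_line_sub; rewrite scale1r. Qed.

Section Orders.
Variable T : finType.

Definition total_order (R : {set T * T}) : bool :=
  [&& [forall a, forall b, ((a, b) \in R) || ((b, a) \in R)],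
      [forall a, forall b, ((a, b) \in R) && ((b, a) \in R) ==> (a == b)]
    & [forall a, forall b, forall c,
         ((a, b) \in R) && ((b, c) \in R) ==> ((a, c) \in R)]].

Definition torder : finType := {R : {set T * T} | total_order R}.

Definition ole (R : torder) : rel T := fun a b => (a, b) \in val R.

Lemma total_orderP (r : rel T) :
  total r -> antisymmetric r -> transitive r ->
  total_order [set p | r p.1 p.2].
Proof.
move=> r_tot r_anti r_tr; apply/and3P; split.
- by apply/forallP=> a; apply/forallP=> b; rewrite !inE /= r_tot.
- apply/forallP=> a; apply/forallP=> b; rewrite !inE /=.
  by apply/implyP=> /r_anti ->.
- apply/forallP=> a; apply/forallP=> b; apply/forallP=> c; rewrite !inE /=.
  by apply/implyP=> /andP[ab bc]; apply: r_tr bc.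
Qed.

Definition mk_order (r : rel T) (r_tot : total r) (r_anti : antisymmetric r)
    (r_tr : transitive r) : torder :=
  Sub [set p | r p.1 p.2] (total_orderP r_tot r_anti r_tr).

Lemma ole_mk r r_tot r_anti r_tr : ole (@mk_order r r_tot r_anti r_tr) =2 r.
Proof. by move=> a b; rewrite /ole SubK inE. Qed.

Lemma ole_total R : total (ole R).
Proof.
by move=> a b; case/and3P: (valP R) => /forallP/(_ a)/forallP/(_ b).
Qed.

Lemma ole_anti R : antisymmetric (ole R).
Proof.
move=> a b; case/and3P: (valP R) => _ /forallP/(_ a)/forallP/(_ b)/implyP aR _.
by move/aR/eqP.
Qed.

Lemma ole_trans R : transitive (ole R).
Proof.
move=> b a c ab bc; case/and3P: (valP R) => _ _.
by move/forallP/(_ a)/forallP/(_ b)/forallP/(_ c)/implyP; apply; apply/andP.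
Qed.

Lemma olexx R a : ole R a a.
Proof. by have := ole_total R a a; rewrite orbb. Qed.

Lemma ole_inj R S : ole R =2 ole S -> R = S.
Proof. by move=> RS; apply/val_inj/setP=> -[a b]; apply: RS. Qed.

(* Sign of the permutation carrying the order R to the order S when the
   elements of T have degree deg: one sign for each pair of odd elements which
   R and S order differently. *)
Definition koszul (deg : T -> int) (R S : torder) : rat :=
  (-1) ^+ #|[set p : T * T | [&& p.1 != p.2, ole R p.1 p.2, ole S p.2 p.1,
                                odd `|deg p.1| & odd `|deg p.2|]]|.

End Orders.

Section OrderImage.
Variables (T U : finType) (f : U -> T) (f_inj : injective f) (R : torder T).

Lemma pullback_total : total (fun a b => ole R (f a) (f b)).
Proof. by move=> a b; apply: ole_total. Qed.

Lemma pullback_anti : antisymmetric (fun a b => ole R (f a) (f b)).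
Proof. by move=> a b /ole_anti/f_inj. Qed.

Lemma pullback_trans : transitive (fun a b => ole R (f a) (f b)).
Proof. by move=> b a c; apply: ole_trans. Qed.

Definition pullback : torder U :=
  mk_order pullback_total pullback_anti pullback_trans.

End OrderImage.

(* Graphs with k external vertices, n internal vertices and e edges.  Vertices
   and edges are numbered, the numberings being forgotten by [relabel] below;
   external and internal vertices are kept apart. *)
Definition vertex (k n : nat) : finType := ('I_k + 'I_n)%type.

(* The orientation set, i.e. the set of vertices and edges. *)
Definition cell (k n e : nat) : finType := (vertex k n + 'I_e)%type.

(* Edge j is oriented from (g j).1 to (g j).2. *)
Definition digraph (k n e : nat) : finType :=
  {ffun 'I_e -> vertex k n * vertex k n}.

Definition ograph (k n e : nat) : finType :=
  (digraph k n e * torder (cell k n e))%type.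

(* (j, false) is the source half of edge j and (j, true) its target half. *)
Definition halfedge (e : nat) : finType := ('I_e * bool)%type.

Section Graph.
Variables (k n e : nat).
Implicit Types (g : digraph k n e) (x y : vertex k n) (j : 'I_e).
Implicit Types (S : {set cell k n e}).

Definition vcell x : cell k n e := inl x.
Definition ecell j : cell k n e := inr j.
Definition ext (i : 'I_k) : vertex k n := inl i.
Definition int_ (i : 'I_n) : vertex k n := inr i.

Definition endpoint g (h : halfedge e) : vertex k n :=
  if h.2 then (g h.1).2 else (g h.1).1.

Definition halves g x : {set halfedge e} := [set h | endpoint g h == x].
Definition valence g x : nat := #|halves g x|.

Definition incident g x j : bool := ((g j).1 == x) || ((g j).2 == x).

(* A set of cells stands for the subspace of the geometric realisation made of
   its vertices and its open edges. *)
Definition adj g S : rel (cell k n e) := fun c d =>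
  [&& c \in S, d \in S &
    match c, d with
    | inl x, inr j | inr j, inl x => incident g x j
    | _, _ => false
    end].

Definition connected_in g S : bool :=
  (S != set0) && [forall c in S, forall d in S, connect (adj g S) c d].

Definition component g S (c : cell k n e) : {set cell k n e} :=
  [set d in S | connect (adj g S) c d].

(* First Betti number of a connected set of cells. *)
Definition betti1 S : nat :=
  (#|[set j | ecell j \in S]|.+1 - #|[set x | vcell x \in S]|)%N.

Definition is_tree g S : bool := connected_in g S && (betti1 S == 0%N).

Definition tree_type g j : bool :=
  let S := [set~ ecell j] in
  ~~ connected_in g S &&
  (is_tree g (component g S (vcell (g j).1))
     (+) is_tree g (component g S (vcell (g j).2))).

Definition frame g : {set cell k n e} :=
  [set c | match c with
           | inl x => [exists j, ~~ tree_type g j && incident g x j]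
           | inr j => ~~ tree_type g j
           end].

Definition cut_vertex g S x : bool :=
  (vcell x \in S) && ~~ connected_in g (S :\ vcell x).

Definition is_hair g j : bool :=
  tree_type g j &&
  [exists x, exists y,
    [&& (g j == (x, y)) || (g j == (y, x)), valence g x == 1%N,
        vcell y \in frame g
      & [forall j', tree_type g j' && incident g y j' ==> (j' == j)]]].

Definition admissible g : bool :=
  [&& connected_in g setT, (0 < k)%N,
      [forall i, valence g (ext i) == 1%N]
    & [forall i, (3 <= valence g (int_ i))%N]].

Definition two_loop_hairy g : bool :=
  [&& admissible g, betti1 [set: cell k n e] == 2%N,
      [forall x, ~~ cut_vertex g (frame g) x]
    & [forall j, tree_type g j ==> is_hair g j]].

Definition defect g : nat := (\sum_(i < n) (valence g (int_ i) - 3))%N.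

End Graph.

Section Relabel.
Variables (k n e : nat) (s : 'S_k) (t : 'S_n) (u : 'S_e).

Definition relabel_vertex (x : vertex k n) : vertex k n :=
  match x with inl i => inl (s i) | inr i => inr (t i) end.

Definition relabel_cell (c : cell k n e) : cell k n e :=
  match c with inl x => inl (relabel_vertex x) | inr j => inr (u j) end.

End Relabel.

Section RelabelGraph.
Variables (k n e : nat) (s : 'S_k) (t : 'S_n) (u : 'S_e).

Lemma relabel_cellK :
  cancel (relabel_cell s^-1%g t^-1%g u^-1%g) (@relabel_cell k n e s t u).
Proof. by case=> [[i|i]|j] /=; rewrite permKV. Qed.

Definition relabel (o : ograph k n e) : ograph k n e :=
  ([ffun j => let p := o.1 ((u^-1)%g j) in
              (relabel_vertex s t p.1, relabel_vertex s t p.2)],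
   pullback (can_inj relabel_cellK) o.2).

End RelabelGraph.

Section Degree.
Variables (m N k n e : nat).

Definition cell_deg (c : cell k n e) : int :=
  match c with
  | inl (inl _) => - m%:Z
  | inl (inr _) => - N%:Z
  | inr _ => N%:Z - 1
  end.

Definition total_deg : int := \sum_(c : cell k n e) cell_deg c.

End Degree.

Section Flip.
Variables (k n e : nat).

Definition flip (j : 'I_e) (o : ograph k n e) : ograph k n e :=
  ([ffun i => if i == j then ((o.1 i).2, (o.1 i).1) else o.1 i], o.2).

End Flip.

Section PrependTwo.
Variables (T : finType) (R : torder T).

(* The order on bool + T in which false comes first and true second; they
   stand for the new vertex and the new edge of an expansion. *)
Definition prepend_le (a b : bool + T) : bool :=
  match a, b with
  | inl x, inl y => x ==> y
  | inl _, inr _ => true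
  | inr _, inl _ => false
  | inr x, inr y => ole R x y
  end.

Lemma prepend_total : total prepend_le.
Proof. by move=> [[]|a] [[]|b] //=; apply: ole_total. Qed.

Lemma prepend_anti : antisymmetric prepend_le.
Proof. by move=> [[]|a] [[]|b] //= /ole_anti ->. Qed.

Lemma prepend_trans : transitive prepend_le.
Proof. by move=> [[]|b] [[]|a] [[]|c] //=; apply: ole_trans. Qed.

Definition prepend : torder (bool + T)%type :=
  mk_order prepend_total prepend_anti prepend_trans.

End PrependTwo.

Section Expand.
Variables (k n e : nat).

Definition up_vertex (x : vertex k n) : vertex k n.+1 :=
  match x with inl i => inl i | inr i => inr (lift ord0 i) end.

(* The new vertex and the new edge both get number 0. *)
Definition down (c : cell k n.+1 e.+1) : bool + cell k n e :=
  match c with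
  | inl (inl i) => inr (inl (inl i))
  | inl (inr i) => if unlift ord0 i is Some i' then inr (inl (inr i'))
                   else inl false
  | inr j => if unlift ord0 j is Some j' then inr (inr j') else inl true
  end.

Lemma down_inj : injective down.
Proof.
move=> [[i|i]|i] [[j|j]|j] //=.
- by case=> ->.
- by case: unliftP.
- by case: unliftP.
- by case: unliftP.
- by case: unliftP => [i' ->|->]; case: unliftP => [j' ->|->] // -[->].
- by case: unliftP => [i' ->|->]; case: unliftP => [j' ->|->].
- by case: unliftP.
- by case: unliftP => [i' ->|->]; case: unliftP => [j' ->|->].
- by case: unliftP => [i' ->|->]; case: unliftP => [j' ->|->] // -[->].
Qed.

(* Replaces the internal vertex v by an edge from the old vertex to the new
   one, the half-edges in A being moved to the new vertex. *)
Definition expand (o : ograph k n e) (v : 'I_n) (A : {set halfedge e}) :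
    ograph k n.+1 e.+1 :=
  let att (h : halfedge e) : vertex k n.+1 :=
    if h \in A then inr ord0 else up_vertex (endpoint o.1 h) in
  ([ffun j => if unlift ord0 j is Some j' then (att (j', false), att (j', true))
              else (inr (lift ord0 v), inr ord0)],
   pullback down_inj (prepend o.2)).

Definition splittings (g : digraph k n e) (v : 'I_n) :
    {set {set {set halfedge e}}} :=
  [set P | [&& partition P (halves g (int_ k v)), #|P| == 2%N
             & [forall A in P, (2 <= #|A|)%N]]].

End Expand.

Section Chains.
Variables (m N : nat).

Definition chain (k n e : nat) : vectType rat := free_space (ograph k n e).

(* Isomorphism, reversal of one edge, and change of the order.  The relations
   are imposed on all labelled graphs, admissible or not; since they preserve
   admissibility this does not change the span of the admissible ones. *)
Definition graph_rel k n e : {vspace chain k n e} :=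
  ((\sum_(o : ograph k n e) \sum_(s : 'S_k) \sum_(t : 'S_n) \sum_(u : 'S_e)
      <[delta (relabel s t u o) - delta o]>)
   + (\sum_(o : ograph k n e) \sum_(j < e)
        <[delta (flip j o) - (-1) ^+ N *: delta o]>)
   + (\sum_(o : ograph k n e) \sum_(R : torder (cell k n e))
        <[delta (o.1, R) - koszul (@cell_deg m N k n e) o.2 R *: delta o]>))%VS.

(* Which of the two blocks of P is moved to the new vertex does not matter
   modulo graph_rel. *)
Definition boundary_graph k n e (o : ograph k n e) : chain k n.+1 e.+1 :=
  \sum_(v < n) \sum_(P in splittings o.1 v)
     delta (expand o v (odflt set0 [pick A in P])).

Definition boundary k n e : 'Hom(chain k n e, chain k n.+1 e.+1) :=
  extend (@boundary_graph k n e).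

Definition GC k n e : vectType rat := quot (graph_rel k n e).

Definition gclass k n e (o : ograph k n e) : GC k n e :=
  quot_pi (graph_rel k n e) (delta o).

(* The part of the graph-complex with k external vertices, n internal vertices
   and e edges. *)
Definition graph_complex k n e : {vspace GC k n e} :=
  (\sum_(o : ograph k n e | admissible o.1) <[gclass o]>)%VS.

(* Well defined on the quotient by boundary_rel and diffE below. *)
Definition diff k n e : 'Hom(GC k n e, GC k n.+1 e.+1) :=
  quot_map (graph_rel k n e) (graph_rel k n.+1 e.+1) (boundary k n e).

Definition two_loop k n e (i : nat) : {vspace GC k n e} :=
  (\sum_(o : ograph k n e | two_loop_hairy o.1 && (defect o.1 == i))
     <[gclass o]>)%VS.

Lemma two_loop_sub k n e i : (two_loop k n e i <= graph_complex k n e)%VS.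
Proof.
apply/subv_sumP=> o /andP[/and4P[adm _ _ _] _].
exact: (sumv_sup o).
Qed.

(* Z / B for B a subspace of Z. *)
Definition homology (V : vectType rat) (Z B : {vspace V}) :
  {vspace quot B} := (quot_pi B @: Z)%VS.
End Chains.

Section WellDefined.
Variables (m N : nat).

Lemma boundary_delta k n e (o : ograph k n e) :
  boundary k n e (delta o) = boundary_graph o.
Proof. exact: extend_delta. Qed.

Lemma rel_relabel k n e s t u (o : ograph k n e) :
  delta (relabel s t u o) - delta o \in graph_rel m N k n e.
Proof.
apply/(subvP (addvSl _ _))/(subvP (addvSl _ _)).
rewrite memvE; apply: (sumv_sup o) => //; apply: (sumv_sup s) => //.
by apply: (sumv_sup t) => //; apply: (sumv_sup u).
Qed.

Lemma rel_flip k n e j (o : ograph k n e) :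
  delta (flip j o) - (-1) ^+ N *: delta o \in graph_rel m N k n e.
Proof.
apply/(subvP (addvSl _ _))/(subvP (addvSr _ _)).
by rewrite memvE; apply: (sumv_sup o) => //; apply: (sumv_sup j).
Qed.

Lemma rel_order k n e (o : ograph k n e) R :
  delta (o.1, R) - koszul (@cell_deg m N k n e) o.2 R *: delta o
    \in graph_rel m N k n e.
Proof.
apply/(subvP (addvSr _ _)).
by rewrite memvE; apply: (sumv_sup o) => //; apply: (sumv_sup R).
Qed.

Lemma ograph_eq k n e (o o' : ograph k n e) :
  o.1 =1 o'.1 -> ole o.2 =2 ole o'.2 -> o = o'.
Proof.
by case: o o' => [g R] [g' R'] /= /ffunP -> /ole_inj ->.
Qed.

Lemma relabel_cell_inj k n e (s : 'S_k) (t : 'S_n) (u : 'S_e) :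
  injective (relabel_cell s t u).
Proof.
by move=> [[i|i]|j] [[i'|i']|j'] //= [] /perm_inj ->.
Qed.

Definition relabel_half e (u : 'S_e) (h : halfedge e) : halfedge e := (u h.1, h.2).

Lemma relabel_half_inj e (u : 'S_e) : injective (relabel_half u).
Proof. by move=> [j b] [j' b'] [/perm_inj -> ->]. Qed.

Lemma endpoint_relabel k n e s t u (o : ograph k n e) h :
  endpoint (relabel s t u o).1 (relabel_half u h)
  = relabel_vertex s t (endpoint o.1 h).
Proof. by rewrite /endpoint /= ffunE permK; case: ifP. Qed.

Lemma relabel_vertex_inj k n (s : 'S_k) (t : 'S_n) :
  injective (relabel_vertex s t).
Proof. by move=> [i|i] [j|j] //= [/perm_inj ->]. Qed.

Lemma halves_relabel k n e s t u (o : ograph k n e) x :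
  halves (relabel s t u o).1 (relabel_vertex s t x)
  = relabel_half u @: halves o.1 x.
Proof.
apply/setP=> h; have -> : h = relabel_half u (relabel_half u^-1%g h).
  by case: h => j b; rewrite /relabel_half /= permKV.
rewrite (mem_imset _ _ (@relabel_half_inj _ u)) !inE endpoint_relabel.
by rewrite (inj_eq (@relabel_vertex_inj _ _ s t)).
Qed.

Lemma expand_relabel k n e (s : 'S_k) (t : 'S_n) (u : 'S_e) (o : ograph k n e)
    v (A : {set halfedge e}) :
  expand (relabel s t u o) (t v) (relabel_half u @: A)
  = relabel s (lift_perm ord0 ord0 t) (lift_perm ord0 ord0 u) (expand o v A).
Proof.
apply: ograph_eq => [j | a b] /=.
  rewrite [LHS]ffunE [RHS]ffunE.
  have up_rel x : up_vertex (relabel_vertex s t x)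
               = relabel_vertex s (lift_perm ord0 ord0 t) (up_vertex x).
    by case: x => i //=; rewrite lift_perm_lift.
  have att h :
    (if relabel_half u h \in relabel_half u @: A then inr ord0
     else up_vertex (endpoint (relabel s t u o).1 (relabel_half u h)))
    = relabel_vertex s (lift_perm ord0 ord0 t)
        (if h \in A then inr ord0 else up_vertex (endpoint o.1 h)).
    rewrite (mem_imset _ _ (@relabel_half_inj _ u)) endpoint_relabel up_rel.
    by case: ifP => //= _; rewrite lift_perm_id.
  rewrite lift_permV /= ffunE.
  case: (unliftP ord0 j) => [j' ->|->] /=.
    rewrite lift_perm_lift liftK; have := att (u^-1%g j', false).
    by have := att (u^-1%g j', true); rewrite /relabel_half /= permKV => -> ->.
  by rewrite lift_perm_id unlift_none /= lift_perm_lift lift_perm_id.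
rewrite !ole_mk.
have down_rel c : down (relabel_cell s (lift_perm ord0 ord0 t)
    (lift_perm ord0 ord0 u) c)
  = match down c with inl x => inl x | inr d => inr (relabel_cell s t u d) end.
  case: c => [[i|i]|i] //=; case: (unliftP ord0 i) => [i' ->|->] /=;
  by rewrite ?lift_perm_lift ?lift_perm_id ?liftK ?unlift_none.
have [a' ->] : exists a', a = relabel_cell s (lift_perm ord0 ord0 t)
    (lift_perm ord0 ord0 u) a'.
  by eexists; apply: esym; apply: relabel_cellK.
have [b' ->] : exists b', b = relabel_cell s (lift_perm ord0 ord0 t)
    (lift_perm ord0 ord0 u) b'.
  by eexists; apply: esym; apply: relabel_cellK.
have K k1 n1 e1 (s1 : 'S_k1) (t1 : 'S_n1) (u1 : 'S_e1) c :
    relabel_cell s1^-1%g t1^-1%g u1^-1%g (relabel_cell s1 t1 u1 c) = c.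
  by case: c => [[i|i]|i] /=; rewrite permK.
rewrite !K !down_rel.
by case: (down a') (down b') => [x|c] [y|d] //=; rewrite ole_mk !K.
Qed.


Definition flip_half e (j : 'I_e) (h : halfedge e) : halfedge e :=
  (h.1, (h.1 == j) (+) h.2).

Lemma flip_halfK e (j : 'I_e) : involutive (flip_half j).
Proof. by move=> [i b]; rewrite /flip_half /= addbA addbb. Qed.

Lemma endpoint_flip k n e j (o : ograph k n e) h :
  endpoint (flip j o).1 (flip_half j h) = endpoint o.1 h.
Proof. by case: h => i b; rewrite /endpoint /= ffunE; case: eqP; case: b. Qed.

Lemma halves_flip k n e j (o : ograph k n e) x :
  halves (flip j o).1 x = flip_half j @: halves o.1 x.
Proof.
apply/setP=> h; rewrite -[h](flip_halfK j) (mem_imset _ _ (inv_inj (flip_halfK j))).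
by rewrite !inE endpoint_flip.
Qed.

Lemma expand_flip k n e j (o : ograph k n e) v (A : {set halfedge e}) :
  expand (flip j o) v (flip_half j @: A) = flip (lift ord0 j) (expand o v A).
Proof.
apply: ograph_eq => [i | a b] /=; last by rewrite !ole_mk.
rewrite !ffunE; case: (unliftP ord0 i) => [i' ->|->] //=.
rewrite (inj_eq lift_inj).
have att h : (h \in flip_half j @: A) = (flip_half j h \in A).
  by rewrite -{1}[h](flip_halfK j) (mem_imset _ _ (inv_inj (flip_halfK j))).
have ep h : endpoint (flip j o).1 h = endpoint o.1 (flip_half j h).
  by rewrite -{1}[h](flip_halfK j) endpoint_flip.
have := ep (i', false); have := ep (i', true); rewrite /= => -> ->.
by rewrite !att /flip_half /=; case: (i' == j).
Qed.

Lemma koszul_prepend k n e (R R' : torder (cell k n e)) :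
  koszul (@cell_deg m N k n.+1 e.+1) (pullback (@down_inj k n e) (prepend R))
    (pullback (@down_inj k n e) (prepend R'))
  = koszul (@cell_deg m N k n e) R R'.
Proof.
pose up (c : cell k n e) : cell k n.+1 e.+1 :=
  match c with inl x => inl (up_vertex x) | inr j => inr (lift ord0 j) end.
have upK c : down (up c) = inr c.
  by case: c => [[i|i]|i] //=; rewrite liftK.
have up_inj : injective up by move=> a b /(congr1 (@down k n e)); rewrite !upK => -[].
have up_deg c : @cell_deg m N _ _ _ (up c) = cell_deg m N c by case: c => [[]|].
have upP a c : down a = inr c -> a = up c.
  by move=> ac; apply: (@down_inj k n e); rewrite ac upK.
rewrite /koszul; congr (_ ^+ _).
pose upp (p : cell k n e * cell k n e) := (up p.1, up p.2).
have upp_inj : injective upp by move=> [a b] [a' b'] [/up_inj -> /up_inj ->].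
rewrite -(card_imset _ upp_inj); apply: eq_card => -[a b].
apply/idP/imsetP => [|[[a' b'] + ->]]; last first.
  by rewrite !inE /= !ole_mk !upK /= !up_deg (inj_eq up_inj).
rewrite inE /= !ole_mk; case Ea: (down a) => [[]|a']; case Eb: (down b) => [[]|b'];
  rewrite ?ole_mk //= ?andbF //; try by rewrite -(inj_eq (@down_inj k n e)) Ea Eb eqxx.
rewrite (upP _ _ Ea) (upP _ _ Eb) !up_deg (inj_eq up_inj) => Hab.
by exists (a', b'); rewrite // inE.
Qed.

Lemma koszul_swap (T : finType) (deg : T -> int) (R R' : torder T) x y :
  x != y -> (forall z, ole R x z) -> deg x = deg y ->
  (forall a b, ole R' a b = ole R (tperm x y a) (tperm x y b)) ->
  koszul deg R R' = (-1) ^+ `|deg x|.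
Proof.
move=> xy minx dxy RR'; rewrite -[RHS]signr_odd /koszul.
have Rx z : ole R z x -> z = x by move=> zx; apply: (@ole_anti _ R); rewrite zx minx.
have Rab a b : ole R a b -> ole R b a -> a = b.
  by move=> ab ba; apply: (@ole_anti _ R); rewrite ab ba.
have tD z : z != x -> z != y -> tperm x y z = z.
  by move=> zx zy; rewrite tpermD // eq_sym.
case Ex: (odd _); last first.
  rewrite (_ : [set _ | _] = set0) ?cards0 //; apply/setP=> -[a b].
  rewrite !inE /= RR'; apply/negP=> /and5P[ab Eab Eba oa ob].
  have nx c : odd `|deg c| -> tperm x y c = c.
    by move=> oc; apply: tpermD; apply/eqP=> E; move: oc; rewrite -E -?dxy Ex.
  by move: Eba ab; rewrite !nx // => /(Rab _ _ Eab) ->; rewrite eqxx.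
pose Z := [set z | [&& z != x, z != y, ole R z y & odd `|deg z|]].
rewrite (_ : [set _ | _] =
  (x, y) |: ([set (x, z) | z in Z] :|: [set (z, y) | z in Z])); last first.
  apply/setP=> -[a b]; rewrite !inE /= RR' !xpair_eqE.
  have -> : ((a, b) \in [set (x, z) | z in Z]) = (a == x) && (b \in Z).
    apply/imsetP/andP=> [[z zZ [-> ->]]|[/eqP-> bZ]]; first by rewrite eqxx.
    by exists b.
  have -> : ((a, b) \in [set (z, y) | z in Z]) = (b == y) && (a \in Z).
    apply/imsetP/andP=> [[z zZ [-> ->]]|[/eqP-> bZ]]; first by rewrite eqxx.
    by exists a.
  rewrite !inE.
  have [->|ax] := eqVneq a x.
    rewrite minx tpermL Ex /=; have [->|by_] := eqVneq b y.
      by rewrite xy tpermR minx -dxy Ex.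
    have [->|bx] := eqVneq b x; first by [].
    by rewrite tD //= orbF.
  have [->|ay] := eqVneq a y.
    rewrite tpermR /= andbF; apply/negP=> /and5P[yb Eyb /Rx Eb _ _].
    have [Ebx|bx] := eqVneq b x; first by move: Eyb xy; rewrite Ebx => /Rx ->; rewrite eqxx.
    by move: Eb; rewrite tD // 1?eq_sym // => /eqP; rewrite (negPf bx).
  rewrite /= (tD a) //.
  have [->|by_] := eqVneq b y; first by rewrite ay tpermR minx -dxy Ex andbT.
  apply/negP=> /and5P[ab Eab Eba _ _].
  have [Ebx|bx] := eqVneq b x; first by move: Eab ax; rewrite Ebx => /Rx ->; rewrite eqxx.
  by move: Eba ab; rewrite tD // => /(Rab _ _ Eab) ->; rewrite eqxx.
rewrite cardsU1 !inE !negb_or.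
have -> : (x, y) \notin [set (x, z) | z in Z].
  by apply/imsetP=> -[z]; rewrite inE => /and4P[_ + _ _] [Ez]; rewrite Ez eqxx.
have -> : (x, y) \notin [set (z, y) | z in Z].
  by apply/imsetP=> -[z]; rewrite inE => /and4P[+ _ _ _] [Ez]; rewrite Ez eqxx.
rewrite cardsU (_ : _ :&: _ = set0); last first.
  apply/setP=> p; rewrite !inE; apply/negP=> /andP[/imsetP[z _ ->] /imsetP[z']].
  by rewrite inE => /and4P[+ _ _ _] [Ez _]; rewrite Ez eqxx.
rewrite cards0 subn0 !card_imset ?addnn ?exprS ?exprM; first last.
- by move=> a b [].
- by move=> a b [].
by rewrite -signr_odd odd_double mulr1.
Qed.


Lemma splittings_blocks k n e (g : digraph k n e) v P A B :
  P \in splittings g v -> A \in P -> B \in P -> A != B ->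
  forall h, (h \in B) = (endpoint g h == int_ k v) && (h \notin A).
Proof.
rewrite inE => /and3P[/and3P[/eqP covP /trivIsetP trP _] P2 _] AP BP AB h.
have defP : P = [set A; B].
  apply/esym/eqP; rewrite eqEcard subUset !sub1set AP BP (eqP P2) /=.
  by rewrite cards2 AB.
have : h \in halves g (int_ k v) = ((h \in A) || (h \in B)).
  by rewrite -covP defP /cover big_setU1 ?inE // big_set1.
rewrite inE => ->; have /pred0P/(_ h)/= := trP A B AP BP AB.
by case: (h \in A); case: (h \in B).
Qed.

Lemma expand_swap k n e (o : ograph k n e) v P A B :
  P \in splittings o.1 v -> A \in P -> B \in P ->
  delta (expand o v A) - delta (expand o v B) \in graph_rel m N k n.+1 e.+1.
Proof.
move=> PP AP BP; have [->|AB] := eqVneq A B; first by rewrite subrr mem0v.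
set t : 'S_n.+1 := tperm ord0 (lift ord0 v).
pose o2 := relabel 1%g t 1%g (expand o v A); pose o3 := flip ord0 o2.
have eB : expand o v B = (o3.1, (expand o v B).2).
  apply: ograph_eq => [j|a b] //=.
  rewrite !ffunE /= invg1 perm1.
  case: (unliftP ord0 j) => [j' ->|->] /=; last first.
    by rewrite /t tpermL tpermR.
  have att h : (if h \in B then inr ord0 else up_vertex (endpoint o.1 h)) =
    relabel_vertex 1%g t
      (if h \in A then inr ord0 else up_vertex (endpoint o.1 h)).
    have AP' : (h \in A) = (endpoint o.1 h == int_ k v) && (h \notin B).
      by apply: splittings_blocks PP _ _ _ _; rewrite // eq_sym.
    rewrite (splittings_blocks PP AP BP AB).
    case: (h \in A) AP' => [/esym/andP[/eqP-> _]|_] /=.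
      by rewrite andbF /= /t tpermL.
    rewrite andbT; case: eqP => [->|] /=; first by rewrite /t tpermR.
    case: (endpoint _ _) => i /=; first by rewrite perm1.
    move=> iv; rewrite /t tpermD ?neq_lift // (inj_eq lift_inj).
    by apply/eqP=> vi; apply: iv; rewrite vi.
  by rewrite !att.
have ks : koszul (@cell_deg m N k n.+1 e.+1) o3.2 (expand o v B).2 = (-1) ^+ N.
  have ti c : relabel_cell 1^-1%g t^-1%g 1^-1%g c
      = tperm (inl (inr (lift ord0 v)) : cell k n.+1 e.+1) (inl (inr ord0)) c.
    rewrite /t !invg1 tpermV; case: c => [[i|i]|i] /=.
- by rewrite perm1 tpermD.
    - case: (tpermP ord0 (lift ord0 v) i) => [->|->|i0 iv]; rewrite ?tpermR ?tpermL //.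
      rewrite tpermD //; apply/eqP.
        by move=> [E]; apply: iv; rewrite /= E.
      by move=> [E]; apply: i0; rewrite /= E.
    by rewrite perm1 tpermD.
  rewrite (@koszul_swap _ _ _ _ (inl (inr (lift ord0 v))) (inl (inr ord0))) //.
  - by rewrite /= abszN.
  - move=> z; rewrite /o3 /= !ole_mk ti tpermL /= ?unlift_none.
    by case: (down _) => [[]|].
  by move=> a b; rewrite /o3 /= !ole_mk !ti !tpermK.
have := rel_order o3 (expand o v B).2; rewrite -eB ks => r1.
have r2 := rel_flip ord0 o2.
have r3 := rel_relabel 1%g t 1%g (expand o v A).
rewrite -memvN opprB.
have -> : delta (expand o v B) - delta (expand o v A)
  = (delta (expand o v B) - (-1) ^+ N *: delta o3)
    + (-1) ^+ N *: (delta o3 - (-1) ^+ N *: delta o2)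
    + (delta o2 - delta (expand o v A)).
  rewrite scalerBr scalerA -expr2 sqrr_sign scale1r.
  by rewrite !addrA !subrK.
by apply: memvD r3; apply: memvD r1 _; apply: memvZ.
Qed.


Lemma pick_block k n e (g : digraph k n e) v P :
  P \in splittings g v -> odflt set0 [pick A in P] \in P.
Proof.
rewrite inE => /and3P[_ P2 _]; case: pickP => [A|P0] //=.
by move: P2; rewrite (eq_card0 P0).
Qed.

Lemma splittings_imset k n e (g g' : digraph k n e) v v' (f : halfedge e -> halfedge e)
    (P : {set {set halfedge e}}) :
  injective f -> halves g' (int_ k v') = f @: halves g (int_ k v) ->
  ([set f @: (A : {set halfedge e}) | A in P] \in splittings g' v')
  = (P \in splittings g v).
Proof.
move=> f_inj hh; rewrite !inE hh imset_partition // card_imset; last first.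
  exact: imset_inj.
congr [&& _, _ & _]; apply/forall_inP/forall_inP => [H A AP|H _ /imsetP[A AP ->]].
  by have := H _ (imset_f _ AP); rewrite card_imset.
by rewrite card_imset // H.
Qed.

(* A bijection of half-edges which matches expansions up to the scalar a. *)
Lemma boundary_match k n e (o o' : ograph k n e) (a : rat)
    (h : 'I_n -> 'I_n) (f : halfedge e -> halfedge e) :
  injective h -> injective f ->
  (forall v, halves o'.1 (int_ k (h v)) = f @: halves o.1 (int_ k v)) ->
  (forall v (A : {set halfedge e}), delta (expand o' (h v) (f @: A)) - a *: delta (expand o v A)
     \in graph_rel m N k n.+1 e.+1) ->
  boundary_graph o' - a *: boundary_graph o \in graph_rel m N k n.+1 e.+1.
Proof.
move=> h_inj f_inj hf exf; rewrite /boundary_graph.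
apply: (memv_sum_match (P' := fun v => splittings o'.1 v)
  (f := fun P : {set {set halfedge e}} => [set f @: (A : {set halfedge e}) | A in P])
  h_inj) => [|v P|v P PP].
- exact/imset_inj/imset_inj.
- exact: (splittings_imset _ f_inj (hf v)).
have AP := pick_block PP; move: AP; set A := odflt set0 _ => AP.
have PP' : [set f @: (A : {set halfedge e}) | A in P] \in splittings o'.1 (h v).
  by rewrite (splittings_imset _ f_inj (hf v)).
have r1 := expand_swap PP' (pick_block PP') (imset_f _ AP).
have := memvD r1 (exf v A); by rewrite addrA subrK.
Qed.

Lemma boundary_rel k n e :
  (boundary k n e @: graph_rel m N k n e <= graph_rel m N k n.+1 e.+1)%VS.
Proof.
rewrite /graph_rel !limgD !limg_sum !subv_add -!andbA.
apply/and3P; split.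
- apply/subv_sumP=> o _; rewrite limg_sum; apply/subv_sumP=> s _.
  rewrite limg_sum; apply/subv_sumP=> t _.
  rewrite limg_sum; apply/subv_sumP=> u _.
  apply: extend_line_sub1.
  apply: (@boundary_match _ _ _ _ _ _ t (relabel_half u)).
  + exact: perm_inj.
  + exact: relabel_half_inj.
  + by move=> v; rewrite -(halves_relabel s t u).
  + by move=> v A; rewrite expand_relabel scale1r rel_relabel.
- apply/subv_sumP=> o _; rewrite limg_sum; apply/subv_sumP=> j _.
  apply: extend_line_sub.
  apply: (@boundary_match _ _ _ _ _ _ id (flip_half j)) => //.
  + exact/inv_inj/flip_halfK.
  + by move=> v; rewrite -halves_flip.
  + by move=> v A; rewrite expand_flip rel_flip.
apply/subv_sumP=> o _; rewrite limg_sum; apply/subv_sumP=> R _.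
apply: extend_line_sub.
apply: (@boundary_match _ _ _ _ _ _ id id) => //.
  by move=> v; rewrite imset_id.
move=> v A; rewrite imset_id -koszul_prepend.
exact: (rel_order (expand o v A)).
Qed.

Lemma diffE k n e (o : ograph k n e) :
  diff m N k n e (gclass m N o) = quot_pi _ (boundary_graph o).
Proof. by rewrite /diff quot_mapE ?boundary_rel // boundary_delta. Qed.

End WellDefined.

(* The number k of external vertices and the defect of a two-loop hairy graph
   determine the numbers of its internal vertices and of its edges. *)
Section TwoLoopSizes.
Variables (k n e : nat).

Lemma sum_valence (g : digraph k n e) : (\sum_x valence g x = 2 * e)%N.
Proof.
have -> : (2 * e = \sum_(h : halfedge e) 1)%N.
  by rewrite sum1_card card_prod card_ord card_bool mulnC.
rewrite (partition_big (endpoint g) xpredT) //=; apply: eq_bigr => x _.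
by rewrite /valence -sum1_card; apply: eq_bigl => h; rewrite inE.
Qed.

Lemma two_loop_hairy_sizes (g : digraph k n e) : two_loop_hairy g ->
  (n + defect g = k.+2)%N /\ (e + defect g = (2 * k).+3)%N.
Proof.
case/and4P=> /and4P[_ _ /forallP ext1 /forallP int3] b2 _ _.
have : (defect g + 3 * n + k = 2 * e)%N.
  rewrite -(sum_valence g) big_sumType /= addnC; congr (_ + _)%N.
    rewrite (eq_bigr (fun=> 1%N)) => [|i _]; last exact/eqP/ext1.
    by rewrite sum1_card card_ord.
  rewrite /defect mulnC -[X in (_ + X * _)%N]card_ord -sum_nat_const -big_split.
  by apply: eq_bigr => i _ /=; rewrite subnK.
have : (e.+1 - (k + n) = 2)%N.
  move: b2; rewrite /betti1.
  have -> : [set j | ecell k n j \in [set: cell k n e]] = setT.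
    by apply/setP=> j; rewrite !inE.
  have -> : [set x | vcell e x \in [set: cell k n e]] = setT.
    by apply/setP=> j; rewrite !inE.
  by rewrite !cardsT card_sum !card_ord => /eqP.
lia.
Qed.

End TwoLoopSizes.

Section TwoLoopComplex.
Variables (m N k : nat).

(* C_2, C_1, C_0 in Hodge degree k; the sizes are those of
   two_loop_hairy_sizes. *)
Definition C2 := two_loop m N k k (2 * k).+1 2.
Definition C1 := two_loop m N k k.+1 (2 * k).+2 1.
Definition C0 := two_loop m N k k.+2 (2 * k).+3 0.

Definition d2 := diff m N k k (2 * k).+1.
Definition d1 := diff m N k k.+1 (2 * k).+2.

Definition H1 := homology (lker d1 :&: C1)%VS (d2 @: C2)%VS.
Definition H0 := homology C0 (d1 @: C1)%VS.

(* Each C_i lies in a single total degree. *)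
Definition euler_char : rat :=
  (-1) ^ total_deg m N k k (2 * k).+1 * (\dim C2)%:R
  + (-1) ^ total_deg m N k k.+1 (2 * k).+2 * (\dim C1)%:R
  + (-1) ^ total_deg m N k k.+2 (2 * k).+3 * (\dim C0)%:R.

End TwoLoopComplex.

(* A formal power series is given by its coefficients. *)
Definition series := nat -> rat.

Definition gen_fun (a : nat -> rat) : series :=
  fun k => if k is 0%N then 0 else a k.

(* f = P / Q in rat[[t]]. *)
Definition series_frac (f : series) (P Q : {poly rat}) : Prop :=
  Q`_0 != 0 /\ forall n, \sum_(i < n.+1) Q`_i * f (n - i)%N = P`_n.

(* Main.v *)
(* When m and N are even only the edges are odd, so an oriented two-loop hairy
   graph is a Theta with a, b, c hairs inside its three strands and p, q <= 1
   hairs at its two essential vertices, together with a word in its edges.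
   Exchanging two strands, which carry an odd number 2a + 1 of edges each,
   changes the sign, and exchanging the essential vertices multiplies by
   (-1)^(pq + a + b + c).  Hence C_d in Hodge degree k has as a basis the graphs
   with a > b > c, a + b + c = k - d, except that C_2 vanishes for k even and C_0
   for k odd.  The differential moves a hair from an essential vertex to each of
   the strands, so up to a nonzero factor it maps (a, b, c) to (a+1, b, c) plus
   terms with a larger b + c: it is injective on C_1 for k even and on C_2 for k
   odd.  The homology is then the cokernel, of dimension the number of triples
   a > b > c which are not of the form (a'+1, b, c), i.e. with a = b + 1, and this
   number is k %/ 6. *)
Require Import Defs.
From mathcomp Require Import all_boot all_order all_algebra all_fingroup.
From mathcomp Require Import zify ring boolp.
Set Implicit Arguments.
Unset Strict Implicit.
Unset Printing Implicit Defensive.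
Import Order.TTheory GRing.Theory Num.Theory.
Local Open Scope ring_scope.

(** Two-loop hairy graphs are defined by connectivity and cut vertices, and their classes live in a
    quotient; each point needs a translation. First, for k > 0 a graph is two-loop hairy exactly
    when it carries an explicit [theta] with at most one hair at each essential vertex. Extracting
    the three strands is the hard direction. The frame punctured at a vertex v is connected, so its
    2n cells force at least 2n - 1 edge-vertex incidences, whereas there are 2(n+1) - deg v of them.
    Hence deg v <= 3, and if deg v = 3 the punctured frame is a tree; rooted at the other essential
    vertex it directs every frame edge. Second, a class multiplied by the sign of its edge word
    depends only on the shape, but a quotient does not show that such a vector is nonzero. This is
    certified by linear forms compatible with all relations. They are nonzero because a
    Theta-structure with three distinct strand lengths is rigid: up to reversal, the graph and the
    shape determine the word. *)

Lemma sign_congr (a b : nat) : odd a = odd b -> (-1) ^+ a = (-1) ^+ b :> rat.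
Proof. by move=> ab; rewrite -signr_odd ab signr_odd. Qed.

(** * Signs of words in odd letters *)

Section Inversions.
Variables (T : eqType) (r : rel T).

Definition cross (A B : seq T) : nat :=
  sumn [seq count (fun b => ~~ r a b) B | a <- A].

Fixpoint inversions (l : seq T) : nat :=
  if l is x :: l' then (count (fun y => ~~ r x y) l' + inversions l')%N else 0%N.

Definition word_sign (l : seq T) : rat := (-1) ^+ inversions l.

Lemma word_sign_sq l : word_sign l * word_sign l = 1.
Proof. by rewrite /word_sign -expr2 sqrr_sign. Qed.

Lemma cross_cons a A B :
  cross (a :: A) B = (count (fun b => ~~ r a b) B + cross A B)%N.
Proof. by []. Qed.

Lemma cross_nilr A : cross A [::] = 0%N.
Proof. by elim: A. Qed.

Lemma cross_catr A B C : cross A (B ++ C) = (cross A B + cross A C)%N.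
Proof.
by elim: A => //= a A IH; rewrite !cross_cons IH count_cat addnACA.
Qed.

Lemma inversions_cat A B :
  inversions (A ++ B) = (inversions A + inversions B + cross A B)%N.
Proof.
elim: A => [|a A IH] /=; first by rewrite addn0.
by rewrite IH count_cat cross_cons; lia.
Qed.

Lemma cross_perml A A' B : perm_eq A A' -> cross A B = cross A' B.
Proof. by move=> AA'; apply/perm_sumn/perm_map. Qed.

Lemma cross_permr A B B' : perm_eq B B' -> cross A B = cross A B'.
Proof. by move=> BB'; congr sumn; apply: eq_map => a; apply/seq.permP. Qed.

Hypotheses (r_total : total r) (r_anti : antisymmetric r).

(** Two distinct letters are out of order in exactly one of the two arrangements. *)
Lemma cross_sym A B : uniq (A ++ B) ->
  (cross A B + cross B A = size A * size B)%N.
Proof.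
elim: A => [|a A IH] /=; first by rewrite cross_nilr.
rewrite mem_cat negb_or => /andP[/andP[aA aB] uAB].
rewrite cross_cons mulSn -(IH uAB) (cross_permr B (B' := A ++ [:: a])); last first.
  by rewrite -cat1s perm_catC.
rewrite cross_catr.
suff -> : size B = (count (fun b => ~~ r a b) B + cross B [:: a])%N by lia.
elim: B aB {IH uAB} => //= b B IH; rewrite inE negb_or cross_cons /= => /andP[ab /IH ->].
have : ~~ (r a b && r b a) by apply/negP=> /r_anti/eqP; rewrite (negPf ab).
have := r_total a b; case: (r a b); case: (r b a) => //=; lia.
Qed.

(** Inversions between blocks depend only on their multisets of letters, so only the inversions
    inside the middle block change. *)
Lemma word_sign_perm P A A' Q : perm_eq A A' ->
  word_sign (P ++ A' ++ Q) =
    word_sign A * word_sign A' * word_sign (P ++ A ++ Q).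
Proof.
move=> AA'; rewrite /word_sign !inversions_cat !cross_catr.
rewrite (cross_permr _ AA') (cross_perml _ AA') -!exprD.
apply: sign_congr; lia.
Qed.

Lemma word_sign_swap P A B Q : uniq (A ++ B) ->
  word_sign (P ++ B ++ A ++ Q) =
    (-1) ^+ (size A * size B) * word_sign (P ++ A ++ B ++ Q).
Proof.
move=> uAB; rewrite [B ++ A ++ Q]catA [A ++ B ++ Q]catA.
rewrite (@word_sign_perm P (A ++ B)) 1?perm_catC // -(cross_sym uAB).
congr (_ * _); rewrite /word_sign !inversions_cat -!exprD.
apply: sign_congr; rewrite !oddD; do !case: (odd _) => //.
Qed.

(** Each of the pairs of letters is inverted in exactly one of [l] and [rev l]. *)
Lemma inversions_rev l : uniq l -> (inversions (rev l) + inversions l = 'C(size l, 2))%N.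
Proof.
elim: l => //= a l IH /andP[al ul].
have ula : uniq (l ++ [:: a]) by rewrite cats1 rcons_uniq al.
rewrite rev_cons -cats1 inversions_cat (cross_perml [:: a] (A' := l)) ?perm_rev //.
have := cross_sym ula; have := IH ul.
rewrite binS bin1 /= muln1 cross_cons -[cross [::] l]/(0%N) /=; lia.
Qed.

Lemma word_sign_rev P A Q : uniq A ->
  word_sign (P ++ rev A ++ Q) =
    (-1) ^+ 'C(size A, 2) * word_sign (P ++ A ++ Q).
Proof.
move=> uA; rewrite (@word_sign_perm P A) 1?perm_sym ?perm_rev //.
by congr (_ * _); rewrite mulrC /word_sign -exprD inversions_rev.
Qed.

End Inversions.

Lemma word_sign_map (T U : eqType) (r : rel T) (r' : rel U) (f : T -> U) l :
  {in l &, forall x y, r' (f x) (f y) = r x y} ->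
  word_sign r' (map f l) = word_sign r l.
Proof.
move=> H; congr (_ ^+ _); elim: l H => //= x l IH H.
rewrite IH => [|y z yl zl]; last by rewrite H // inE ?yl ?zl orbT.
congr (_ + _)%N; rewrite count_map; apply: eq_in_count => y yl /=.
by rewrite H // inE ?eqxx ?yl ?orbT.
Qed.

(** * Koszul signs read off words of edges *)

Section Koszul.
Variables (m N k n e : nat).
Hypotheses (N_gt0 : (0 < N)%N) (m_even : ~~ odd m) (N_even : ~~ odd N).

Definition edge_rel (R : torder (cell k n e)) : rel 'I_e :=
  fun i j => ole R (ecell k n i) (ecell k n j).

Lemma edge_rel_total R : total (edge_rel R).
Proof. by move=> i j; apply: ole_total. Qed.

Lemma edge_rel_anti R : antisymmetric (edge_rel R).
Proof. by move=> i j /ole_anti[]. Qed.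

Lemma odd_cell_deg (c : cell k n e) :
  odd `|cell_deg m N c|%N = if c is inr _ then true else false.
Proof.
case: c => [[i|i]|j] /=; rewrite ?abszN ?absz_nat ?(negPf m_even) ?(negPf N_even) //.
lia.
Qed.

(** Only edges are odd. A pair of edges ordered differently by R and R' is an inversion of [l] for
    exactly one of them; a pair ordered alike is one for both or for neither and cancels modulo
    2. *)
Lemma koszul_word R R' (l : seq 'I_e) : perm_eq l (enum 'I_e) ->
  koszul (@cell_deg m N k n e) R R' =
    word_sign (edge_rel R) l * word_sign (edge_rel R') l.
Proof.
move=> le; have ul : uniq l by rewrite (perm_uniq le) enum_uniq.
pose K (s : seq 'I_e) := (\sum_(i <- s) \sum_(j <- s)
  [&& i != j, edge_rel R i j & edge_rel R' j i])%N.
(* K restricts the Koszul count to pairs of edges; being indexed by a list, it allows induction on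
   the word. *)
have -> : koszul (@cell_deg m N k n e) R R' = (-1) ^+ K l.
  congr (_ ^+ _); rewrite /K (perm_big _ le) /= big_enum /=.
  under eq_bigr => i _ do rewrite (perm_big _ le) /= big_enum /=.
  rewrite pair_big /= -sum1_card.
  pose f (p : 'I_e * 'I_e) : cell k n e * cell k n e := (ecell k n p.1, ecell k n p.2).
  have f_inj : injective f by move=> [a b] [c d] [-> ->].
  rewrite big_mkcond /= [RHS]big_mkcond /=.
  rewrite (bigID (mem [set f p | p in setT])) /= [X in (_ + X)%N]big1 ?addn0.
    rewrite big_imset /=; last by move=> x y _ _; apply: f_inj.
    rewrite big_mkcond; apply: eq_bigr => -[i j] _; rewrite !inE /= /edge_rel.
    have /= -> := odd_cell_deg (ecell k n i); rewrite !andbT.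
    by rewrite (inj_eq (inr_inj)); case: ifP.
  move=> [a b] /= /imsetP pf; case: ifP => //; rewrite inE /= => /and5P[_ _ _].
  rewrite !odd_cell_deg; case: a pf => // i; case: b => // j; case.
  by exists (i, j); rewrite ?inE.
have KE s : uniq s -> K s = inversions (edge_rel R) s + inversions (edge_rel R') s
   %[mod 2].
  elim: s => [|x s IH] /=; first by rewrite /K big_nil.
  move=> /andP[xs us]; rewrite /K big_cons big_cons eqxx /= add0n.
  under [X in (_ + X)%N]eq_bigr => i _ do rewrite big_cons.
  rewrite big_split /=.
  have parity X Y K0 c c' i i' : X + Y = c + c' %[mod 2] -> K0 = i + i' %[mod 2] ->
    X + (Y + K0) = (c + i) + (c' + i') %[mod 2] by lia.
  apply: parity (IH us) => /=.
  elim: s xs {IH us} => [|y s IH] /=; first by rewrite !big_nil.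
  rewrite inE negb_or => /andP[xy /IH]; rewrite !big_cons.
  have : ~~ (edge_rel R x y && edge_rel R y x).
    by apply/negP=> /edge_rel_anti/eqP; rewrite (negPf xy).
  have : ~~ (edge_rel R' x y && edge_rel R' y x).
    by apply/negP=> /edge_rel_anti/eqP; rewrite (negPf xy).
  have := edge_rel_total R x y; have := edge_rel_total R' x y.
  rewrite [y == x]eq_sym xy /=.
  case: (edge_rel R x y); case: (edge_rel R y x); case: (edge_rel R' x y);
    case: (edge_rel R' y x) => //=; lia.
rewrite /word_sign -exprD; apply: sign_congr.
by have := KE l ul; lia.
Qed.

End Koszul.

Notation hair k e := ('I_k * 'I_e)%type (only parsing).
Notation node k n e := ('I_n * hair k e * 'I_e)%type (only parsing).
Notation strand k n e := ('I_e * seq (node k n e))%type (only parsing).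
Notation link k n e := ('I_e * (vertex k n * vertex k n))%type (only parsing).

(** * Theta-graphs *)

Section Theta.
Variables (k n e : nat).

(** A link is an edge with its intended endpoints. The hairs along a strand are included, each
    directed towards its external vertex; the last link ends at w. *)
Fixpoint strand_links (x : 'I_n) (j : 'I_e) (l : seq (node k n e)) (w : 'I_n) : seq (link k n e) :=
  if l is (y, (i, h), j') :: l' then
    [:: (j, (int_ k x, int_ k y)), (h, (int_ k y, ext n i)) & strand_links y j' l' w]
  else [:: (j, (int_ k x, int_ k w))].

Definition hair_links (x : 'I_n) (hs : seq (hair k e)) : seq (link k n e) :=
  [seq (h.2, (int_ k x, ext n h.1)) | h <- hs].

Definition tail_word (l : seq (node k n e)) : seq 'I_e :=
  flatten [seq [:: p.1.2.2; p.2] | p <- l].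
Definition strand_word (s : strand k n e) : seq 'I_e := s.1 :: tail_word s.2.
Definition strand_nodes (s : strand k n e) : seq 'I_n := [seq p.1.1 | p <- s.2].
Definition strand_exts (s : strand k n e) : seq 'I_k := [seq p.1.2.1 | p <- s.2].

(* [((y, (i, h)), j)] is the inner vertex y of a strand, carrying the external
   vertex i at the end of the hair h and left by the edge j; a strand is its
   first edge and its inner vertices, listed from [source] to [sink]. *)
Record theta := Theta {
  source : 'I_n; sink : 'I_n; source_hair : seq (hair k e); sink_hair : seq (hair k e);
  strand1 : strand k n e; strand2 : strand k n e; strand3 : strand k n e }.
Implicit Types (t : theta) (s : strand k n e) (g : digraph k n e).

Definition links t : seq (link k n e) :=
  hair_links (source t) (source_hair t) ++ hair_links (sink t) (sink_hair t)
  ++ strand_links (source t) (strand1 t).1 (strand1 t).2 (sink t)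
  ++ strand_links (source t) (strand2 t).1 (strand2 t).2 (sink t)
  ++ strand_links (source t) (strand3 t).1 (strand3 t).2 (sink t).

(* As m and N are even only the edges are odd, so this word of edges carries the
   whole orientation. *)
Definition word t : seq 'I_e :=
  unzip2 (source_hair t) ++ unzip2 (sink_hair t)
  ++ strand_word (strand1 t) ++ strand_word (strand2 t) ++ strand_word (strand3 t).

Definition nodes t : seq 'I_n :=
  [:: source t, sink t & strand_nodes (strand1 t)
     ++ strand_nodes (strand2 t) ++ strand_nodes (strand3 t)].

Definition exts t : seq 'I_k :=
  unzip1 (source_hair t) ++ unzip1 (sink_hair t)
  ++ strand_exts (strand1 t) ++ strand_exts (strand2 t) ++ strand_exts (strand3 t).

Definition joins g (q : link k n e) : bool :=
  (g q.1 == q.2) || (g q.1 == (q.2.2, q.2.1)).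

(** The permutation conditions make t list every vertex and every edge exactly once, so t describes
    g completely up to the directions of the edges. *)
Definition theta_on t g : bool :=
  [&& perm_eq (nodes t) (enum 'I_n), perm_eq (exts t) (enum 'I_k),
      perm_eq (word t) (enum 'I_e) & all (joins g) (links t)].

(** This is ((p, q), (a, b, c)) in the notation of the overview. *)
Definition shape t : (nat * nat) * (nat * nat * nat) :=
  ((size (source_hair t), size (sink_hair t)),
   (size (strand1 t).2, size (strand2 t).2, size (strand3 t).2)).

Lemma unzip1_strand_links x j l w :
  unzip1 (strand_links x j l w) = strand_word (j, l).
Proof. by elim: l x j => [|[[y [i h]] j'] l IH] x j //=; rewrite IH. Qed.

Lemma unzip1_links t : unzip1 (links t) = word t.
Proof.
have hairE x hs : unzip1 (hair_links x hs) = unzip2 hs by rewrite /unzip1 -map_comp.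
have catE (a b : seq (link k n e)) : unzip1 (a ++ b) = unzip1 a ++ unzip1 b by rewrite /unzip1 map_cat.
rewrite /links !catE !hairE !unzip1_strand_links.
by case: t => ? ? ? ? [? ?] [? ?] [? ?].
Qed.

Lemma size_strand_word s : size (strand_word s) = (size s.2).*2.+1.
Proof. by case: s => j l; rewrite /strand_word /=; elim: l => //= p l [->]. Qed.

Lemma size_word t :
  size (word t) = (size (source_hair t) + size (sink_hair t)
    + (size (strand1 t).2 + size (strand2 t).2 + size (strand3 t).2).*2 + 3)%N.
Proof. rewrite /word !size_cat !size_strand_word !size_map; lia. Qed.

Lemma size_nodes t : size (nodes t) =
  (size (strand1 t).2 + size (strand2 t).2 + size (strand3 t).2).+2.
Proof. by rewrite /= !size_cat !size_map addnA. Qed.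

Lemma size_exts t : size (exts t) = (size (source_hair t) + size (sink_hair t)
  + (size (strand1 t).2 + size (strand2 t).2 + size (strand3 t).2))%N.
Proof. rewrite !size_cat !size_map; lia. Qed.

Lemma joins_sym g j x y : joins g (j, (x, y)) = joins g (j, (y, x)).
Proof. by rewrite /joins orbC. Qed.

(** A node stores the edge by which it is left. Read backwards it must store the edge by which it
    was entered, so edges and nodes are regrouped on the way, and plain list reversal would be
    wrong. *)
Fixpoint rev_append_strand (j : 'I_e) (l acc : seq (node k n e)) : strand k n e :=
  if l is (y, h, j') :: l' then rev_append_strand j' l' ((y, h, j) :: acc)
  else (j, acc).

Definition rev_strand s : strand k n e := rev_append_strand s.1 s.2 [::].

Lemma rev_strand_word s : strand_word (rev_strand s) = rev (strand_word s).
Proof.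
suff H j l acc : strand_word (rev_append_strand j l acc) =
    rev (strand_word (j, l)) ++ tail_word acc by case: s => j l; rewrite H cats0.
elim: l j acc => [|[[y [i h]] j'] l IH] j acc //=.
by rewrite IH /strand_word /= !rev_cons -!cats1 -!catA.
Qed.

Lemma rev_strand_nodes s : strand_nodes (rev_strand s) = rev (strand_nodes s).
Proof.
suff H j l acc : strand_nodes (rev_append_strand j l acc) =
    rev (strand_nodes (j, l)) ++ strand_nodes (j, acc).
  by case: s => j l; rewrite H cats0.
elim: l j acc => [|[[y [i h]] j'] l IH] j acc //=.
by rewrite IH /strand_nodes /= !rev_cons -!cats1 -!catA.
Qed.

Lemma rev_strand_exts s : strand_exts (rev_strand s) = rev (strand_exts s).
Proof.
suff H j l acc : strand_exts (rev_append_strand j l acc) =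
    rev (strand_exts (j, l)) ++ strand_exts (j, acc).
  by case: s => j l; rewrite H cats0.
elim: l j acc => [|[[y [i h]] j'] l IH] j acc //=.
by rewrite IH /strand_exts /= !rev_cons -!cats1 -!catA.
Qed.

Lemma size_rev_strand s : size (rev_strand s).2 = size s.2.
Proof.
by have := congr1 size (rev_strand_nodes s); rewrite size_rev !size_map.
Qed.

Lemma rev_strand_joins g x s w : all (joins g) (strand_links x s.1 s.2 w) ->
  all (joins g) (strand_links w (rev_strand s).1 (rev_strand s).2 x).
Proof.
(* Invariant of the accumulator: it is the reversed path from y back to x, lacking only its first
   edge, which is the one about to be traversed. *)
pose good y acc := if acc is (y', (i, h), j') :: acc' then
  [&& y' == y, joins g (h, (int_ k y, ext n i)) & all (joins g) (strand_links y j' acc' x)]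
  else y == x.
suff H y j l acc : all (joins g) (strand_links y j l w) -> good y acc ->
    all (joins g) (strand_links w (rev_append_strand j l acc).1
                     (rev_append_strand j l acc).2 x).
  by case: s => j l /H; apply; rewrite /good.
elim: l y j acc => [|[[y' [i h]] j'] l IH] y j acc /=.
  rewrite andbT joins_sym => jyw; case: acc => [|[[y' [i h]] j'] acc] /=.
    by move=> /eqP <-; rewrite jyw.
  by case/and3P=> /eqP -> -> ->; rewrite jyw.
case/and3P=> jyy' jh jl yacc; apply: (IH _ _ _ jl); rewrite /= eqxx jh /=.
case: acc yacc => [|[[y'' [i' h']] j''] acc] /=; first by move/eqP <-; rewrite joins_sym jyy'.
by case/and3P=> /eqP-> -> ->; rewrite joins_sym jyy'.
Qed.

Definition rev_theta t : theta :=
  Theta (sink t) (source t) (sink_hair t) (source_hair t)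
    (rev_strand (strand1 t)) (rev_strand (strand2 t)) (rev_strand (strand3 t)).

Definition swap12 t : theta :=
  Theta (source t) (sink t) (source_hair t) (sink_hair t)
    (strand2 t) (strand1 t) (strand3 t).

Definition swap23 t : theta :=
  Theta (source t) (sink t) (source_hair t) (sink_hair t)
    (strand1 t) (strand3 t) (strand2 t).

Lemma word_rev_theta t : word (rev_theta t) =
  unzip2 (sink_hair t) ++ unzip2 (source_hair t) ++ rev (strand_word (strand1 t))
  ++ rev (strand_word (strand2 t)) ++ rev (strand_word (strand3 t)).
Proof. by rewrite -!rev_strand_word. Qed.

Lemma theta_on_rev t g : theta_on t g -> theta_on (rev_theta t) g.
Proof.
case/and4P=> tn tx tw tj; apply/and4P; split.
- apply: perm_trans tn; rewrite /nodes /= !rev_strand_nodes.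
  apply/seq.permP=> a /=; rewrite !count_cat !count_rev; lia.
- apply: perm_trans tx; rewrite /exts /= !rev_strand_exts.
  apply/seq.permP=> a /=; rewrite !count_cat !count_rev; lia.
- apply: perm_trans tw; rewrite word_rev_theta /word.
  apply/seq.permP=> a; rewrite !count_cat !count_rev; lia.
move: tj; rewrite /links !all_cat /= => /and5P[-> -> t1 t2 t3].
by rewrite !rev_strand_joins.
Qed.

Lemma theta_on_swap12 t g : theta_on t g -> theta_on (swap12 t) g.
Proof.
case/and4P=> tn tx tw tj; apply/and4P; split.
- apply: perm_trans tn; rewrite /nodes /=.
  apply/seq.permP=> a /=; rewrite !count_cat; lia.
- apply: perm_trans tx; rewrite /exts /=.
  apply/seq.permP=> a /=; rewrite !count_cat; lia.
- apply: perm_trans tw; rewrite /word; cbn [swap12 swap23 strand1 strand2 strand3 source_hair sink_hair].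
  apply/seq.permP=> a; rewrite !count_cat; lia.
move: tj; rewrite /links !all_cat /= => /and5P[-> -> t1 t2 t3].
by rewrite t1 t2 t3.
Qed.

Lemma theta_on_swap23 t g : theta_on t g -> theta_on (swap23 t) g.
Proof.
case/and4P=> tn tx tw tj; apply/and4P; split.
- apply: perm_trans tn; rewrite /nodes /=.
  apply/seq.permP=> a /=; rewrite !count_cat; lia.
- apply: perm_trans tx; rewrite /exts /=.
  apply/seq.permP=> a /=; rewrite !count_cat; lia.
- apply: perm_trans tw; rewrite /word; cbn [swap12 swap23 strand1 strand2 strand3 source_hair sink_hair].
  apply/seq.permP=> a; rewrite !count_cat; lia.
move: tj; rewrite /links !all_cat /= => /and5P[-> -> t1 t2 t3].
by rewrite t1 t2 t3.
Qed.

Lemma shape_rev t : shape (rev_theta t) =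
  ((shape t).1.2, (shape t).1.1, (shape t).2).
Proof. by rewrite /shape /= !size_rev_strand. Qed.

Section WordSigns.
Variable r : rel 'I_e.
Hypotheses (r_total : total r) (r_anti : antisymmetric r).

Lemma word_sign_swap12 t : uniq (word t) ->
  word_sign r (word (swap12 t)) = - word_sign r (word t).
Proof.
rewrite /word; cbn [swap12 swap23 strand1 strand2 strand3 source_hair sink_hair] => uw; rewrite -[RHS]mulN1r.
set H1 := unzip2 _ in uw *; set H2 := unzip2 _ in uw *.
rewrite [H1 ++ _]catA [in RHS]catA.
rewrite (word_sign_swap r_total r_anti (H1 ++ H2) _ (A := strand_word (strand1 t))).
  rewrite !size_strand_word; congr (_ * _).
  by rewrite -[RHS]/((-1) ^+ 1%N); apply: sign_congr; lia.
rewrite catA cat_uniq in uw; case/and3P: uw => _ _ uw.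
by rewrite catA cat_uniq in uw; case/and3P: uw.
Qed.

Lemma word_sign_swap23 t : uniq (word t) ->
  word_sign r (word (swap23 t)) = - word_sign r (word t).
Proof.
rewrite /word; cbn [swap12 swap23 strand1 strand2 strand3 source_hair sink_hair] => uw; rewrite -[RHS]mulN1r.
set H1 := unzip2 _ in uw *; set H2 := unzip2 _ in uw *.
have catE a b c : H1 ++ H2 ++ a ++ b ++ c = (H1 ++ H2 ++ a) ++ b ++ c by rewrite -!catA.
rewrite !catE.
have := word_sign_swap r_total r_anti (H1 ++ H2 ++ strand_word (strand1 t)) [::]
  (A := strand_word (strand2 t)) (B := strand_word (strand3 t)).
rewrite !cats0 => ->; last first.
  by do 3 (rewrite cat_uniq in uw; case/and3P: uw => _ _ uw).
rewrite !size_strand_word; congr (_ * _).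
by rewrite -[RHS]/((-1) ^+ 1%N); apply: sign_congr; lia.
Qed.

(** Exchanging the two hair words costs (-1)^(pq). Reversing a strand word of length 2a + 1 costs
    (-1)^((2a+1)a) = (-1)^a. *)
Lemma word_sign_rev_theta t : uniq (word t) ->
  word_sign r (word (rev_theta t)) =
    (-1) ^+ (size (source_hair t) * size (sink_hair t)
      + (size (strand1 t).2 + size (strand2 t).2 + size (strand3 t).2))
    * word_sign r (word t).
Proof.
move=> uw; rewrite word_rev_theta.
have revP P s Q : uniq (strand_word s) ->
    word_sign r (P ++ rev (strand_word s) ++ Q) =
      (-1) ^+ size s.2 * word_sign r (P ++ strand_word s ++ Q).
  move=> us; rewrite word_sign_rev //; congr (_ * _); apply: sign_congr.
  rewrite size_strand_word bin2 /=; move: (size s.2) => p.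
  have -> : (p.*2.+1 * p.*2 = (p.*2.+1 * p).*2)%N by lia.
  by rewrite doubleK oddM /= odd_double.
move: uw; rewrite /word.
set H1 := unzip2 (source_hair t); set H2 := unzip2 (sink_hair t) => uw.
have [uH u1 u2 u3] : [/\ uniq (H1 ++ H2), uniq (strand_word (strand1 t)),
    uniq (strand_word (strand2 t)) & uniq (strand_word (strand3 t))].
  rewrite catA cat_uniq in uw; case/and3P: uw => -> _ uw.
  rewrite cat_uniq in uw; case/and3P: uw => -> _ uw.
  by rewrite cat_uniq in uw; case/and3P: uw.
rewrite (word_sign_swap r_total r_anti [::] _ uH) /=.
rewrite [H1 ++ _]catA revP // [(H1 ++ H2) ++ _]catA revP // [((H1 ++ H2) ++ _) ++ _]catA.
rewrite -[rev (strand_word (strand3 t))]cats0 revP // cats0 -!catA !mulrA -!exprD.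
by rewrite !size_map !addnA.
Qed.

End WordSigns.
End Theta.

Section MapTheta.
Variables (k n e k' n' e' : nat).
Variables (a : 'I_k -> 'I_k') (b : 'I_n -> 'I_n') (c : 'I_e -> 'I_e').

Definition map_node (p : node k n e) : node k' n' e' :=
  (b p.1.1, (a p.1.2.1, c p.1.2.2), c p.2).
Definition map_hair (h : hair k e) : hair k' e' := (a h.1, c h.2).
Definition map_strand (s : strand k n e) : strand k' n' e' :=
  (c s.1, map map_node s.2).
Definition map_vertex (x : vertex k n) : vertex k' n' :=
  match x with inl i => inl (a i) | inr i => inr (b i) end.
Definition map_link (q : link k n e) : link k' n' e' :=
  (c q.1, (map_vertex q.2.1, map_vertex q.2.2)).

Definition map_theta (t : theta k n e) : theta k' n' e' :=
  Theta (b (source t)) (b (sink t)) (map map_hair (source_hair t))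
    (map map_hair (sink_hair t)) (map_strand (strand1 t))
    (map_strand (strand2 t)) (map_strand (strand3 t)).

Lemma map_strand_links x s w :
  strand_links (b x) (map_strand s).1 (map_strand s).2 (b w)
  = map map_link (strand_links x s.1 s.2 w).
Proof. by case: s => j l; elim: l x j => [|[[y [i h]] j'] l IH] x j //=; rewrite IH. Qed.

Lemma links_map t : links (map_theta t) = map map_link (links t).
Proof.
have hairE x hs : hair_links (b x) (map map_hair hs) = map map_link (hair_links x hs).
  by rewrite /hair_links -!map_comp.
by rewrite /links !map_cat -!hairE -!map_strand_links.
Qed.

Lemma map_strand_word s : strand_word (map_strand s) = map c (strand_word s).
Proof.
case: s => j l; rewrite /strand_word /=; congr cons.
by elim: l => //= p l; rewrite /tail_word /= => ->.
Qed.

Lemma word_map t : word (map_theta t) = map c (word t).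
Proof.
rewrite /word !map_cat -!map_strand_word; congr (_ ++ (_ ++ _)).
  by rewrite /unzip2 /= -!map_comp.
by rewrite /unzip2 /= -!map_comp.
Qed.

Lemma map_strand_nodes s : strand_nodes (map_strand s) = map b (strand_nodes s).
Proof. by rewrite /strand_nodes -!map_comp. Qed.

Lemma map_strand_exts s : strand_exts (map_strand s) = map a (strand_exts s).
Proof. by rewrite /strand_exts -!map_comp. Qed.

Lemma nodes_map t : nodes (map_theta t) = map b (nodes t).
Proof. by rewrite /nodes /= !map_cat !map_strand_nodes. Qed.

Lemma exts_map t : exts (map_theta t) = map a (exts t).
Proof. by rewrite /exts /unzip1 /= !map_cat !map_strand_exts -!map_comp. Qed.

Lemma shape_map t : shape (map_theta t) = shape t.
Proof. by rewrite /shape /= !size_map. Qed.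

End MapTheta.

Lemma perm_of_enumerations (T : finType) (l l' : seq T) :
  perm_eq l (enum T) -> perm_eq l' (enum T) -> exists s : {perm T}, map s l = l'.
Proof.
move=> le le'; have ul : uniq l by rewrite (perm_uniq le) enum_uniq.
have ul' : uniq l' by rewrite (perm_uniq le') enum_uniq.
have sz : size l = size l' by rewrite (perm_size le) (perm_size le').
have il x : (index x l < size l)%N by rewrite index_mem (perm_mem le) mem_enum.
pose f x := nth x l' (index x l).
have f_inj : injective f.
  move=> x y; rewrite /f (set_nth_default y) -?sz // => /eqP.
  rewrite nth_uniq -?sz // => /eqP ixy.
  have xl : x \in l by rewrite -index_mem.
  have yl : y \in l by rewrite -index_mem.
  by rewrite -(nth_index x xl) ixy nth_index.
exists (perm f_inj).
case: l l' le le' ul ul' sz il @f f_inj => [|x0 l] [|y0 l'] // le le' ul ul' sz il f f_inj.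
apply: (@eq_from_nth _ x0) => [|i]; rewrite size_map // => il0.
rewrite (nth_map x0) // permE /f index_uniq //; apply: set_nth_default.
by rewrite -sz.
Qed.

(** * Theta-structures of equal shape are isomorphic *)

Section Iso.
Variables (k n e : nat).
Implicit Types (t : theta k n e) (g : digraph k n e).

Lemma map_strand_eq (a : 'I_k -> 'I_k) (b : 'I_n -> 'I_n) (c : 'I_e -> 'I_e)
    (s s' : strand k n e) : size s.2 = size s'.2 ->
  map b (strand_nodes s) = strand_nodes s' ->
  map a (strand_exts s) = strand_exts s' ->
  map c (strand_word s) = strand_word s' -> map_strand a b c s = s'.
Proof.
case: s s' => j l [j' l'] /= sl; rewrite /map_strand /strand_word /= => Hb Ha [-> Hc].
congr pair.
elim: l l' sl Hb Ha Hc => [|p l IH] [|p' l'] //= [sl] [Hb1 Hb2] [Ha1 Ha2] [Hc1 Hc2 Hc3].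
rewrite (IH l') //; congr cons.
by case: p p' Hb1 Ha1 Hc1 Hc2 => [[? [? ?]] ?] [[? [? ?]] ?] /= <- <- <- <-.
Qed.

Lemma map_hair_eq (a : 'I_k -> 'I_k) (c : 'I_e -> 'I_e) (s s' : seq (hair k e)) :
  size s = size s' -> map a (unzip1 s) = unzip1 s' -> map c (unzip2 s) = unzip2 s' ->
  map (map_hair a c) s = s'.
Proof.
elim: s s' => [|[i h] s IH] [|[i' h'] s'] //= [sz] [ai asz] [ch csz].
by rewrite (IH s') // /map_hair /= ai ch.
Qed.

Lemma eqcat_split (T : Type) (s1 s1' s2 s2' : seq T) : size s1 = size s1' ->
  s1 ++ s2 = s1' ++ s2' -> s1 = s1' /\ s2 = s2'.
Proof.
move=> sz E; split.
  by have := congr1 (take (size s1)) E; rewrite take_size_cat // sz take_size_cat.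
by have := congr1 (drop (size s1)) E; rewrite drop_size_cat // sz drop_size_cat.
Qed.

(** Equal shapes cut the listings of vertices, external vertices and edges into blocks of equal
    sizes, so the permutations matching the whole listings match the structures entry by entry. *)
Lemma theta_perm t t' g g' : theta_on t g -> theta_on t' g' -> shape t = shape t' ->
  exists (s : 'S_k) (p : 'S_n) (u : 'S_e), map_theta s p u t = t'.
Proof.
move=> /and4P[tn tx tw _] /and4P[tn' tx' tw' _] [sz1 sz2 sz3 sz4 sz5].
have [s sE] := perm_of_enumerations tx tx'; have [p pE] := perm_of_enumerations tn tn'.
have [u uE] := perm_of_enumerations tw tw'; exists s, p, u; move: uE pE sE.
case: t t' sz1 sz2 sz3 sz4 sz5 {tn tx tw tn' tx' tw'}
  => [v w h1 h2 s1 s2 s3] [v' w' h1' h2' s1' s2' s3'].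
cbn [shape strand1 strand2 strand3 source_hair sink_hair fst snd] => z1 z2 z3 z4 z5.
rewrite /word /nodes /exts !map_cons !map_cat.
cbn [source sink strand1 strand2 strand3 source_hair sink_hair] => wE [vv ww nE] xE.
have szw q q' : size q.2 = size q'.2 -> size (map u (strand_word q)) = size (strand_word q').
  by rewrite size_map !size_strand_word => ->.
have szn q q' : size q.2 = size q'.2 -> size (map p (strand_nodes q)) = size (strand_nodes q').
  by rewrite !size_map.
have szx q q' : size q.2 = size q'.2 -> size (map s (strand_exts q)) = size (strand_exts q').
  by rewrite !size_map.
have [|x1 {}xE] := eqcat_split _ xE; first by rewrite !size_map.
have [|x2 {}xE] := eqcat_split _ xE; first by rewrite !size_map.
have [|x3 {}xE] := eqcat_split _ xE; first exact: szx.
have [|x4 x5] := eqcat_split _ xE; first exact: szx.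
have [|w1 {}wE] := eqcat_split _ wE; first by rewrite !size_map.
have [|w2 {}wE] := eqcat_split _ wE; first by rewrite !size_map.
have [|w3 {}wE] := eqcat_split _ wE; first exact: szw.
have [|w4 w5] := eqcat_split _ wE; first exact: szw.
have [|n1 {}nE] := eqcat_split _ nE; first exact: szn.
have [|n2 n3] := eqcat_split _ nE; first exact: szn.
rewrite /map_theta /= vv ww (map_hair_eq z1 x1 w1) (map_hair_eq z2 x2 w2).
by rewrite (map_strand_eq z3 n1 x3 w3) (map_strand_eq z4 n2 x4 w4) (map_strand_eq z5 n3 x5 w5).
Qed.

End Iso.

(** * Classes of Theta-graphs in the graph-complex *)

Section Relations.
Variables (m N k n e : nat).
Implicit Types (o : ograph k n e) (t : theta k n e) (g : digraph k n e).

Lemma gclass_rel o o' (x : rat) :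
  delta o - x *: delta o' \in graph_rel m N k n e ->
  gclass m N o = x *: gclass m N o'.
Proof.
rewrite -(lker_quot_pi (graph_rel m N k n e)) memv_ker linearB linearZ_LR /=.
by rewrite subr_eq0 => /eqP.
Qed.

Lemma gclass_relabel (s : 'S_k) (p : 'S_n) (u : 'S_e) o : gclass m N (relabel s p u o) = gclass m N o.
Proof.
by rewrite (@gclass_rel _ o 1) scale1r // rel_relabel.
Qed.

Lemma gclass_order o R : gclass m N (o.1, R) =
  koszul (@cell_deg m N k n e) o.2 R *: gclass m N o.
Proof. exact/gclass_rel/rel_order. Qed.

Hypotheses (N_gt0 : (0 < N)%N) (m_even : ~~ odd m) (N_even : ~~ odd N).

Lemma gclass_flip j o : gclass m N (flip j o) = gclass m N o.
Proof.
rewrite (gclass_rel (rel_flip m N j o)).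
by rewrite -signr_odd (negPf N_even) scale1r.
Qed.

(** For N even a flip is free; the differing edges are flipped one at a time, by induction on their
    number. *)
Lemma gclass_undirected o g' :
  (forall j, g' j = o.1 j \/ g' j = ((o.1 j).2, (o.1 j).1)) ->
  gclass m N (g', o.2) = gclass m N o.
Proof.
have [p] := ubnP #|[set j | o.1 j != g' j]|.
elim: p o => // p IH o op sw.
have [/existsP[j jP]|og] := boolP [exists j, o.1 j != g' j]; last first.
  suff -> : g' = o.1 by case: (o).
  apply/ffunP=> j; apply/esym/eqP; move: og.
  by rewrite negb_exists => /forallP/(_ j)/negPn.
have gj : g' j = ((o.1 j).2, (o.1 j).1).
  by case: (sw j) => // E; rewrite E eqxx in jP.
rewrite -[RHS](gclass_flip j) -(IH (flip j o)) //=.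
  rewrite ltnS in op; apply: leq_trans _ op; apply: proper_card; apply/properP; split.
    by apply/subsetP=> i; rewrite !inE ffunE; have [->|//] := eqVneq i j; rewrite gj eqxx.
  by exists j; rewrite !inE ?jP // ffunE eqxx gj eqxx.
move=> i; rewrite ffunE; have [->|_] := eqVneq i j; last exact: sw.
by left; rewrite gj.
Qed.

Lemma joins_map (s : 'S_k) (p : 'S_n) (u : 'S_e) o q : joins o.1 q ->
  joins (relabel s p u o).1 (map_link s p u q).
Proof.
case: q => j [x y]; rewrite /joins /= !ffunE permK.
by case/orP=> /eqP -> /=; rewrite -[relabel_vertex s p _]/(map_vertex s p _) eqxx ?orbT.
Qed.

Lemma theta_on_relabel (s : 'S_k) (p : 'S_n) (u : 'S_e) o t : theta_on t o.1 ->
  theta_on (map_theta s p u t) (relabel s p u o).1.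
Proof.
have enumE (T : finType) (f : {perm T}) l :
    perm_eq l (enum T) -> perm_eq (map f l) (enum T).
  move=> le; apply: uniq_perm; rewrite ?enum_uniq ?map_inj_uniq //.
  - by rewrite (perm_uniq le) enum_uniq.
  - exact: perm_inj.
  move=> x; rewrite mem_enum -[x](permKV f) mem_map; last exact: perm_inj.
  by rewrite (perm_mem le) mem_enum.
case/and4P=> tn tx tw tj; rewrite /theta_on nodes_map exts_map word_map links_map.
rewrite !enumE //= all_map; apply: sub_all tj => q; exact: joins_map.
Qed.

Lemma word_sign_relabel (s : 'S_k) (p : 'S_n) (u : 'S_e) o l :
  word_sign (edge_rel (relabel s p u o).2) (map u l) = word_sign (edge_rel o.2) l.
Proof.
by apply: word_sign_map => x y _ _; rewrite /edge_rel ole_mk /= !permK.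
Qed.

Lemma theta_on_joins t g j : theta_on t g ->
  exists2 q, q \in links t & q.1 = j /\ joins g q.
Proof.
case/and4P=> _ _ tw tj; have : j \in word t by rewrite (perm_mem tw) mem_enum.
rewrite -unzip1_links => /mapP[q qt ->]; exists q => //; split=> //.
exact: (allP tj).
Qed.

Lemma theta_on_undirected t g g' : theta_on t g -> theta_on t g' ->
  forall j, g' j = g j \/ g' j = ((g j).2, (g j).1).
Proof.
move=> tg tg' j; have [q qt [<- qg]] := theta_on_joins j tg.
case/and4P: tg' => _ _ _ /allP/(_ q qt).
by move: qg; rewrite /joins => /orP[]/eqP-> /orP[]/eqP ->; case: (q.2); auto.
Qed.

(** The word sign cancels the Koszul sign of any change of order, so the order chosen in o no longer
    matters. *)
Definition theta_class o t : GC m N k n e :=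
  word_sign (edge_rel o.2) (word t) *: gclass m N o.

(** Relabel o along the isomorphism, redirect its edges, then change the order: the Koszul sign of
    this last change is the product of the two word signs. *)
Lemma theta_class_eq o o' t t' : theta_on t o.1 -> theta_on t' o'.1 ->
  shape t = shape t' -> theta_class o t = theta_class o' t'.
Proof.
move=> to to' tt'; have [s [p [u tE]]] := theta_perm to to' tt'.
have r1 := theta_on_relabel s p u to; rewrite tE in r1.
rewrite /theta_class -(gclass_relabel s p u o) -(word_sign_relabel s p u).
rewrite -(word_map s p) tE -(gclass_undirected (theta_on_undirected r1 to')).
have wE : perm_eq (word t') (enum 'I_e) by case/and4P: to'.
set R := (relabel s p u o).2.
have := gclass_order (o'.1, R) o'.2; rewrite /= -surjective_pairing => ->.
rewrite (koszul_word N_gt0 m_even N_even R o'.2 wE) scalerA mulrCA.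
by rewrite word_sign_sq mulr1.
Qed.

Lemma theta_on_uniq t g : theta_on t g -> uniq (word t).
Proof. by case/and4P=> _ _ tw _; rewrite (perm_uniq tw) enum_uniq. Qed.

Lemma theta_class_swap12 o t : theta_on t o.1 ->
  theta_class o (swap12 t) = - theta_class o t.
Proof.
move=> to; rewrite /theta_class word_sign_swap12 ?scaleNr ?(theta_on_uniq to) //.
  exact: edge_rel_total.
exact: edge_rel_anti.
Qed.

Lemma theta_class_swap23 o t : theta_on t o.1 ->
  theta_class o (swap23 t) = - theta_class o t.
Proof.
move=> to; rewrite /theta_class word_sign_swap23 ?scaleNr ?(theta_on_uniq to) //.
  exact: edge_rel_total.
exact: edge_rel_anti.
Qed.

Lemma theta_class_rev o t : theta_on t o.1 ->
  theta_class o (rev_theta t) =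
    (-1) ^+ (size (source_hair t) * size (sink_hair t)
      + (size (strand1 t).2 + size (strand2 t).2 + size (strand3 t).2))
    *: theta_class o t.
Proof.
move=> to; rewrite /theta_class scalerA word_sign_rev_theta ?(theta_on_uniq to) //.
  exact: edge_rel_total.
exact: edge_rel_anti.
Qed.

End Relations.

(** * Valences and the rigidity of a Theta-structure *)

Section LocalStructure.
Variables (k n e : nat).
Implicit Types (t : theta k n e) (g : digraph k n e) (j : 'I_e).

Definition inner_nodes t : seq 'I_n :=
  strand_nodes (strand1 t) ++ strand_nodes (strand2 t) ++ strand_nodes (strand3 t).

Lemma valence_sum g x : valence g x = (\sum_j (((g j).1 == x) + ((g j).2 == x)))%N.
Proof.
rewrite /valence -sum1_card big_mkcond /=.
have -> : (\sum_h (if h \in halves g x then 1 else 0) =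
    \sum_j \sum_(b : bool) (if (j, b) \in halves g x then 1 else 0))%N.
  by rewrite pair_bigA; apply: eq_bigr => -[].
by apply: eq_bigr => j _; rewrite big_bool /= !inE /endpoint /= addnC; do 2!case: eqP.
Qed.

Definition ends (l : seq (link k n e)) : seq (vertex k n) :=
  flatten [seq [:: q.2.1; q.2.2] | q <- l].

Lemma ends_cons q l : ends (q :: l) = [:: q.2.1, q.2.2 & ends l].
Proof. by []. Qed.

Lemma ends_cat l1 l2 : ends (l1 ++ l2) = ends l1 ++ ends l2.
Proof. by rewrite /ends map_cat flatten_cat. Qed.

Lemma valence_ends t g x : theta_on t g ->
  valence g x = count_mem x (ends (links t)).
Proof.
case/and4P=> _ _ tw tj; rewrite valence_sum -big_enum -(perm_big _ tw) /=.
rewrite -unzip1_links big_map; elim: (links t) tj => [|[j [y z]] l IH]; first by rewrite big_nil.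
rewrite ends_cons /= => /andP[jq /IH]; rewrite big_cons /= => ->.
by move: jq; rewrite /joins /= => /orP[]/eqP-> /=; lia.
Qed.

Lemma count_int_strand z x j l w :
  count_mem (int_ k z) (ends (strand_links x j l w)) =
    ((x == z) + (w == z) + 3 * count_mem z (strand_nodes (j, l)))%N.
Proof.
have intE (a b : 'I_n) : (int_ k a == int_ k b) = (a == b) by rewrite (inj_eq inr_inj).
elim: l x j => [|[[y [i h]] j'] l IH] x j; first by rewrite /= !intE; lia.
rewrite [strand_links _ _ _ _]/= -[strand_nodes (j, _)]/(y :: strand_nodes (j', l)) !ends_cons /= IH !intE.
by rewrite /strand_nodes /=; lia.
Qed.

Lemma count_ext_strand i x j l w :
  count_mem (ext n i) (ends (strand_links x j l w)) = count_mem i (strand_exts (j, l)).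
Proof.
have extE (a b : 'I_k) : (ext n a == ext n b) = (a == b) by rewrite (inj_eq inl_inj).
elim: l x j => [|[[y [i' h]] j'] l IH] x j //.
by rewrite [strand_links _ _ _ _]/= -[strand_exts (j, _)]/(i' :: strand_exts (j', l)) !ends_cons /= IH extE.
Qed.

Lemma count_int_hair z x hs : count_mem (int_ k z) (ends (hair_links x hs : seq (link k n e))) =
  ((x == z) * size hs)%N.
Proof.
have intE (a b : 'I_n) : (int_ k a == int_ k b) = (a == b) by rewrite (inj_eq inr_inj).
elim: hs => [|h hs IH]; first by rewrite muln0.
by rewrite [hair_links _ _]/= ends_cons /= intE IH; lia.
Qed.

Lemma count_ext_hair i x hs : count_mem (ext n i) (ends (hair_links x hs : seq (link k n e))) =
  count_mem i (unzip1 hs).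
Proof.
have extE (a b : 'I_k) : (ext n a == ext n b) = (a == b) by rewrite (inj_eq inl_inj).
by elim: hs => [|h hs IH] //; rewrite [hair_links _ _]/= ends_cons /= extE IH.
Qed.

Lemma valence_int t g z : theta_on t g -> valence g (int_ k z) =
  ((source t == z) * (size (source_hair t) + 3)
   + (sink t == z) * (size (sink_hair t) + 3) + 3 * count_mem z (inner_nodes t))%N.
Proof.
move=> tg; rewrite (valence_ends _ tg) /links /inner_nodes !ends_cat !count_cat.
rewrite !count_int_hair !count_int_strand.
by case: t {tg} => ? ? ? ? [? ?] [? ?] [? ?] /=; lia.
Qed.

Lemma valence_ext t g i : theta_on t g -> valence g (ext n i) = 1%N.
Proof.
move=> tg; rewrite (valence_ends _ tg).
have -> : count_mem (ext n i) (ends (links t)) = count_mem i (exts t).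
  rewrite /links !ends_cat /exts !count_cat !count_ext_hair !count_ext_strand.
  by case: t {tg} => ? ? ? ? [? ?] [? ?] [? ?].
case/and4P: tg => _ tx _ _; rewrite count_uniq_mem ?(perm_uniq tx) ?enum_uniq //.
by rewrite (perm_mem tx) mem_enum.
Qed.

Lemma nodes_uniq t g : theta_on t g ->
  [/\ source t != sink t, source t \notin inner_nodes t, sink t \notin inner_nodes t
    & uniq (inner_nodes t)].
Proof.
case/and4P=> tn _ _ _; have := perm_uniq tn; rewrite enum_uniq /nodes -/(inner_nodes t).
by rewrite cons_uniq cons_uniq inE negb_or => /and3P[/andP[-> ->] -> ->].
Qed.

Lemma nodes_mem t g z : theta_on t g ->
  [|| z == source t, z == sink t | z \in inner_nodes t].
Proof. by case/and4P=> tn _ _ _; have := perm_mem tn z; rewrite mem_enum !inE. Qed.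

Lemma valence_source t g : theta_on t g ->
  valence g (int_ k (source t)) = (size (source_hair t) + 3)%N.
Proof.
move=> tg; rewrite (valence_int _ tg); have [vw vi wi _] := nodes_uniq tg.
by rewrite eqxx eq_sym (negPf vw) (count_memPn vi); lia.
Qed.

Lemma valence_sink t g : theta_on t g ->
  valence g (int_ k (sink t)) = (size (sink_hair t) + 3)%N.
Proof. by move=> tg; rewrite (valence_source (theta_on_rev tg)). Qed.

Lemma valence_inner t g z : theta_on t g -> z \in inner_nodes t ->
  valence g (int_ k z) = 3%N.
Proof.
move=> tg zi; rewrite (valence_int _ tg); have [vw vi wi ui] := nodes_uniq tg.
rewrite count_uniq_mem // zi.
have /negPf-> : source t != z by apply: contraNneq vi => ->.
have /negPf-> : sink t != z by apply: contraNneq wi => ->.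
by [].
Qed.

Lemma joins_incident g j x y : joins g (j, (x, y)) -> incident g x j.
Proof. by rewrite /joins /incident /= => /orP[]/eqP-> /=; rewrite eqxx ?orbT. Qed.

Lemma joins_inj g j x y z : joins g (j, (x, y)) -> joins g (j, (x, z)) -> y = z.
Proof.
by rewrite /joins /= => /orP[]/eqP-> /orP[]/eqP; congruence.
Qed.

Lemma joins_int_ext g j x y z i :
  joins g (j, (int_ k x, int_ k y)) -> joins g (j, (int_ k z, ext n i)) = false.
Proof.
have ie (a : 'I_n) : (int_ k a == ext n i) = false by [].
by rewrite /joins /= => /orP[]/eqP->; rewrite !xpair_eqE /= !ie !andbF.
Qed.

Arguments joins_int_ext [g j x y] z i _.

Lemma incident_bound g x (js : seq 'I_e) :
  uniq js -> all (incident g x) js -> (size js <= valence g x)%N.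
Proof.
move=> ujs /allP xjs; pose f j : halfedge e := (j, (g j).1 != x).
have uf : uniq (map f js) by rewrite map_inj_uniq // => a b [].
rewrite -(size_map f) -(card_uniqP uf); apply/subset_leq_card/subsetP => h.
case/mapP=> j /xjs; rewrite /incident /f => + ->; rewrite !inE /endpoint /=.
by case: eqP => //= /eqP.
Qed.

Lemma incident_exhaust g x (js : seq 'I_e) j :
  uniq js -> all (incident g x) js -> (valence g x <= size js)%N ->
  incident g x j -> j \in js.
Proof.
move=> ujs xjs vx xj; apply: contraTT vx => jjs; rewrite -ltnNge.
by apply: (@incident_bound g x (j :: js)) => /=; rewrite ?jjs ?xj.
Qed.

Lemma strand_first (x : 'I_n) j (l : seq (node k n e)) w : exists y : 'I_n, (j, (int_ k x, int_ k y)) \in strand_links x j l w.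
Proof.
by case: l => [|[[y [i h]] j'] l] /=; [exists w | exists y]; rewrite inE eqxx.
Qed.

Lemma strand_node_hair x j (l : seq (node k n e)) w z : z \in strand_nodes (j, l) ->
  exists h i, (h, (int_ k z, ext n i)) \in strand_links x j l w.
Proof.
elim: l x j => [|[[y [i h]] j'] l IH] x j //=; rewrite inE => /orP[/eqP->|zl].
  by exists h, i; rewrite !inE eqxx orbT.
by have [h' [i' H]] := IH y j' zl; exists h', i'; rewrite !inE H !orbT.
Qed.

Lemma strand_joins t g : theta_on t g ->
  [/\ all (joins g) (strand_links (source t) (strand1 t).1 (strand1 t).2 (sink t)),
      all (joins g) (strand_links (source t) (strand2 t).1 (strand2 t).2 (sink t))
    & all (joins g) (strand_links (source t) (strand3 t).1 (strand3 t).2 (sink t))].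
Proof. by case/and4P=> _ _ _; rewrite /links !all_cat => /and5P[_ _ -> -> ->]. Qed.

Lemma source_hair_joins t g h : theta_on t g -> h \in source_hair t ->
  joins g (h.2, (int_ k (source t), ext n h.1)).
Proof.
case/and4P=> _ _ _; rewrite /links !all_cat => /and5P[/allP H _ _ _ _] ht.
by apply: H; apply/mapP; exists h.
Qed.

Definition source_edges t : seq 'I_e := [:: (strand1 t).1; (strand2 t).1; (strand3 t).1].

Lemma source_edgesP t g j : theta_on t g -> j \in source_edges t ->
  exists y : 'I_n, joins g (j, (int_ k (source t), int_ k y)).
Proof.
move=> tg; have [/allP t1 /allP t2 /allP t3] := strand_joins tg.
have F s : exists y, _ := strand_first (source t) s.1 s.2 (sink t).
have [y1 H1] := F (strand1 t); have [y2 H2] := F (strand2 t); have [y3 H3] := F (strand3 t).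
rewrite !inE => /or3P[]/eqP->; [exists y1 | exists y2 | exists y3];
by [apply: t1 | apply: t2 | apply: t3].
Qed.

(** The hairs and the three first edges are as many distinct edges as the valence of the source,
    which leaves room for no other. *)
Lemma source_incident t g j : theta_on t g ->
  incident g (int_ k (source t)) j = (j \in unzip2 (source_hair t) ++ source_edges t).
Proof.
move=> tg; have uw := theta_on_uniq tg.
have ujs : uniq (unzip2 (source_hair t) ++ source_edges t).
  apply: subseq_uniq uw; rewrite /word; apply: cat_subseq => //.
  apply: subseq_trans (suffix_subseq _ _).
  rewrite -[source_edges t]/([:: _] ++ [:: _] ++ [:: _]).
  by do 2?[apply: cat_subseq]; rewrite sub1seq inE eqxx.
have ajs : all (incident g (int_ k (source t))) (unzip2 (source_hair t) ++ source_edges t).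
  apply/allP=> i; rewrite mem_cat => /orP[/mapP[h ht ->]|/(source_edgesP tg)[y]].
    exact: joins_incident (source_hair_joins tg ht).
  exact: joins_incident.
apply/idP/idP => [|jt]; last exact: (allP ajs).
by apply: incident_exhaust; rewrite // (valence_source tg) size_cat size_map.
Qed.

(** An inner vertex of t' is trivalent, so as the source of t it would carry no hair and all its
    edges would lead to internal vertices; but t' attaches a hair to it. *)
Lemma source_not_inner t t' g : theta_on t g -> theta_on t' g ->
  source t \notin inner_nodes t'.
Proof.
move=> tg tg'; apply/negP=> vt'.
have := valence_inner tg' vt'; rewrite (valence_source tg).
case E: (source_hair t) => [|h0 hs] /=; [move=> _ | lia].
have [h [i hi]] : exists h i, joins g (h, (int_ k (source t), ext n i)).
  have [/allP t1 /allP t2 /allP t3] := strand_joins tg'.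
  have F s : source t \in strand_nodes s -> exists h i, _ :=
    @strand_node_hair (source t') s.1 s.2 (sink t') (source t).
  move: vt'; rewrite !mem_cat => /or3P[]/F[h [i hi]]; exists h, i;
  by [apply: t1 | apply: t2 | apply: t3].
have := joins_incident hi; rewrite (source_incident _ tg) E => /(source_edgesP tg)[y].
by move/(joins_int_ext (source t) i); rewrite hi.
Qed.

Lemma source_ext_edge t g h i : theta_on t g ->
  joins g (h, (int_ k (source t), ext n i)) -> h \in unzip2 (source_hair t).
Proof.
move=> tg hi; have := joins_incident hi; rewrite (source_incident _ tg) mem_cat.
by case/orP=> // /(source_edgesP tg)[y] /(joins_int_ext (source t) i); rewrite hi.
Qed.

Lemma source_int_edge t g j y : theta_on t g ->
  joins g (j, (int_ k (source t), int_ k y)) -> j \in source_edges t.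
Proof.
move=> tg jy; have := joins_incident jy; rewrite (source_incident _ tg) mem_cat.
case/orP=> // /mapP[h /(source_hair_joins tg) H jh].
by have := joins_int_ext (source t) h.1 jy; rewrite jh H.
Qed.

(* Inner vertices are trivalent, so the edge into one of them determines the
   edge out of it. *)
Lemma strand_determined g x j l l' w :
  all (joins g) (strand_links x j l w) -> all (joins g) (strand_links x j l' w) ->
  uniq (strand_word (j, l)) -> uniq (strand_word (j, l')) ->
  w \notin strand_nodes (j, l) -> w \notin strand_nodes (j, l') ->
  (forall z, z \in strand_nodes (j, l') -> valence g (int_ k z) = 3%N) ->
  l = l'.
Proof.
have int_inj : injective (@int_ k n) by move=> a b [].
elim: l l' x j => [|[[y [i h]] j1] l IH] [|[[y' [i' h']] j1'] l'] x j //.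
- rewrite /strand_nodes /= => /andP[jw _] /andP[jy _] _ _ _.
  by rewrite inE negb_or (int_inj _ _ (joins_inj jw jy)) eqxx.
- rewrite /strand_nodes /= => /andP[jy _] /andP[jw _] _ _.
  by rewrite inE negb_or (int_inj _ _ (joins_inj jw jy)) eqxx.
rewrite -[strand_nodes (j, _ :: l)]/(y :: strand_nodes (j1, l)).
rewrite -[strand_nodes (j, _ :: l')]/(y' :: strand_nodes (j1', l')) /=.
move=> /and3P[jy hi jl] /and3P[jy' hi' jl'].
have E := int_inj _ _ (joins_inj jy jy'); rewrite -{}E in jy' hi' jl' *.
move=> /and3P[jl0 hl0 ul] /and3P[jl0' hl0' ul'] wl wl' val3.
move: jl0 jl0' hl0 hl0' wl wl'; rewrite !inE !negb_or.
move=> /and3P[jh jj1 _] /and3P[jh' jj1' _] /andP[hj1 _] /andP[hj1' _].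
move=> /andP[_ wl] /andP[_ wl'].
have [z /(allP jl) jz] := strand_first y j1 l w.
have [z' /(allP jl') jz'] := strand_first y j1' l' w.
(* The edges at y known from l' exhaust its valence 3, so the hair and the exit of l are among them;
   the kind of the far endpoint tells hair from exit. *)
have ex3 i0 : incident g (int_ k y) i0 -> i0 \in [:: j; h'; j1'].
  apply: incident_exhaust; rewrite ?val3 ?inE ?eqxx //=.
    by rewrite !inE !negb_or jh' jj1' hj1'.
  rewrite (joins_incident hi') (joins_incident jz') !andbT.
  by rewrite joins_sym in jy; apply: joins_incident jy.
have hh : h = h'.
  have := ex3 _ (joins_incident hi); rewrite !inE eq_sym (negPf jh) /=.
  case/orP=> /eqP // hj; move: hi; rewrite hj.
  by rewrite (joins_int_ext _ _ jz').
have jj : j1 = j1'.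
  have := ex3 _ (joins_incident jz); rewrite !inE -hh eq_sym (negPf jj1) eq_sym (negPf hj1) /=.
  by move/eqP.
move: hi'; rewrite -hh => /(joins_inj hi)[->]; rewrite -jj in jl' ul' wl' *.
rewrite (IH l' y j1) // => z0 zl; apply: val3; by rewrite inE zl orbT.
Qed.

End LocalStructure.

Section UniqueSign.
Variables (k n e : nat).
Implicit Types (t : theta k n e) (g : digraph k n e) (j : 'I_e).

Lemma strand_word_uniq t g : theta_on t g ->
  [/\ uniq (strand_word (strand1 t)), uniq (strand_word (strand2 t))
    & uniq (strand_word (strand3 t))].
Proof.
move/theta_on_uniq; rewrite /word catA cat_uniq => /and3P[_ _].
rewrite cat_uniq => /and3P[-> _]; rewrite cat_uniq => /and3P[-> _ ->].
by [].
Qed.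

Definition strands t : seq (strand k n e) := [:: strand1 t; strand2 t; strand3 t].

Lemma strandsP t g s : theta_on t g -> s \in strands t ->
  [/\ all (joins g) (strand_links (source t) s.1 s.2 (sink t)), uniq (strand_word s),
      {subset strand_nodes s <= inner_nodes t}, s.1 \in source_edges t
    & sink t \notin strand_nodes s].
Proof.
move=> tg st; have [t1 t2 t3] := strand_joins tg; have [u1 u2 u3] := strand_word_uniq tg.
have [_ _ wt _] := nodes_uniq tg.
have sub : {subset strand_nodes s <= inner_nodes t}.
  move=> z zs; rewrite !mem_cat; move: st zs.
  by rewrite !inE => /or3P[]/eqP-> ->; rewrite ?orbT.
have ws : sink t \notin strand_nodes s by apply: contra wt; apply: sub.
by split=> //; move: st; rewrite !inE => /or3P[]/eqP->; rewrite ?eqxx ?orbT.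
Qed.

(** The sinks agree too, as the sink of t' is not inner for t. A strand of t' then leaves by the
    first edge of some strand of t, and by trivalence the first edge determines the rest. *)
Lemma same_source_strands t t' g s' : theta_on t g -> theta_on t' g ->
  source t' = source t -> s' \in strands t' -> s' \in strands t.
Proof.
move=> tg tg' vv st'.
have ww : sink t' = sink t.
  have := source_not_inner (theta_on_rev tg') tg; rewrite /= => wt.
  have := nodes_mem (sink t') tg; rewrite (negPf wt) orbF -vv.
  by have [+ _ _ _] := nodes_uniq tg'; rewrite eq_sym => /negPf-> /eqP.
have [js' us' sub' es' ws'] := strandsP tg' st'; rewrite vv ww in js' es' ws'.
have [y jy] := source_edgesP tg' es'; rewrite vv in jy.
have [s st E] : exists2 s, s \in strands t & s.1 = s'.1.
  have := source_int_edge tg jy; rewrite !inE => /or3P[]/eqP E.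
  - by exists (strand1 t); rewrite ?inE ?eqxx.
  - by exists (strand2 t); rewrite ?inE ?eqxx ?orbT.
  by exists (strand3 t); rewrite ?inE ?eqxx ?orbT.
have [js us _ _ ws] := strandsP tg st.
suff <- : s = s' by [].
case: s s' E js us ws js' us' sub' ws' {st st' es' jy} => j l [j' l'] /= <-.
move=> js us ws js' us' sub' ws'; congr pair.
apply: (strand_determined js js' us us' ws ws') => z /sub'.
exact: valence_inner tg'.
Qed.

Lemma same_source_hair t t' g : theta_on t g -> theta_on t' g ->
  source t' = source t -> size (source_hair t') = size (source_hair t) ->
  (size (source_hair t) <= 1)%N -> unzip2 (source_hair t') = unzip2 (source_hair t).
Proof.
move=> tg tg' vv sz.
case E: (source_hair t) sz => [|h [|//]]; case E': (source_hair t') => [|h' [|//]] // _ _.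
have := @source_hair_joins _ _ _ t' g h' tg'; rewrite E' inE eqxx vv => /(_ isT).
by move/(source_ext_edge tg); rewrite E inE => /eqP /= ->.
Qed.

Lemma same_source_word t t' g : theta_on t g -> theta_on t' g ->
  source t' = source t -> shape t = shape t' ->
  (size (source_hair t) <= 1)%N -> (size (sink_hair t) <= 1)%N ->
  uniq [:: size (strand1 t).2; size (strand2 t).2; size (strand3 t).2] ->
  word t' = word t.
Proof.
move=> tg tg' vv [sz1 sz2 sz3 sz4 sz5] h1 h2.
have := fun s => same_source_strands tg tg' vv (s' := s).
have ww : sink t' = sink t.
  have := source_not_inner (theta_on_rev tg') tg; rewrite /= => wt.
  have := nodes_mem (sink t') tg; rewrite (negPf wt) orbF -vv.
  by have [+ _ _ _] := nodes_uniq tg'; rewrite eq_sym => /negPf-> /eqP.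
rewrite /word (same_source_hair tg tg' vv _ h1) //.
have -> := same_source_hair (theta_on_rev tg) (theta_on_rev tg') ww (esym sz2) h2.
move=> /= H; rewrite !inE => /and3P[].
rewrite negb_or => /andP[n12 n13] n23 _.
have := H (strand1 t'); have := H (strand2 t'); have := H (strand3 t').
rewrite !inE !eqxx ?orbT => /(_ isT) S3 /(_ isT) S2 /(_ isT) S1.
suff [-> -> ->] : [/\ strand1 t' = strand1 t, strand2 t' = strand2 t & strand3 t' = strand3 t].
  by [].
split.
- case/or3P: S1 => /eqP E //; first by move: n12; rewrite sz3 E eqxx.
  by move: n13; rewrite sz3 E eqxx.
- case/or3P: S2 => /eqP E //; first by move: n12; rewrite sz4 E eqxx.
  by move: n23; rewrite sz4 E eqxx.
case/or3P: S3 => /eqP E //; first by move: n13; rewrite sz5 E eqxx.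
by move: n23; rewrite sz5 E eqxx.
Qed.

(** This excludes orientation-reversing automorphisms. The source of t' is the source or the sink of
    t. In the first case distinct lengths identify the strands in order, so the words coincide. In
    the second, the valences give p = q, and comparison with [rev_theta t] yields a sign which the
    parity hypothesis makes +1. *)
Lemma theta_sign_unique (r : rel 'I_e) t t' g :
  total r -> antisymmetric r -> theta_on t g -> theta_on t' g ->
  shape t = shape t' ->
  (size (source_hair t) <= 1)%N -> (size (sink_hair t) <= 1)%N ->
  uniq [:: size (strand1 t).2; size (strand2 t).2; size (strand3 t).2] ->
  (size (source_hair t) = size (sink_hair t) ->
    ~~ odd (size (source_hair t) * size (sink_hair t)
      + (size (strand1 t).2 + size (strand2 t).2 + size (strand3 t).2))) ->
  word_sign r (word t') = word_sign r (word t).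
Proof.
move=> rt ra tg tg' tt' h1 h2 ut par.
have := nodes_mem (source t') tg; rewrite (negPf (source_not_inner tg' tg)) orbF.
case/orP=> /eqP vv; first by rewrite (same_source_word tg tg' vv tt').
have sz : size (source_hair t) = size (sink_hair t).
  have := valence_sink tg; rewrite -vv (valence_source tg').
  by case: tt' => -> _ _ _ _; lia.
rewrite (same_source_word (theta_on_rev tg) tg' vv) //= ?size_rev_strand //.
  rewrite word_sign_rev_theta ?(theta_on_uniq tg) // -signr_odd.
  by rewrite (negPf (par sz)) mul1r.
by rewrite shape_rev -tt' /shape /= -sz.
Qed.

End UniqueSign.

Section ExtendQuotient.
Variables (T : finType) (W : vectType rat) (f : T -> W) (U : {vspace free_space T}).

Lemma extend_line_ker x y a : f x = a *: f y ->
  (<[delta x - a *: delta y]> <= lker (extend f))%VS.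
Proof.
by move=> E; rewrite -memvE memv_ker linearB linearZ_LR /= !extend_delta E subrr.
Qed.

Lemma extend_line_ker1 x y : f x = f y -> (<[delta x - delta y]> <= lker (extend f))%VS.
Proof. by move=> E; rewrite -memvE memv_ker linearB /= !extend_delta E subrr. Qed.

(** The partial inverse of [quot_pi U] picks some representative; two representatives differ by an
    element of U, which f annihilates. *)
Lemma extend_quotE x : (U <= lker (extend f))%VS ->
  (extend f \o (quot_pi U)^-1)%VF (quot_pi U (delta x)) = f x.
Proof.
move=> Uf; rewrite comp_lfunE -[RHS](extend_delta f x).
apply/eqP; rewrite -subr_eq0 -linearB /= -memv_ker.
apply: (subvP Uf); set y := _ - _; suff : y \in lker (quot_pi U) by rewrite lker_quot_pi.
by rewrite memv_ker linearB /= limg_lfunVK ?subrr // memv_img ?memvf.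
Qed.

End ExtendQuotient.

(** * Linear forms on the quotient that detect a shape *)

Section Coefficient.
Variables (m N k n e : nat).
Hypotheses (N_gt0 : (0 < N)%N) (m_even : ~~ odd m) (N_even : ~~ odd N).
Implicit Types (o : ograph k n e) (t : theta k n e).
Variable sh : (nat * nat) * (nat * nat * nat).

Definition has_theta (x : rat) o : Prop :=
  exists t, [/\ theta_on t o.1, shape t = sh & word_sign (edge_rel o.2) (word t) = x].

(* This is nonzero only if no automorphism of o reverses the orientation. *)
Definition theta_coef o : rat := (`[< has_theta 1 o >])%:R - (`[< has_theta (-1) o >])%:R.

Lemma has_theta_relabel x (s : 'S_k) (p : 'S_n) (u : 'S_e) o :
  has_theta x o -> has_theta x (relabel s p u o).
Proof.
case=> t [to ts tx]; exists (map_theta s p u t); split.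
- exact: theta_on_relabel.
- by rewrite shape_map.
by rewrite word_map word_sign_relabel.
Qed.

Lemma theta_coef_relabel (s : 'S_k) (p : 'S_n) (u : 'S_e) o :
  theta_coef (relabel s p u o) = theta_coef o.
Proof.
suff H x : has_theta x (relabel s p u o) <-> has_theta x o.
  by congr (_%:R - _%:R); rewrite (asbool_equiv_eq (H _)).
split; last exact: has_theta_relabel.
move/(has_theta_relabel s^-1%g p^-1%g u^-1%g); suff -> : relabel s^-1%g p^-1%g u^-1%g (relabel s p u o) = o by [].
apply: ograph_eq => [j|a b] /=.
  rewrite !ffunE invgK permK; by case: (o.1 j) => -[i1|i1] [i2|i2] /=; rewrite !permK.
rewrite !ole_mk !invgK.
have K c : relabel_cell s^-1%g p^-1%g u^-1%g (relabel_cell s p u c) = c.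
  by case: c => [[i|i]|i] /=; rewrite permK.
by rewrite !K.
Qed.

Lemma theta_coef_flip j o : theta_coef (flip j o) = theta_coef o.
Proof.
have H t : theta_on t (flip j o).1 = theta_on t o.1.
  congr [&& _, _, _ & _]; apply: eq_all => -[i [x y]]; rewrite /joins /= ffunE.
  have [->|//] := eqVneq i j; case: (o.1 j) => a b; rewrite !xpair_eqE /=.
  by case: (a == x); case: (a == y); case: (b == x); case: (b == y).
suff H' x : has_theta x (flip j o) <-> has_theta x o.
  by congr (_%:R - _%:R); rewrite (asbool_equiv_eq (H' _)).
by split=> -[t [to ts tx]]; exists t; move: to; rewrite H.
Qed.

(** Changing the order multiplies the word signs of all Theta-structures at once; when the factor is
    -1 the two indicators are exchanged. *)
Lemma theta_coef_order o R :
  theta_coef (o.1, R) = koszul (@cell_deg m N k n e) o.2 R * theta_coef o.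
Proof.
have H x t : theta_on t o.1 -> (word_sign (edge_rel R) (word t) == x) =
    (word_sign (edge_rel o.2) (word t) == koszul (@cell_deg m N k n e) o.2 R * x).
  move=> to; have wE : perm_eq (word t) (enum 'I_e) by case/and4P: to.
  rewrite (koszul_word N_gt0 m_even N_even o.2 R wE) -mulrA.
  apply/eqP/eqP=> [<-|E]; first by rewrite word_sign_sq mulr1.
  have E1 : word_sign (edge_rel R) (word t) * x = 1.
    by rewrite -(word_sign_sq (edge_rel o.2) (word t)) {2}E mulrA word_sign_sq mul1r.
  by rewrite -[x]mul1r -(word_sign_sq (edge_rel R) (word t)) -mulrA E1 mulr1.
have H' x : has_theta x (o.1, R) <-> has_theta (koszul (@cell_deg m N k n e) o.2 R * x) o.
  by split=> -[t [to ts /eqP tx]]; exists t; split=> //; apply/eqP; rewrite -?H // H.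
rewrite /theta_coef !(asbool_equiv_eq (H' _)) mulr1 mulrN1.
have : koszul (@cell_deg m N k n e) o.2 R = 1 \/ koszul (@cell_deg m N k n e) o.2 R = -1.
  by rewrite /koszul -signr_odd; case: (odd _); [right | left].
by case=> ->; rewrite ?mul1r // mulN1r opprK opprB.
Qed.

Definition theta_form : 'Hom(GC m N k n e, rat^o) :=
  (extend (theta_coef : ograph k n e -> rat^o) \o (quot_pi (graph_rel m N k n e))^-1)%VF.

Lemma extend_theta_coef_rel :
  (graph_rel m N k n e <= lker (extend (theta_coef : ograph k n e -> rat^o)))%VS.
Proof.
rewrite /graph_rel !subv_add -!andbA; apply/and3P; split.
- apply/subv_sumP=> o _; apply/subv_sumP=> s _; apply/subv_sumP=> p _.
  apply/subv_sumP=> u _; apply: extend_line_ker1; exact: theta_coef_relabel.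
- apply/subv_sumP=> o _; apply/subv_sumP=> j _; apply: extend_line_ker.
  have E : theta_coef (flip j o) = (-1) ^+ N * theta_coef o.
    by rewrite theta_coef_flip -signr_odd (negPf N_even) mul1r.
  exact: E.
apply/subv_sumP=> o _; apply/subv_sumP=> R _; apply: extend_line_ker.
exact: theta_coef_order.
Qed.

Lemma theta_formE o : theta_form (gclass m N o) = theta_coef o.
Proof.
exact: extend_quotE extend_theta_coef_rel.
Qed.

Lemma theta_form_other o t : theta_on t o.1 ->
  (forall t', theta_on t' o.1 -> shape t' <> sh) ->
  theta_form (theta_class m N o t) = 0.
Proof.
move=> to ne; rewrite linearZ_LR /= theta_formE /theta_coef.
by rewrite !asboolF ?subrr ?scaler0 // => -[t' [/ne]].
Qed.

(** By [theta_sign_unique] exactly one indicator is 1, namely that of the word sign of t, and this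
    sign cancels the one in [theta_class]. *)
Lemma theta_form_self o t : theta_on t o.1 -> shape t = sh ->
  (size (source_hair t) <= 1)%N -> (size (sink_hair t) <= 1)%N ->
  uniq [:: size (strand1 t).2; size (strand2 t).2; size (strand3 t).2] ->
  (size (source_hair t) = size (sink_hair t) ->
    ~~ odd (size (source_hair t) * size (sink_hair t)
      + (size (strand1 t).2 + size (strand2 t).2 + size (strand3 t).2))) ->
  theta_form (theta_class m N o t) = 1.
Proof.
move=> to ts h1 h2 ut par; rewrite linearZ_LR /= theta_formE /theta_coef.
have H x : has_theta x o <-> word_sign (edge_rel o.2) (word t) = x.
  split=> [[t' [to' ts' <-]]|tx]; last by exists t.
  apply/esym/(theta_sign_unique _ _ to to') => //; last by rewrite ts ts'.
    exact: edge_rel_total.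
  exact: edge_rel_anti.
rewrite !(asbool_equiv_eq (H _)).
have [->|->] : word_sign (edge_rel o.2) (word t) = 1 \/ word_sign (edge_rel o.2) (word t) = -1.
  by rewrite /word_sign -signr_odd; case: (odd _); [right | left].
  by rewrite asboolT // asboolF ?subr0 ?scale1r // => /eqP; rewrite eq_sym.
by rewrite asboolF ?asboolT // sub0r scaleN1r opprK.
Qed.

End Coefficient.

(** * The differential of a Theta-graph *)

Section Splittings.
Variables (k n e : nat).
Implicit Types (g : digraph k n e).

(** Two blocks of at least two half-edges need valence 4. *)
Lemma splittings_small g v : (valence g (int_ k v) <= 3)%N -> splittings g v = set0.
Proof.
move=> v3; apply/setP=> P; rewrite !inE; apply/negP=> /and3P[pP /eqP P2 /forall_inP P2'].
have : (\sum_(A in P) 2 <= \sum_(A in P) #|A|)%N by apply: leq_sum.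
rewrite -(card_partition pP) sum_nat_const P2; rewrite /valence in v3; lia.
Qed.

Variables (g : digraph k n e) (v : 'I_n) (p0 p1 p2 p3 : halfedge e).
Hypotheses (p_uniq : uniq [:: p0; p1; p2; p3])
  (p_halves : halves g (int_ k v) = [set p0; p1; p2; p3]).

Definition split_at (p : halfedge e) : {set {set halfedge e}} :=
  [set [set p0; p]; halves g (int_ k v) :\: [set p0; p]].

(** Both blocks have size exactly 2, so a splitting amounts to the choice of the partner of p0. *)
Lemma splittings4 : splittings g v = split_at @: [set p1; p2; p3].
Proof.
pose H := halves g (int_ k v); have cH : #|H| = 4%N.
  have /= <- := card_uniqP p_uniq; apply: eq_card => x.
  by rewrite /H p_halves !inE -!orbA.
have p0H : p0 \in H by rewrite /H p_halves !inE eqxx.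
apply/setP=> P; apply/idP/imsetP => [PP|[p pp ->]].
  have [pP P2 Pge] : [/\ partition P H, #|P| = 2%N & forall A, A \in P -> (2 <= #|A|)%N].
    by move: PP; rewrite inE => /and3P[-> /eqP -> /forall_inP].
  have [/eqP covP trP _] := and3P pP.
  have BP : pblock P p0 \in P by rewrite pblock_mem // covP.
  have p0B : p0 \in pblock P p0 by rewrite mem_pblock covP.
  set B := pblock P p0 in BP p0B.
  have [B' B'P BB'] : exists2 B', B' \in P & B != B'.
    have : #|P :\ B| == 1%N by have := cardsD1 B P; rewrite BP P2 => -[]; rewrite add0n => <-.
    case/cards1P=> B' E; have : B' \in P :\ B by rewrite E inE.
    by rewrite !inE => /andP[]; exists B'; rewrite // eq_sym.
  have defB' : B' = H :\: B.
    apply/setP=> h; rewrite (splittings_blocks PP BP B'P BB') !inE andbC.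
    by [].
  have defP : P = [set B; B'].
    by apply/esym/eqP; rewrite eqEcard subUset !sub1set BP B'P P2 cards2 BB'.
  have BH : B \subset H by rewrite -covP; apply: (bigcup_max B).
  have cB : #|B :\ p0| == 1%N.
    have := cardsID B H; rewrite cH (setIidPr BH) -defB'.
    have := Pge _ BP; have := Pge _ B'P; rewrite (cardsD1 p0 B) p0B /=.
    by move: #|B'| #|B :\ p0| => b b' ? ? ?; apply/eqP; lia.
  case/cards1P: cB => p Bp; have pB : p \in B :\ p0 by rewrite Bp inE.
  have defB : B = [set p0; p] by rewrite -Bp setD1K.
  exists p; last by rewrite /split_at -/H -defB -defB'.
  move: pB; rewrite !inE => /andP[pp0 /(subsetP BH)].
  by rewrite /H p_halves !inE (negPf pp0).
have pp0 : p0 != p.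
  by move: pp p_uniq; rewrite !inE /= !inE !negb_or => /orP[/orP[]|]/eqP -> /andP[/and3P[]].
have pH : p \in H by move: pp; rewrite /H p_halves !inE => /orP[/orP[]|] ->; rewrite ?orbT.
have sH : [set p0; p] \subset H by rewrite subUset !sub1set p0H pH.
have cD : #|H :\: [set p0; p]| = 2%N.
  have := cardsID [set p0; p] H; rewrite cH (setIidPr sH) cards2 pp0; lia.
have neq : [set p0; p] != H :\: [set p0; p].
  by apply/eqP=> /setP/(_ p0); rewrite !inE eqxx.
rewrite inE cards2 neq /=; apply/andP; split.
  apply/and3P; split.
  - rewrite /cover big_setU1 ?inE // big_set1; apply/eqP/setP=> x; rewrite inE in_setD.
    by have := subsetP sH x; case: (x \in [set p0; p]) => //= ->.
  - apply/trivIsetP=> A A'; rewrite !inE => /orP[]/eqP-> /orP[]/eqP->; rewrite ?eqxx //.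
      by move=> _; rewrite -setI_eq0; apply/eqP/setP=> x;
      rewrite in_setI in_setD in_set0; case: (x \in [set p0; p]); rewrite //= andbF.
    by move=> _; rewrite -setI_eq0; apply/eqP/setP=> x;
      rewrite in_setI in_setD in_set0; case: (x \in [set p0; p]); rewrite //= andbF.
  rewrite !inE negb_or; apply/andP; split; apply/eqP=> E.
    by have := cards0 (halfedge e); rewrite E cards2 pp0.
  by move: cD; rewrite -E cards0.
apply/forall_inP=> A; rewrite !inE => /orP[]/eqP->; first by rewrite cards2 pp0.
by rewrite cD.
Qed.

Lemma split_at_inj : {in [set p1; p2; p3] &, injective split_at}.
Proof.
have ne p : p \in [set p1; p2; p3] -> p != p0.
  move=> pp; rewrite eq_sym; move: pp p_uniq.
  by rewrite !inE /= !inE !negb_or => /orP[/orP[]|]/eqP -> /andP[/and3P[]].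
move=> p q pp qq E; have : [set p0; p] \in split_at q by rewrite -E !inE eqxx.
rewrite !inE => /orP[]/eqP/setP E'; last by have := E' p0; rewrite !inE eqxx.
have := E' p; rewrite !inE eqxx orbT (negPf (ne p pp)) /= => /esym/eqP.
by [].
Qed.

End Splittings.

Lemma strand_links_cons k n e x j (l : seq (node k n e)) w : strand_links x j l w =
  (j, (int_ k x, int_ k (head w (strand_nodes (j, l))))) :: behead (strand_links x j l w).
Proof. by case: l => [|[[? [? ?]] ?] ?]. Qed.

Lemma behead_strand_links k n e (x y : 'I_n) j (l : seq (node k n e)) w :
  behead (strand_links x j l w) = behead (strand_links y j l w).
Proof. by case: l => [|[[? [? ?]] ?] ?]. Qed.

Section ExpandTheta.
Variables (m N k n e : nat).
Implicit Types (o : ograph k n e) (t : theta k n e) (g : digraph k n e).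

(** By [expand_swap] the picked block may be replaced by the one containing p0. *)
Lemma sum_splittings o v p0 p1 p2 p3 :
  uniq [:: p0; p1; p2; p3] -> halves o.1 (int_ k v) = [set p0; p1; p2; p3] ->
  \sum_(P in splittings o.1 v) gclass m N (expand o v (odflt set0 [pick A in P]))
  = gclass m N (expand o v [set p0; p1]) + gclass m N (expand o v [set p0; p2])
    + gclass m N (expand o v [set p0; p3]).
Proof.
move=> up hE; rewrite (splittings4 up hE) big_imset /=; last exact: split_at_inj up.
rewrite (eq_bigr (fun p => gclass m N (expand o v [set p0; p]))) => [|p pp]; last first.
  rewrite -[RHS]scale1r; apply: gclass_rel; rewrite scale1r.
  have pP : split_at o.1 v p0 p \in splittings o.1 v.
    by rewrite (splittings4 up hE) imset_f.
  by apply: expand_swap pP (pick_block pP) _; rewrite /split_at !inE eqxx.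
have [n12 n13 n23] : [/\ p1 != p2, p1 != p3 & p2 != p3].
  by case/and4P: up; rewrite !inE !negb_or => _ /andP[-> ->] ->.
rewrite setUC big_setU1 ?inE ?negb_or; last by rewrite eq_sym n13 eq_sym n23.
by rewrite big_setU1 ?inE // big_set1 addrC.
Qed.

(* A junk value unless j is incident to x. *)
Definition half_at g x j : halfedge e := (j, (g j).1 != x).

Lemma half_at_inj g x : injective (half_at g x).
Proof. by move=> i j []. Qed.

Section Source.
Variables (o : ograph k n e) (t : theta k n e) (i : 'I_k) (h : 'I_e).
Hypotheses (t_on : theta_on t o.1) (t_hair : source_hair t = [:: (i, h)]).

Let v := source t.
Let j1 := (strand1 t).1.
Let A : {set halfedge e} := [set half_at o.1 (int_ k v) h; half_at o.1 (int_ k v) j1].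
Let o' := expand o v A.

(** The hair and the first edge of the first strand move to the new vertex, which thus becomes the
    first inner vertex of that strand, reached from the source by the new edge. Both have number
    0. *)
Definition expand_theta : theta k n.+1 e.+1 :=
  Theta (lift ord0 (source t)) (lift ord0 (sink t)) [::]
    (map (map_hair id (lift ord0)) (sink_hair t))
    (ord0, (ord0, (i, lift ord0 h), lift ord0 j1) :: (map_strand id (lift ord0) (lift ord0) (strand1 t)).2)
    (map_strand id (lift ord0) (lift ord0) (strand2 t))
    (map_strand id (lift ord0) (lift ord0) (strand3 t)).

Lemma expand_joins q : joins o.1 q -> q.1 != h -> q.1 != j1 ->
  joins o'.1 (map_link id (lift ord0) (lift ord0) q).
Proof.
case: q => j [x y] /= jq jh jj; rewrite /joins /= !ffunE liftK.
have att b : (if (j, b) \in A then inr ord0 else up_vertex (endpoint o.1 (j, b)))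
    = map_vertex id (lift ord0) (endpoint o.1 (j, b)).
  by rewrite !inE !xpair_eqE (negPf jh) (negPf jj) /=; case: (endpoint _ _).
by rewrite !att /endpoint /=; case/orP: jq => /eqP /= ->; rewrite eqxx ?orbT.
Qed.

(** As j is not a loop at v, exactly one of its halves lies in A and is moved. *)
Lemma expand_joins_moved j x : j \in [:: h; j1] -> joins o.1 (j, (int_ k v, x)) ->
  x != int_ k v -> joins o'.1 (lift ord0 j, (int_ k ord0, map_vertex id (lift ord0) x)).
Proof.
move=> jA jq xv; rewrite /joins /= !ffunE liftK.
have inA b : ((j, b) \in A) = ((o.1 j).1 != int_ k v) (+) ~~ b.
  rewrite !inE !xpair_eqE; move: jA; rewrite !inE.
  by case: (altP (j =P h)) => [->|_] /=; [case: (altP (h =P j1)) => [<-|_] | move=> /eqP->;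
    rewrite eqxx]; rewrite ?orbF /=; case: b; case: (_ != _).
rewrite !inA /endpoint /=; case/orP: jq => /eqP /= -> /=; rewrite ?eqxx ?(negPf xv) /=.
  by [].
by case: x {xv} => ?; rewrite eqxx orbT.
Qed.

Lemma expand_joins_new : joins o'.1 (ord0, (int_ k (lift ord0 v), int_ k ord0)).
Proof. by rewrite /joins /= !ffunE unlift_none eqxx. Qed.

Lemma expand_links_joins : all (joins o'.1) (links expand_theta).
Proof.
have [g' gE] : exists g' : digraph k n.+1 e.+1, g' = o'.1 by exists o'.1.
rewrite -[X in all (joins X)]gE.
have uw := theta_on_uniq t_on; have [vw vi wi ui] := nodes_uniq t_on.
case/and4P: t_on => _ _ _ tj.
pose y := head (sink t) (strand_nodes (j1, (strand1 t).2)).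
pose rest := hair_links (sink t) (sink_hair t)
  ++ behead (strand_links v j1 (strand1 t).2 (sink t))
  ++ strand_links v (strand2 t).1 (strand2 t).2 (sink t)
  ++ strand_links v (strand3 t).1 (strand3 t).2 (sink t).
have lE : perm_eq (links t) [:: (h, (int_ k v, ext n i)), (j1, (int_ k v, int_ k y)) & rest].
  rewrite /links t_hair [strand_links _ (strand1 t).1 _ _]strand_links_cons.
  apply/seq.permP=> a; rewrite /rest /= !count_cat /= !count_cat.
  have ar (c1 c2 c3 c4 : nat) : (c1 + (c2 + (c3 + c4)) = c1 + (c3 + (c2 + c4)))%N by clear; lia.
  exact: ar.
have /= /and3P[jh jj jr] : all (joins o.1) [:: (h, (int_ k v, ext n i)), (j1, (int_ k v, int_ k y)) & rest].
  by rewrite -(perm_all _ lE).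
have hrest : all (fun q : link k n e => joins o'.1 (map_link id (lift ord0) (lift ord0) q)) rest.
  apply/allP=> q qr; have : uniq [:: h, j1 & unzip1 rest].
    by rewrite -(perm_uniq (perm_map fst lE)) -/(unzip1 _) unzip1_links.
  rewrite /= inE negb_or => /and3P[/andP[_ hr] jr' _].
  have q1 : q.1 \in unzip1 rest by apply: map_f.
  apply: expand_joins; first exact: (allP jr).
    by apply: contraNneq hr => <-.
  by apply: contraNneq jr' => <-.
have yv : int_ k y != int_ k v.
  have : (y == sink t) || (y \in inner_nodes t).
    rewrite /y /inner_nodes /strand_nodes; case: (strand1 t).2 => [|p l] /=.
      by rewrite eqxx.
    by rewrite inE eqxx orbT.
  by apply: contraTneq => -[->]; rewrite negb_or vw vi.
have jh' := expand_joins_moved (mem_head _ _) jh isT.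
have jj' : joins o'.1 (lift ord0 j1, (int_ k ord0, map_vertex id (lift ord0) (int_ k y))).
  by apply: expand_joins_moved; rewrite // !inE eqxx orbT.
have jn := expand_joins_new; rewrite -gE in jh' jj' jn hrest; rewrite /rest !all_cat in hrest.
case/and4P: hrest => H1 H2 H3 H4.
rewrite /links !all_cat; apply/and5P; split=> //.
- move: H1; rewrite /hair_links /= -map_comp !all_map; apply.
- rewrite /= -/v jn jh' /= [strand_links _ _ _ _]strand_links_cons /=.
  rewrite (behead_strand_links _ (lift ord0 v)).
  have -> := map_strand_links id (lift ord0) (lift ord0) v (strand1 t) (sink t).
  rewrite behead_map all_map H2 andbT.
  by move: jj'; rewrite /y /strand_nodes /=; case: (strand1 t).2.
- by rewrite /= map_strand_links all_map H3.
by rewrite /= map_strand_links all_map H4.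
Qed.

Lemma expand_theta_on : theta_on expand_theta o'.1.
Proof.
case/and4P: t_on => tn tx tw _; rewrite /theta_on expand_links_joins andbT.
apply/and3P; split.
- have -> : enum 'I_n.+1 = ord0 :: map (lift ord0) (enum 'I_n) by rewrite enum_ordSl.
  apply: (@perm_trans _ (ord0 :: map (lift ord0) (nodes t))); last first.
    by rewrite perm_cons perm_map.
  rewrite -(nodes_map id (lift ord0) (lift ord0)); apply/seq.permP=> a.
  rewrite /nodes /strand_nodes /= !count_cat /=.
  have ar (c1 c2 c3 c4 : nat) : (c1 + (c2 + (c3 + c4)) = c3 + (c1 + (c2 + c4)))%N by clear; lia.
  exact: ar.
- apply: perm_trans tx; have <- : exts (map_theta id (lift (@ord0 n)) (lift (@ord0 e)) t) = exts t.
    by rewrite exts_map map_id.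
  rewrite /exts /strand_exts /= t_hair; apply/seq.permP=> a.
  by rewrite /= !count_cat /= !count_cat addnCA.
- have -> : enum 'I_e.+1 = ord0 :: map (lift ord0) (enum 'I_e) by rewrite enum_ordSl.
  apply: (@perm_trans _ (ord0 :: map (lift ord0) (word t))); last first.
    by rewrite perm_cons perm_map.
  rewrite -(word_map id (lift ord0)) /word /= t_hair; apply/seq.permP=> a.
  rewrite /strand_word /= !count_cat /= !count_cat /=.
  have ar (c1 c2 c3 c4 : nat) : (c1 + (c2 + (c3 + c4)) = c2 + (c3 + (c1 + c4)))%N by clear; lia.
  exact: ar.
Qed.

End Source.
End ExpandTheta.

(** * One vector for each shape *)

Section ThetaVector.
Variables (m N k n e : nat).
Hypotheses (N_gt0 : (0 < N)%N) (m_even : ~~ odd m) (N_even : ~~ odd N).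
Implicit Types (o : ograph k n e) (t : theta k n e).

Definition is_theta_class sh (X : GC m N k n e) : Prop :=
  exists o t, [/\ theta_on t o.1, shape t = sh & X = theta_class m N o t].

(** By [theta_class_eq] the choice of a representative does not matter. Shapes which no graph
    realises get 0, so the symmetry relations hold for all shapes without side conditions. *)
Definition theta_vec sh : GC m N k n e :=
  if pselect (exists X, is_theta_class sh X) is left ex then projT1 (cid ex) else 0.

Lemma theta_vecE o t : theta_on t o.1 -> theta_class m N o t = theta_vec (shape t).
Proof.
move=> to; rewrite /theta_vec; case: pselect => [ex|[]]; last first.
  by exists (theta_class m N o t), o, t.
case: (cid ex) => X /= [o' [t' [to' sh ->]]].
exact: theta_class_eq.
Qed.

Lemma theta_vec_none sh : (forall o t, theta_on t o.1 -> shape t <> sh) -> theta_vec sh = 0.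
Proof.
by move=> no; rewrite /theta_vec; case: pselect => // ex; case: notF;
  case: ex => X [o [t [to sh' _]]]; case: (no o t).
Qed.

Lemma theta_vec_case sh : (exists o t, theta_on t o.1 /\ shape t = sh) \/ theta_vec sh = 0.
Proof.
have [[o [t H]]|no] := pselect (exists o t, theta_on t o.1 /\ shape t = sh).
  by left; exists o, t.
by right; apply: theta_vec_none => o t to sh'; apply: no; exists o, t.
Qed.

(** f carries realisations of sh to realisations of sh' and f' goes back, so either both shapes are
    realised or both vectors are 0. *)
Lemma theta_vec_op sh sh' (x : rat) (f f' : theta k n e -> theta k n e) :
  (forall o t, theta_on t o.1 -> shape t = sh ->
     [/\ theta_on (f t) o.1, shape (f t) = sh'
       & theta_class m N o (f t) = x *: theta_class m N o t]) ->
  (forall o t, theta_on t o.1 -> shape t = sh' -> theta_on (f' t) o.1 /\ shape (f' t) = sh) ->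
  theta_vec sh' = x *: theta_vec sh.
Proof.
move=> fE f'E; have [[o [t [to tsh]]]|z] := theta_vec_case sh.
  have [fo fsh fx] := fE o t to tsh.
  by rewrite -{1}fsh -(theta_vecE fo) fx (theta_vecE to) tsh.
have [[o [t [to tsh]]]|z'] := theta_vec_case sh'; last by rewrite z z' scaler0.
have [fo fsh] := f'E o t to tsh; have [ffo ffsh fx] := fE o _ fo fsh.
by rewrite -{1}ffsh -(theta_vecE ffo) fx (theta_vecE fo) fsh.
Qed.

Lemma theta_vec_swap12 pq a b c : theta_vec (pq, (b, a, c)) = - theta_vec (pq, (a, b, c)).
Proof.
rewrite -scaleN1r; apply: (theta_vec_op (f := @swap12 k n e) (f' := @swap12 k n e)) => o t to.
  by case=> <- <- <- <-; split; rewrite ?scaleN1r ?theta_class_swap12 ?theta_on_swap12.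
by case=> <- <- <- <-; split; rewrite ?theta_on_swap12.
Qed.

Lemma theta_vec_swap23 pq a b c : theta_vec (pq, (a, c, b)) = - theta_vec (pq, (a, b, c)).
Proof.
rewrite -scaleN1r; apply: (theta_vec_op (f := @swap23 k n e) (f' := @swap23 k n e)) => o t to.
  by case=> <- <- <- <-; split; rewrite ?scaleN1r ?theta_class_swap23 ?theta_on_swap23.
by case=> <- <- <- <-; split; rewrite ?theta_on_swap23.
Qed.

Lemma theta_vec_rev p q a b c : theta_vec ((q, p), (a, b, c)) =
  (-1) ^+ (p * q + (a + b + c)) *: theta_vec ((p, q), (a, b, c)).
Proof.
apply: (theta_vec_op (f := @rev_theta k n e) (f' := @rev_theta k n e)) => o t to.
  case=> <- <- <- <- <-; split; rewrite ?theta_on_rev ?shape_rev //.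
  exact: theta_class_rev.
by case=> <- <- <- <- <-; split; rewrite ?theta_on_rev ?shape_rev.
Qed.

Lemma self_opp_eq0 (V : lmodType rat) (v : V) : v = - v -> v = 0.
Proof.
move/eqP; rewrite -addr_eq0 -mulr2n -scaler_nat scaler_eq0 pnatr_eq0 /=.
by move/eqP.
Qed.

Lemma theta_vec_eq12 pq a c : theta_vec (pq, (a, a, c)) = 0.
Proof. exact/self_opp_eq0/theta_vec_swap12. Qed.

Lemma theta_vec_rev_odd p a b c : odd (p * p + (a + b + c)) ->
  theta_vec ((p, p), (a, b, c)) = 0.
Proof.
move=> par; apply: self_opp_eq0.
by rewrite {1}theta_vec_rev -signr_odd par expr1 scaleN1r.
Qed.

End ThetaVector.

Section ExpandSign.
Variables (m N k n e : nat).
Hypotheses (N_gt0 : (0 < N)%N) (m_even : ~~ odd m) (N_even : ~~ odd N).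
Implicit Types (o : ograph k n e) (t : theta k n e).

Definition hair_pair o t (h j : 'I_e) : {set halfedge e} :=
  [set half_at o.1 (int_ k (source t)) h; half_at o.1 (int_ k (source t)) j].

Lemma shape_expand_theta t i h : shape (expand_theta t i h) = ((0, size (sink_hair t)),
    ((size (strand1 t).2).+1, size (strand2 t).2, size (strand3 t).2))%N.
Proof. by rewrite /shape /= !size_map. Qed.

(** The new edge precedes all others, so putting it in front of the word creates no inversion. The
    block formed by it and h has even length and moves past the sink hairs without a sign. *)
Lemma word_sign_expand o v (A : {set halfedge e}) t i h :
  source_hair t = [:: (i, h)] ->
  theta_on (expand_theta t i h) (expand o v A).1 ->
  word_sign (edge_rel (expand o v A).2) (word (expand_theta t i h))
  = word_sign (edge_rel o.2) (word t).
Proof.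
move=> th to'; set r' := edge_rel (expand o v A).2.
have uw := theta_on_uniq to'.
have r0 j : r' ord0 (lift ord0 j) by rewrite /r' /edge_rel !ole_mk /= unlift_none liftK.
have rl j j' : r' (lift ord0 j) (lift ord0 j') = edge_rel o.2 j j'.
  by rewrite /r' /edge_rel !ole_mk /= !liftK.
rewrite -(@word_sign_map _ _ (edge_rel o.2) r' (lift ord0) (word t)); last first.
  by move=> x y _ _; apply: rl.
have -> : word_sign r' (map (lift ord0) (word t)) = word_sign r' (ord0 :: map (lift ord0) (word t)).
  rewrite /word_sign /= count_map (eq_count (a2 := pred0)) ?count_pred0 //.
  by move=> j /=; rewrite r0.
rewrite -(word_map id (lift ord0)).
pose mt : theta k n.+1 e.+1 := map_theta id (lift ord0) (lift ord0) t; rewrite -/mt.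
pose K := unzip2 (sink_hair mt).
pose Q := strand_word (strand1 mt) ++ strand_word (strand2 mt) ++ strand_word (strand3 mt).
have e1 : word (expand_theta t i h) = [::] ++ K ++ [:: ord0; lift ord0 h] ++ Q by [].
have e2 : ord0 :: word mt = [::] ++ [:: ord0; lift ord0 h] ++ K ++ Q.
  by rewrite /word /mt /= th.
rewrite e2 e1 word_sign_swap; first by rewrite -signr_odd oddM /= mul1r.
- exact: edge_rel_total.
- exact: edge_rel_anti.
have : perm_eq (word (expand_theta t i h)) (([:: ord0; lift ord0 h] ++ K) ++ Q).
  by rewrite e1 cat0s catA perm_cat2r perm_catC.
by move/perm_uniq => pe; apply: subseq_uniq (prefix_subseq _ Q) _; rewrite -pe.
Qed.

Lemma theta_class_expand o t i h : theta_on t o.1 -> source_hair t = [:: (i, h)] ->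
  let: (a, b, c) := (shape t).2 in let q := size (sink_hair t) in
  word_sign (edge_rel o.2) (word t) *: gclass m N (expand o (source t) (hair_pair o t h (strand1 t).1))
  = theta_vec m N k n.+1 e.+1 ((0, q), (a.+1, b, c))%N.
Proof.
move=> to th /=; have to' := expand_theta_on to th.
by rewrite -(word_sign_expand th to') -(shape_expand_theta t i h) -(theta_vecE N_gt0 m_even N_even to').
Qed.

(** The three splittings pair the hair with the first edge of each strand. The last two reduce to
    [theta_class_expand] by exchanging strands, and the sign in the word cancels against the sign of
    the shape. *)
Lemma sum_splittings_source o t i h : theta_on t o.1 -> source_hair t = [:: (i, h)] ->
  let: (a, b, c) := (shape t).2 in let q := size (sink_hair t) in
  word_sign (edge_rel o.2) (word t) *:
    (\sum_(P in splittings o.1 (source t))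
      gclass m N (expand o (source t) (odflt set0 [pick A in P])))
  = theta_vec m N k n.+1 e.+1 ((0, q), (a.+1, b, c))%N
    + theta_vec m N k n.+1 e.+1 ((0, q), (a, b.+1, c))%N
    + theta_vec m N k n.+1 e.+1 ((0, q), (a, b, c.+1))%N.
Proof.
move=> to th /=.
pose js := h :: source_edges t; pose v := source t.
have sE : perm_eq js (unzip2 (source_hair t) ++ source_edges t) by rewrite th.
have ujs : uniq js.
  apply: subseq_uniq (theta_on_uniq to); rewrite /js /word th -[h :: _]/([:: h] ++ _).
  apply: cat_subseq => //; apply: subseq_trans (suffix_subseq _ _).
  rewrite -[source_edges t]/([:: _] ++ [:: _] ++ [:: _]).
  by do 2?[apply: cat_subseq]; rewrite sub1seq inE eqxx.
have uh : uniq [seq half_at o.1 (int_ k v) j | j <- js].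
  by rewrite map_inj_uniq //; apply: half_at_inj.
have hE : halves o.1 (int_ k v) = [set half_at o.1 (int_ k v) h;
    half_at o.1 (int_ k v) (strand1 t).1; half_at o.1 (int_ k v) (strand2 t).1;
    half_at o.1 (int_ k v) (strand3 t).1].
  apply/esym/eqP; rewrite eqEcard; apply/andP; split; last first.
    rewrite -/(valence _ _) (valence_source to) th.
    have -> : (size [:: (i, h)] + 3 = size [seq half_at o.1 (int_ k v) j | j <- js])%N by [].
    rewrite -(card_uniqP uh); apply/subset_leq_card/subsetP=> x.
    by rewrite !inE -!orbA.
  have half_in j : j \in js -> half_at o.1 (int_ k v) j \in halves o.1 (int_ k v).
    rewrite (perm_mem sE) -(source_incident _ to) /incident /half_at inE /endpoint /=.
    by case: eqP => //= ->.
  by rewrite !subUset !sub1set !half_in // !inE eqxx ?orbT.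
rewrite (sum_splittings m N uh hE) !scalerDr; congr (_ + _ + _).
- have E := theta_class_expand to th; exact: E.
- have E := theta_class_expand (theta_on_swap12 to) th.
  rewrite (word_sign_swap12 (@edge_rel_total _ _ _ _) (@edge_rel_anti _ _ _ _))
    ?(theta_on_uniq to) // scaleNr in E.
  by rewrite -[LHS]opprK [in LHS]E -theta_vec_swap12.
(* Two exchanges bring the third strand to the front, so the total sign is +1 on both sides. *)
have to' := theta_on_swap23 to.
have E := theta_class_expand (theta_on_swap12 to') th.
rewrite (word_sign_swap12 (@edge_rel_total _ _ _ _) (@edge_rel_anti _ _ _ _))
  ?(theta_on_uniq to') // (word_sign_swap23 (@edge_rel_total _ _ _ _) (@edge_rel_anti _ _ _ _))
  ?(theta_on_uniq to) // opprK in E.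
rewrite [LHS]E.
by rewrite theta_vec_swap12 // theta_vec_swap23 // opprK.
Qed.

Definition split_sum o x : GC m N k n.+1 e.+1 :=
  \sum_(P in splittings o.1 x) gclass m N (expand o x (odflt set0 [pick A in P])).

Definition add_hair (q : nat) (T : nat * nat * nat) : GC m N k n.+1 e.+1 :=
  let: (a, b, c) := T in
  theta_vec m N k n.+1 e.+1 ((0, q), (a.+1, b, c))%N
  + theta_vec m N k n.+1 e.+1 ((0, q), (a, b.+1, c))%N
  + theta_vec m N k n.+1 e.+1 ((0, q), (a, b, c.+1))%N.

Lemma split_sum_small o x : (valence o.1 (int_ k x) <= 3)%N -> split_sum o x = 0.
Proof. by move=> x3; rewrite /split_sum splittings_small // big_set0. Qed.

Lemma split_sum_source o t p : theta_on t o.1 -> size (source_hair t) = p ->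
  (p <= 1)%N -> word_sign (edge_rel o.2) (word t) *: split_sum o (source t) =
    p%:R *: add_hair (size (sink_hair t)) (shape t).2.
Proof.
move=> to; case E: (source_hair t) => [|[i h] [|//]] /= <- // _.
  rewrite scale0r split_sum_small ?scaler0 //.
  by rewrite (valence_source to) E.
by rewrite scale1r; apply: sum_splittings_source to E.
Qed.

(** Inner vertices are trivalent and do not split. The sink of t is the source of [rev_theta t],
    whence the sign of the second term. *)
Lemma diff_theta_class o t : theta_on t o.1 ->
  (size (source_hair t) <= 1)%N -> (size (sink_hair t) <= 1)%N ->
  diff m N k n e (theta_class m N o t) =
    (size (source_hair t))%:R *: add_hair (size (sink_hair t)) (shape t).2
    + ((-1) ^+ (size (source_hair t) * size (sink_hair t)
        + (size (strand1 t).2 + size (strand2 t).2 + size (strand3 t).2))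
       * (size (sink_hair t))%:R) *: add_hair (size (source_hair t)) (shape t).2.
Proof.
move=> to h1 h2; have to' := theta_on_rev to.
have dE : diff m N k n e (gclass m N o) = split_sum o (source t) + split_sum o (sink t).
  rewrite diffE /boundary_graph linear_sum /=.
  rewrite (eq_bigr (split_sum o)) => [|x _]; last by rewrite linear_sum.
  have [vw vi wi _] := nodes_uniq to.
  rewrite (bigD1 (source t)) //= (bigD1 (sink t)) /= ?[sink t == _]eq_sym //.
  rewrite big1 ?addr0 // => x /andP[xv xw]; apply: split_sum_small.
  rewrite (valence_inner to) //; have := nodes_mem x to.
  by rewrite (negPf xv) (negPf xw).
rewrite linearZ_LR /= dE scalerDr (split_sum_source to (erefl _)) //; congr (_ + _).
have := split_sum_source to' (erefl _) h2.
rewrite (word_sign_rev_theta (@edge_rel_total _ _ _ _) (@edge_rel_anti _ _ _ _) (theta_on_uniq to)).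
rewrite shape_rev /= => E; rewrite -[RHS]scalerA -E scalerA mulrA -expr2.
by rewrite sqrr_sign mul1r.
Qed.

End ExpandSign.

Lemma connect_invariant (T : finType) (r : rel T) (P : pred T) x y :
  (forall c d, P c -> r c d -> P d) -> P x -> connect r x y -> P y.
Proof.
move=> Pr + /connectP[p + ->]; elim: p x => //= z p IH x Px /andP[xz].
by apply: IH; apply: Pr xz.
Qed.

(** * Two-loop hairy graphs are Theta-graphs *)

Section Connectivity.
Variables (k n e : nat) (g : digraph k n e).
Implicit Types (S : {set cell k n e}) (c d : cell k n e) (x : vertex k n) (j : 'I_e).

Lemma adj_sym S : symmetric (adj g S).
Proof.
by move=> c d; rewrite /adj andbCA; case: c => [x|j]; case: d => [y|i].
Qed.

Lemma adj_connect_sym S : connect_sym (adj g S).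
Proof. exact/sym_connect_sym/adj_sym. Qed.

Lemma connected_inP S r : r \in S -> (forall c, c \in S -> connect (adj g S) r c) ->
  connected_in g S.
Proof.
move=> rS H; apply/andP; split; first by apply/set0Pn; exists r.
apply/forall_inP=> c /H rc; apply/forall_inP=> d /H rd.
by apply: connect_trans rd; rewrite adj_connect_sym.
Qed.

Lemma connected_in_connect S c d : connected_in g S -> c \in S -> d \in S ->
  connect (adj g S) c d.
Proof. by case/andP=> _ /forall_inP H cS dS; apply: (forall_inP (H c cS)). Qed.

Lemma connected_in_invariant S (P : pred (cell k n e)) r : connected_in g S ->
  r \in S -> P r -> (forall c d, P c -> adj g S c d -> P d) -> forall c, c \in S -> P c.
Proof.
move=> cS rS Pr PP c cS'; apply: connect_invariant PP Pr _.
exact: connected_in_connect.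
Qed.

Section Leaf.
Variables (x z : vertex k n) (j : 'I_e).
Hypotheses (g_conn : connected_in g setT) (x_leaf : valence g x = 1%N)
  (sizes : e = (k + n).+1) (j_xz : joins g (j, (x, z))).

Lemma leaf_neq : x != z.
Proof.
apply/eqP=> xz; have : [set (j, false); (j, true)] \subset halves g x.
  apply/subsetP=> h; move: j_xz; rewrite /joins -xz /= !inE orbb => /eqP gj.
  by case/orP=> /eqP->; rewrite /endpoint /= gj eqxx.
by move/subset_leq_card; rewrite -/(valence g x) x_leaf cards2 xpair_eqE andbF.
Qed.

Lemma leaf_incident i : incident g x i -> i = j.
Proof.
move=> xi; have : i \in [:: j].
  apply: incident_exhaust xi => //=; last by rewrite x_leaf.
  by rewrite (joins_incident j_xz).
by rewrite inE => /eqP.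
Qed.

Let S := [set~ ecell k n j].

Lemma leaf_component : component g S (vcell e x) = [set vcell e x].
Proof.
apply/setP=> d; rewrite !inE; apply/idP/eqP => [/andP[_]|->]; last by rewrite connect0.
move=> xd; apply/eqP; move: xd.
apply: (@connect_invariant _ (adj g S) (fun c => c == vcell e x)) => // c d' /eqP-> /and3P[_].
case: d' => // i dS /leaf_incident ij; by move: dS; rewrite ij !inE eqxx.
Qed.

Lemma rest_component : component g S (vcell e z) = S :\ vcell e x.
Proof.
have zS : vcell e z \in S by rewrite !inE.
apply/setP=> d; rewrite in_setD1; apply/idP/andP => [dz|[dx dS]].
  have dS : d \in S by move: dz; rewrite inE => /andP[].
  split=> //; apply: contraTneq dz => ->; apply/negP => xz.
  have : vcell e z \in component g S (vcell e x).
    by move: xz; rewrite !inE adj_connect_sym.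
  rewrite leaf_component inE => /eqP[zx].
  by move: leaf_neq; rewrite zx eqxx.
(* Adding x and j makes the predicate closed under adjacency in the whole graph, whose connectedness
   then applies. *)
pose P c := [|| c == vcell e x, c == ecell k n j | c \in component g S (vcell e z)].
suff /or3P[|/eqP E|//] : P d; first by rewrite (negPf dx).
  by move: dS; rewrite E !inE eqxx.
apply: (connected_in_invariant g_conn (r := vcell e z)); rewrite ?inE //.
  by rewrite /P !inE connect0 /= !orbT.
move=> a b; rewrite /P => /or3P[/eqP->|/eqP->|az] /and3P[_ _].
- by case: b => // i /leaf_incident ->; rewrite eqxx orbT.
- case: b => // y; rewrite /incident; move: j_xz; rewrite /joins /= => /orP[]/eqP-> /=;
  by case/orP=> /eqP<-; rewrite ?eqxx // !inE connect0 !orbT.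
move=> ab; have [->|bj] := eqVneq b (ecell k n j); first by rewrite orbT.
apply/or3P/Or33; move: az; rewrite !inE bj => /andP[aj za] /=.
apply: connect_trans za _; apply: connect1; rewrite /adj !inE aj bj.
by [].
Qed.

(** Deleting j isolates x, which is a tree. The other part has k + n edges and k + n - 1 vertices,
    hence Betti number 2, so exactly one part is a tree. *)
Lemma leaf_tree_type : tree_type g j.
Proof.
have zS : vcell e z \in S by rewrite !inE.
have nconn : ~~ connected_in g S.
  apply/negP=> cS; have := connected_in_connect (c := vcell e x) (d := vcell e z) cS.
  rewrite !inE => /(_ isT isT) xz.
  have : vcell e z \in component g S (vcell e x) by rewrite !inE.
  by rewrite leaf_component inE => /eqP[zx]; move: leaf_neq; rewrite zx eqxx.
have tx : is_tree g (component g S (vcell e x)).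
  rewrite /is_tree leaf_component; apply/andP; split.
    by apply: (connected_inP (r := vcell e x)); rewrite ?inE // => c; rewrite inE => /eqP->.
  rewrite /betti1 (_ : [set i | _] = set0) ?cards0; last by apply/setP=> i; rewrite !inE.
  rewrite (_ : [set y | _] = [set x]) ?cards1 //.
  by apply/setP=> y; rewrite !inE (inj_eq inl_inj).
have tz : is_tree g (component g S (vcell e z)) = false.
  rewrite /is_tree rest_component; apply/negbTE; rewrite negb_and; apply/orP; right.
  rewrite /betti1 (_ : [set i | _] = [set~ j]); last first.
    by apply/setP=> i; rewrite !inE /= (inj_eq inr_inj).
  rewrite (_ : [set y | _] = [set~ x]); last first.
    by apply/setP=> y; rewrite !inE /= andbT (inj_eq inl_inj).
  by rewrite !cardsC1 card_ord card_sum !card_ord sizes /=; lia.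
rewrite /tree_type -/S nconn /=; move: j_xz; rewrite /joins /= => /orP[]/eqP-> /=;
by rewrite tx tz.
Qed.

End Leaf.
End Connectivity.

(** d is the distance from x0: a last step of a shortest walk to c comes from a closer element. *)
Lemma distance_fun (T : finType) (r : rel T) (S : {set T}) x0 :
  (forall c, c \in S -> connect r x0 c) ->
  exists d : T -> nat, forall c, c \in S -> c != x0 ->
    exists2 c', r c' c & (d c' < d c)%N.
Proof.
move=> S0; pose L := fix L m := if m is m'.+1 then
  [set c | [exists c', (c' \in L m') && r c' c]] else [set x0].
(* The least level containing c; elements in no level get 0, which is harmless as all of S is
   reached. *)
have dP c : exists m, forall m', c \in L m' -> (m <= m')%N /\ c \in L m.
  have [[m cm]|no] := pselect (exists m, c \in L m); last first.
    by exists 0%N => m' cm'; case: no; exists m'.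
  have ex : exists m, c \in L m by exists m.
  by case: (ex_minnP ex) => m0 cm0 min; exists m0 => m' /min.
have [d dE] := fin_all_exists dP; exists d => c /S0/connectP[p + cE].
have {cE} : c \in L (size p) \/ ~~ path r x0 p.
  have [pp|] := boolP (path r x0 p); [left | by right].
  rewrite cE; elim/last_ind: p pp {cE} => [|p y IH]; first by rewrite inE.
  rewrite rcons_path last_rcons size_rcons => /andP[/IH pm py].
  by rewrite /= inE; apply/existsP; exists (last x0 p); rewrite pm.
case=> [|/negP//] cp _ cx; have [_] := dE c _ cp.
case E: (d c) => [|m]; first by rewrite inE (negPf cx).
rewrite /= inE => /existsP[c' /andP[c'm c'c]]; exists c' => //.
by have [] := dE c' _ c'm.
Qed.

Section TwoLoopStructure.
Variables (k n e : nat) (g : digraph k n e).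
Hypothesis g_tlh : two_loop_hairy g.

Let F j := ~~ tree_type g j.

Lemma tlh_connected : connected_in g setT.
Proof. by case/and4P: g_tlh => /and4P[]. Qed.

Lemma tlh_ext i : valence g (ext n i) = 1%N.
Proof. by case/and4P: g_tlh => /and4P[_ _ /forallP/(_ i)/eqP]. Qed.

Lemma tlh_int x : (3 <= valence g (int_ k x))%N.
Proof. by case/and4P: g_tlh => /and4P[_ _ _ /forallP/(_ x)]. Qed.

Lemma tlh_sizes : e = (k + n).+1.
Proof.
case/and4P: g_tlh => _ + _ _; rewrite /betti1.
have -> : [set j | ecell k n j \in [set: cell k n e]] = setT by apply/setP=> j; rewrite !inE.
have -> : [set x | vcell e x \in [set: cell k n e]] = setT by apply/setP=> j; rewrite !inE.
by rewrite !cardsT card_sum !card_ord => /eqP; lia.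
Qed.

Lemma tlh_frame_connected x : vcell e x \in frame g -> connected_in g (frame g :\ vcell e x).
Proof.
case/and4P: g_tlh => _ _ /forallP/(_ x) + _ xf; by rewrite /cut_vertex xf negbK.
Qed.

Lemma tlh_hair j : tree_type g j -> is_hair g j.
Proof. by case/and4P: g_tlh => _ _ _ /forallP/(_ j)/implyP. Qed.

Lemma incident_joins x j : incident g x j -> exists y, joins g (j, (x, y)).
Proof.
rewrite /incident /joins /= => /orP[]/eqP E.
  by exists (g j).2; rewrite -E -surjective_pairing eqxx.
by exists (g j).1; rewrite -E -surjective_pairing eqxx orbT.
Qed.

Lemma frame_vertex x : (vcell e x \in frame g) = [exists j, F j && incident g x j].
Proof. by rewrite inE. Qed.

Lemma ext_notin_frame i : vcell e (ext n i) \notin frame g.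
Proof.
rewrite frame_vertex; apply/negP=> /existsP[j /andP[Fj /incident_joins[z jz]]].
by move: Fj; rewrite /F (leaf_tree_type tlh_connected (tlh_ext i) tlh_sizes jz).
Qed.

Lemma tlh_ext_edge i : exists h x, [/\ joins g (h, (int_ k x, ext n i)), tree_type g h
  & forall j, tree_type g j -> incident g (int_ k x) j -> j = h].
Proof.
have [h hi] : exists h, incident g (ext n i) h.
  have : (0 < valence g (ext n i))%N by rewrite tlh_ext.
  rewrite /valence card_gt0 => /set0Pn[[j b]]; rewrite inE /endpoint /= => jb.
  by exists j; rewrite /incident; case: b jb => ->; rewrite ?orbT.
have [z hz] := incident_joins hi.
have th := leaf_tree_type tlh_connected (tlh_ext i) tlh_sizes hz.
have /andP[_ /existsP[x /existsP[y /and4P[gh vx yf /forallP un]]]] := tlh_hair th.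
have hxy : joins g (h, (x, y)) by [].
case: y yf gh hxy un => [i'|y] yf gh hxy un.
  by move: yf; rewrite -[inl i']/(ext n i') (negPf (ext_notin_frame i')).
have xE : x = ext n i.
  move: hxy hz; rewrite /joins /ext /= => /orP[]/eqP-> /orP[]/eqP; congruence.
exists h, y; split=> //; first by rewrite joins_sym -xE.
by move=> j tj ij; have := un j; rewrite tj ij => /eqP.
Qed.


(** eta i is the edge at the external vertex i and iota i the frame vertex carrying it. A hair is
    the only tree-type edge at its frame vertex, which makes iota injective. A tree-type edge is
    some eta i because its univalent end cannot be internal. *)
Lemma tlh_hairs : exists (eta : 'I_k -> 'I_e) (iota : 'I_k -> 'I_n),
  [/\ forall i, joins g (eta i, (int_ k (iota i), ext n i)),
      forall j, tree_type g j = (j \in codom eta), injective eta, injective iota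
    & forall j x, tree_type g j -> incident g (int_ k x) j -> exists i, j = eta i /\ x = iota i].
Proof.
have [eta etaP] := fin_all_exists tlh_ext_edge.
have [iota iotaP] := fin_all_exists etaP; exists eta, iota.
have un i j : tree_type g j -> incident g (int_ k (iota i)) j -> j = eta i.
  by case: (iotaP i) => _ _; apply.
have jn i : joins g (eta i, (int_ k (iota i), ext n i)) by case: (iotaP i).
have eta_inj : injective eta.
  move=> i i' E; have := jn i; have := jn i'; rewrite -E /joins /ext /int_ /=.
  by move=> /orP[]/eqP-> /orP[]/eqP; congruence.
have tP j : tree_type g j = (j \in codom eta).
  apply/idP/codomP => [tj|[i ->]]; last by case: (iotaP i).
  have /andP[_ /existsP[x /existsP[y /and4P[gj /eqP vx _ _]]]] := tlh_hair tj.
  case: x vx gj => [i|x] vx gj; last by have := tlh_int x; rewrite vx.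
  exists i; have jE := jn i; rewrite joins_sym in jE.
  apply: (leaf_incident (tlh_ext i) jE); exact: (@joins_incident _ _ _ g j _ y).
split=> //.
  move=> i i' E; apply: eta_inj; apply: un; first by case: (iotaP i).
  by rewrite -E; apply: joins_incident (jn i).
move=> j x tj xj; move: (tj); rewrite tP => /codomP[i jE]; exists i; split=> //.
move: xj; rewrite jE /incident; have := jn i; rewrite /joins /= => /orP[]/eqP-> /=.
  by rewrite orbF => /eqP[].
by move=> /eqP[].
Qed.

End TwoLoopStructure.

(** * Degrees in the frame *)

Section FrameCounting.
Variables (k n e : nat) (g : digraph k n e).
Hypothesis g_tlh : two_loop_hairy g.
Variables (eta : 'I_k -> 'I_e) (iota : 'I_k -> 'I_n).
Hypotheses (eta_joins : forall i, joins g (eta i, (int_ k (iota i), ext n i)))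
  (treeE : forall j, tree_type g j = (j \in codom eta))
  (eta_inj : injective eta) (iota_inj : injective iota)
  (tree_int : forall j x, tree_type g j -> incident g (int_ k x) j ->
     exists i, j = eta i /\ x = iota i).

Definition frame_halves x : {set halfedge e} :=
  [set h in halves g (int_ k x) | ~~ tree_type g h.1].

Lemma halves_incident x h : h \in halves g x -> incident g x h.1.
Proof. by rewrite inE /endpoint /incident; case: ifP => _ ->; rewrite ?orbT. Qed.

Lemma eta_half i : half_at g (int_ k (iota i)) (eta i) \in halves g (int_ k (iota i)).
Proof.
have := joins_incident (eta_joins i); rewrite /incident /half_at inE /endpoint /=.
by case: eqP => [->|_] //=; rewrite eqxx.
Qed.

Lemma eta_half_unique i b : (eta i, b) \in halves g (int_ k (iota i)) ->
  (eta i, b) = half_at g (int_ k (iota i)) (eta i).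
Proof.
rewrite /half_at inE /endpoint /=; have := eta_joins i.
by rewrite /joins /= => /orP[]/eqP-> /=; case: b => //=; rewrite ?eqxx.
Qed.

Lemma card_frame_halves x :
  valence g (int_ k x) = (#|frame_halves x| + (x \in codom iota))%N.
Proof.
rewrite /valence -(cardsID (frame_halves x)); congr (_ + _)%N.
  by congr #|pred_of_set _|; apply/setP=> h; rewrite !inE; case: (endpoint _ _ == _).
have [/codomP[i ->]|xi] := boolP (x \in codom iota).
  rewrite (_ : _ :\: _ = [set half_at g (int_ k (iota i)) (eta i)]) ?cards1 //.
  apply/setP=> -[j b]; rewrite in_setD in_set1 [_ \in frame_halves _]in_set.
  apply/idP/eqP => [/andP[+ jb]|->].
    rewrite jb /= negbK => tj.
    have [i' [jE /iota_inj ii]] := tree_int tj (halves_incident jb).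
    by move: jb; rewrite jE -ii; apply: eta_half_unique.
  by rewrite eta_half /= treeE codom_f.
apply/eqP; rewrite cards_eq0; apply/eqP/setP=> h; rewrite in_setD in_set0 [_ \in frame_halves _]in_set.
apply/negP=> /andP[+ hx]; rewrite hx /= negbK => th.
have [i [_ xE]] := tree_int th (halves_incident hx).
by move: xi; rewrite xE codom_f.
Qed.

Lemma frame_halves_ge2 x : (2 <= #|frame_halves x|)%N.
Proof.
by have := tlh_int g_tlh x; rewrite card_frame_halves; case: (_ \in _); lia.
Qed.

Lemma frame_halves_hair x : #|frame_halves x| = 2%N -> x \in codom iota.
Proof.
by have := tlh_int g_tlh x; rewrite card_frame_halves; case: (_ \in _); lia.
Qed.

Lemma frame_endpoint h : ~~ tree_type g h.1 -> exists x, endpoint g h = int_ k x.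
Proof.
move=> th; case E: (endpoint g h) => [i|x]; last by exists x.
have hi : h \in halves g (ext n i) by rewrite inE E.
have jE := eta_joins i; rewrite joins_sym in jE.
by move: th; rewrite (leaf_incident (tlh_ext g_tlh i) jE (halves_incident hi)) treeE codom_f.
Qed.

Lemma card_frame_edges : #|[set j | ~~ tree_type g j]| = n.+1.
Proof.
have -> : [set j | ~~ tree_type g j] = ~: [set eta i | i in setT].
  apply/setP=> j; rewrite !inE treeE; congr (~~ _).
  by apply/codomP/imsetP => [[i ->]|[i _ ->]]; exists i.
rewrite cardsCs setCK card_imset // cardsT !card_ord (tlh_sizes g_tlh); lia.
Qed.

(** Handshake count over the frame edges, all of whose ends are internal vertices. *)
Lemma sum_frame_halves : (\sum_x #|frame_halves x| = 2 * n.+1)%N.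
Proof.
have -> : (2 * n.+1 = \sum_(h : halfedge e | ~~ tree_type g h.1) 1)%N.
  rewrite -card_frame_edges mulnC -[2%N]card_bool -cardsT -cardsX -sum1_card.
  by apply: eq_bigl => -[j b]; rewrite !inE andbT.
transitivity (\sum_x \sum_(h : halfedge e | ~~ tree_type g h.1) (endpoint g h == int_ k x))%N.
  apply: eq_bigr => x _; rewrite -sum1_card big_mkcond [RHS]big_mkcond /=.
  by apply: eq_bigr => h _; rewrite !inE; case: eqP; case: (tree_type _ _).
rewrite exchange_big /=; apply: eq_bigr => h /frame_endpoint[x ->].
rewrite (bigD1 x) //= eqxx big1 ?addn0 // => y yx.
by rewrite (inj_eq inr_inj) eq_sym (negPf yx).
Qed.

Lemma int_in_frame x : vcell e (int_ k x) \in frame g.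
Proof.
rewrite frame_vertex; have /card_gt0P[h] : (0 < #|frame_halves x|)%N.
  exact: leq_trans (frame_halves_ge2 x).
rewrite in_set => /andP[hx hF]; apply/existsP; exists h.1.
by rewrite hF halves_incident.
Qed.

(** These are the incidences between an edge and a vertex that both survive in [punctured v]. *)
Definition incidences v : {set halfedge e} :=
  [set h | ~~ tree_type g h.1 & endpoint g h != int_ k v].

Lemma card_incidences v : (#|incidences v| + #|frame_halves v| = 2 * n.+1)%N.
Proof.
rewrite -card_frame_edges mulnC -[2%N]card_bool -cardsT -cardsX.
rewrite -(cardsID (halves g (int_ k v)) (setX _ _)) addnC; congr (_ + _)%N.
  by apply: eq_card => -[j b]; rewrite !inE /= andbT andbC.
by apply: eq_card => -[j b]; rewrite !inE /= andbT andbC.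
Qed.

Definition punctured v : {set cell k n e} := frame g :\ vcell e (int_ k v).

(** There are n - 1 vertices and n + 1 edges. *)
Lemma card_punctured v : #|punctured v| = (2 * n)%N.
Proof.
have -> : punctured v = [set inl (inr x) | x in [set~ v]] :|: [set inr j | j in [set j | ~~ tree_type g j]].
  apply/setP=> c; rewrite !inE; case: c => [[i|x]|j].
  - have := ext_notin_frame g_tlh i; rewrite frame_vertex => /negPf ->.
    by rewrite andbF; apply/esym/negbTE; rewrite negb_or; apply/andP; split; apply/imsetP=> -[].
  - have := int_in_frame x; rewrite frame_vertex => ->; rewrite andbT.
    rewrite (inj_eq inl_inj) (inj_eq inr_inj).
    apply/idP/orP => [xv|[/imsetP[y + [->]]|/imsetP[]//]]; last by rewrite !inE.
    by left; apply/imsetP; exists x; rewrite ?inE.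
  apply/idP/orP => [jF|[/imsetP[]//|/imsetP[i + [->]]]]; last by rewrite inE.
  by right; apply/imsetP; exists j; rewrite ?inE.
rewrite cardsU (_ : _ :&: _ = set0) ?cards0 ?subn0; last first.
  by apply/setP=> c; rewrite !inE; apply/negP=> /andP[/imsetP[x _ ->] /imsetP[]].
rewrite !card_imset; [|by move=> a b []|by move=> a b []].
rewrite card_frame_edges cardsC1 card_ord; case: (n) v => [[]//|n' _]; lia.
Qed.

(* Rooting the connected set [punctured v] at c0, every other cell c sends its
   incidence with a cell closer to c0; comparing numbers of cells and of
   incidences shows that these are nearly all incidences. *)
Lemma rooted_incidences v c0 : c0 \in punctured v ->
  exists (d : cell k n e -> nat) (rho : cell k n e -> halfedge e),
  {in punctured v :\ c0 &, injective rho} /\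
  forall c, c \in punctured v :\ c0 -> rho c \in incidences v /\
    ((c = ecell k n (rho c).1 /\ d (vcell e (endpoint g (rho c))) < d c)
     \/ (c = vcell e (endpoint g (rho c)) /\ d (ecell k n (rho c).1) < d c))%N.
Proof.
move=> c0S; have cS := tlh_frame_connected g_tlh (int_in_frame v).
have [d dP] := distance_fun (fun c => connected_in_connect cS c0S).
have [j0 j0F] : exists j, ~~ tree_type g j.
  have /card_gt0P[j] : (0 < #|[set j | ~~ tree_type g j]|)%N by rewrite card_frame_edges.
  by rewrite inE; exists j.
have inE1 x j : incident g x j -> exists b, endpoint g (j, b) = x.
  by rewrite /incident /endpoint => /orP[]/eqP; [exists false | exists true].
have rhoP c : exists h, c \in punctured v :\ c0 -> h \in incidences v /\
    ((c = ecell k n h.1 /\ d (vcell e (endpoint g h)) < d c)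
     \/ (c = vcell e (endpoint g h) /\ d (ecell k n h.1) < d c))%N.
  have [cS'|] := boolP (c \in punctured v :\ c0); last by exists (j0, true).
  move: (cS'); rewrite in_setD1 => /andP[cc0 cS0].
  have [c' /and3P[c'S _ cc'] dc] := dP c cS0 cc0.
  case: c c' {cS'} cc0 cS0 c'S cc' dc => [x|j] [y|i] // cc0 cS0 c'S cc' dc.
    have [b xE] := inE1 _ _ cc'; exists (i, b) => _; rewrite xE; split; last by right.
    move: c'S cS0; rewrite /punctured !in_setD1 !inE xE /= => -> /andP[+ _].
    by rewrite (inj_eq inl_inj).
  have [b xE] := inE1 _ _ cc'; exists (j, b) => _; rewrite xE; split; last by left.
  move: c'S cS0; rewrite /punctured !in_setD1 !inE xE /= => /andP[+ _] ->.
  by rewrite (inj_eq inl_inj).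
have [rho rhoE] := fin_all_exists rhoP; exists d, rho; split=> //.
(* One incidence cannot serve both its edge and its vertex: each would be closer to c0 than the
   other. *)
move=> c c' /rhoE[_ H] /rhoE[_ H'] E; move: H H'; rewrite -E.
case=> [[cE dc]|[cE dc]] [[cE' dc']|[cE' dc']]; first by rewrite cE cE'.
- by rewrite -cE' in dc; rewrite -cE in dc'; have := ltn_trans dc dc'; rewrite ltnn.
- by rewrite -cE' in dc; rewrite -cE in dc'; have := ltn_trans dc dc'; rewrite ltnn.
by rewrite cE cE'.
Qed.

(** Here the absence of cut vertices enters: the 2n - 1 cells other than c0 inject into the
    incidences, of which there are 2(n+1) minus the degree of v. *)
Lemma frame_halves_le3 v : (#|frame_halves v| <= 3)%N.
Proof.
have [c0 c0S] : exists c, c \in punctured v.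
  have n0 : (0 < n)%N by case: (n) v => [[]|].
  by apply/card_gt0P; rewrite card_punctured; lia.
have [d [rho [rho_inj rhoP]]] := rooted_incidences c0S.
have := card_incidences v.
have : (#|punctured v :\ c0| <= #|incidences v|)%N.
  rewrite -(card_in_imset rho_inj); apply/subset_leq_card/subsetP => h /imsetP[c cS ->].
  by case: (rhoP c cS).
have := cardsD1 c0 (punctured v); rewrite c0S card_punctured.
by move: #|punctured v :\ c0| #|incidences v| #|frame_halves v| => a b c; clear; lia.
Qed.

(** All degrees are 2 or 3 and they sum to 2n + 2. *)
Lemma essential_vertices : exists v w, [/\ v != w, #|frame_halves v| = 3%N,
  #|frame_halves w| = 3%N & forall x, x != v -> x != w -> #|frame_halves x| = 2%N].
Proof.
pose E := [set x | #|frame_halves x| == 3%N].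
have fE x : #|frame_halves x| = (2 + (x \in E))%N.
  rewrite inE; have := frame_halves_le3 x; have := frame_halves_ge2 x.
  by case: #|_| => [|[|[|[|]]]].
have : #|E| == 2%N.
  have := sum_frame_halves; rewrite (eq_bigr _ (fun x _ => fE x)) big_split /= sum_nat_const card_ord.
  rewrite -big_mkcond sum1_card => H; apply/eqP; move: H; move: #|E| => a; lia.
case/cards2P=> v [w [vw EE]]; exists v, w; split=> //.
- by rewrite fE EE !inE eqxx.
- by rewrite fE EE !inE eqxx orbT.
by move=> x xv xw; rewrite fE EE !inE (negPf xv) (negPf xw).
Qed.

End FrameCounting.

(* The frame of a two-loop hairy graph, each edge directed from one essential
   vertex v to the other one w. *)
Record directed_frame k n e (g : digraph k n e) (eta : 'I_k -> 'I_e) (iota : 'I_k -> 'I_n)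
    (v w : 'I_n) (S T : 'I_e -> 'I_n) (out : 'I_n -> 'I_e) (d : cell k n e -> nat)
    (starts : seq 'I_e) : Prop := DirectedFrame {
  df_eta : forall i, joins g (eta i, (int_ k (iota i), ext n i));
  df_eta_inj : injective eta;
  df_iota_inj : injective iota;
  df_iota : forall x, x != v -> x != w -> x \in codom iota;
  df_neq : v != w;
  df_joins : forall j, j \notin codom eta -> joins g (j, (int_ k (S j), int_ k (T j)));
  df_target : forall j, j \notin codom eta -> T j != v;
  df_source : forall j, j \notin codom eta -> S j != w;
  df_out : forall x, x != v -> x != w -> out x \notin codom eta /\ S (out x) = x;
  df_outK : forall j, j \notin codom eta -> S j != v -> out (S j) = j;
  df_in : forall x, x != v -> x != w -> exists2 j, j \notin codom eta & T j = x;
  df_in_unique : forall i j, i \notin codom eta -> j \notin codom eta ->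
    T i != w -> T i = T j -> i = j;
  df_dist_edge : forall j, j \notin codom eta -> (d (vcell e (int_ k (T j))) < d (ecell k n j))%N;
  df_dist_node : forall x, x != v -> x != w ->
    (d (ecell k n (out x)) < d (vcell e (int_ k x)))%N;
  df_starts_uniq : uniq starts;
  df_starts_size : size starts = 3%N;
  df_starts : forall j, j \in starts = (j \notin codom eta) && (S j == v) }.

(** * Directing the frame from one essential vertex to the other *)

Section Directed.
Variables (k n e : nat) (g : digraph k n e).
Hypothesis g_tlh : two_loop_hairy g.

(** Puncture at v and root at w. As v has degree 3, rho injects 2n - 1 cells into 2n - 1 incidences
    and is a bijection. The half rho j points along j towards w and ends at T j, the opposite half
    starts at S j, and [out x] is the edge of the half rho x. *)
Lemma two_loop_directed : exists eta iota v w S T out d starts,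
  @directed_frame k n e g eta iota v w S T out d starts.
Proof.
have [eta [iota [eta_joins treeE eta_inj iota_inj tree_int]]] := tlh_hairs g_tlh.
have [v [w [vw v3 w3 x2]]] := essential_vertices g_tlh eta_joins treeE eta_inj iota_inj tree_int.
have fP x : vcell e (int_ k x) \in frame g.
  exact: (int_in_frame g_tlh eta_joins treeE iota_inj tree_int).
have FE j : (ecell k n j \in frame g) = (j \notin codom eta) by rewrite inE /= treeE.
have pE j : (ecell k n j \in punctured g v :\ vcell e (int_ k w)) = (j \notin codom eta).
  by rewrite !in_setD1 FE.
have pV x : (vcell e (int_ k x) \in punctured g v :\ vcell e (int_ k w)) = (x != v) && (x != w).
  by rewrite !in_setD1 fP andbT !(inj_eq inl_inj) !(inj_eq inr_inj) andbC.
have c0S : vcell e (int_ k w) \in punctured g v.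
  by rewrite in_setD1 fP andbT (inj_eq inl_inj) (inj_eq inr_inj) eq_sym.
have [d [rho [rho_inj rhoP]]] :=
  rooted_incidences g_tlh eta_joins treeE eta_inj iota_inj tree_int c0S.
(* Cardinalities agree: 2n - 1 = 2(n+1) - 3. *)
have surj : rho @: (punctured g v :\ vcell e (int_ k w)) = incidences g v.
  apply/eqP; rewrite eqEcard; apply/andP; split.
    by apply/subsetP=> h /imsetP[c cS ->]; case: (rhoP c cS).
  rewrite card_in_imset //.
  have := cardsD1 (vcell e (int_ k w)) (punctured g v); rewrite c0S.
  rewrite (card_punctured g_tlh eta_joins treeE eta_inj iota_inj tree_int).
  have := card_incidences g_tlh treeE eta_inj v; rewrite v3.
  move: #|incidences g v| #|punctured g v :\ _| => a b; clear; lia.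
have incE h : (h \in incidences g v) = (h.1 \notin codom eta) && (endpoint g h != int_ k v).
  by rewrite inE treeE.
have tauP j : j \notin codom eta -> [/\ (rho (ecell k n j)).1 = j,
    rho (ecell k n j) \in incidences g v
  & d (vcell e (endpoint g (rho (ecell k n j)))) < d (ecell k n j)]%N.
  by rewrite -pE => /rhoP[inc [[[E] dE]|[]//]]; split.
have omP x : x != v -> x != w -> [/\ endpoint g (rho (vcell e (int_ k x))) = int_ k x,
    rho (vcell e (int_ k x)) \in incidences g v
  & d (ecell k n (rho (vcell e (int_ k x))).1) < d (vcell e (int_ k x))]%N.
  move=> xv xw; have : vcell e (int_ k x) \in punctured g v :\ vcell e (int_ k w) by rewrite pV xv.
  by move=> /rhoP[inc [[]//|[[E] dE]]]; split.
pose opp (h : halfedge e) : halfedge e := (h.1, ~~ h.2).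
have endP h : h.1 \notin codom eta -> exists x, endpoint g h = int_ k x.
  by move=> hF; apply: (frame_endpoint g_tlh eta_joins treeE); rewrite treeE.
have Tx j : exists x, j \notin codom eta -> endpoint g (rho (ecell k n j)) = int_ k x.
  have [jF|] := boolP (j \notin codom eta); last by exists v.
  have [j1 _ _] := tauP j jF; have [|x xE] := endP (rho (ecell k n j)); first by rewrite j1.
  by exists x.
have [T TP] := fin_all_exists Tx.
have Sx j : exists x, j \notin codom eta -> endpoint g (opp (rho (ecell k n j))) = int_ k x.
  have [jF|] := boolP (j \notin codom eta); last by exists v.
  have [j1 _ _] := tauP j jF; have [|x xE] := endP (opp (rho (ecell k n j))); first by rewrite /= j1.
  by exists x.
have [S SP] := fin_all_exists Sx.
pose out x := (rho (vcell e (int_ k x))).1.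
have halfP j h : j \notin codom eta -> h.1 = j -> h = rho (ecell k n j) \/ h = opp (rho (ecell k n j)).
  move=> jF; have [j1 _ _] := tauP j jF; rewrite /opp; case: h (rho _) j1 => [i b] [i' b'] /= -> ->.
  by case: b; case: b'; auto.
have int_inj : injective (@int_ k n) by move=> a b [].
have outF x : x != v -> x != w -> out x \notin codom eta.
  move=> xv xw; have [_ + _] := omP x xv xw; rewrite /out.
  by rewrite incE => /andP[].
have ne_rho x j : x != v -> x != w -> j \notin codom eta -> rho (vcell e (int_ k x)) != rho (ecell k n j).
  move=> xv xw jF; apply/eqP=> /rho_inj; rewrite pE pV xv xw jF => /(_ isT isT).
  by [].
have outS x : x != v -> x != w -> S (out x) = x.
  move=> xv xw; have [xE inc _] := omP x xv xw.
  have [|E] := halfP _ _ (outF x xv xw) (erefl : (rho (vcell e (int_ k x))).1 = _).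
    by move/eqP; rewrite (negPf (ne_rho _ _ xv xw (outF x xv xw))).
  by apply: int_inj; rewrite -SP ?outF // -E xE.
(* If S j is not v, the source half of j is an incidence, hence rho of some cell. It is not rho of
   an edge, since j already owns its other half, so the cell is the vertex S j. In particular S j is
   not the root w. *)
have oppE j : j \notin codom eta -> S j != v -> S j != w /\ out (S j) = j.
  move=> jF Sv; have [j1 _ _] := tauP j jF.
  have inc : opp (rho (ecell k n j)) \in incidences g v.
    by rewrite incE SP //= j1 jF /=.
  move: inc; rewrite -surj => /imsetP[[[i|x]|i] cS E].
  - have : vcell e (ext n i) \in frame g by move: cS; rewrite !in_setD1 => /and3P[].
    by rewrite (negPf (ext_notin_frame g_tlh i)).
  - move: cS; rewrite pV => /andP[xv xw]; have [xE _ _] := omP x xv xw.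
    have xS : x = S j by apply: int_inj; rewrite -xE -E SP.
    by rewrite -xS; split=> //; rewrite /out -E /= j1.
  move: cS; rewrite pE => iF; have [i1 _ _] := tauP i iF.
  have ij : i = j by rewrite -i1 -E /= j1.
  by move: E; rewrite ij /opp; case: (rho _) => a [] [].
(* x has two frame halves; one is rho x, and the other can only be rho of an edge, which therefore
   ends at x. *)
have inP x : x != v -> x != w -> exists2 j, j \notin codom eta & T j = x.
  move=> xv xw; have [xE inc _] := omP x xv xw.
  have omin : rho (vcell e (int_ k x)) \in frame_halves g x.
    by rewrite in_set treeE outF // andbT in_set xE.
  have /card_gt0P[[j b]] : (0 < #|frame_halves g x :\ rho (vcell e (int_ k x))|)%N.
    by have := cardsD1 (rho (vcell e (int_ k x))) (frame_halves g x); rewrite omin x2 //; case: #|_|.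
  rewrite in_setD1 in_set treeE in_set => /and3P[jbne /eqP jx jF].
  have : (j, b) \in incidences g v by rewrite incE jF jx (inj_eq int_inj).
  rewrite -surj => /imsetP[[[i|y]|i] cS E].
  - have : vcell e (ext n i) \in frame g by move: cS; rewrite !in_setD1 => /and3P[].
    by rewrite (negPf (ext_notin_frame g_tlh i)).
  - move: cS; rewrite pV => /andP[yv yw]; have [yE _ _] := omP y yv yw.
    have yx : y = x by apply: int_inj; rewrite -yE -E.
    by move: jbne; rewrite E yx eqxx.
  move: cS; rewrite pE => iF; exists i => //.
  by apply: int_inj; rewrite -TP // -E.
(* rho takes values away from v, so every half at v is the source half of its edge. *)
have atv h : h \in frame_halves g v -> h.1 \notin codom eta /\ h = opp (rho (ecell k n h.1)).
  rewrite in_set treeE in_set => /andP[/eqP hv hF]; split=> //.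
  have [E|//] := halfP _ h hF erefl; have [_ + _] := tauP _ hF.
  by rewrite -E incE hv eqxx andbF.
pose starts := [seq h.1 | h <- enum (frame_halves g v)].
exists eta, iota, v, w, S, T, out, d, starts; split=> //.
- move=> x xv xw; apply: (frame_halves_hair g_tlh eta_joins treeE iota_inj tree_int).
  exact: x2.
- move=> j jF; have [j1 _ _] := tauP j jF; have := TP j jF; have := SP j jF.
  rewrite /opp /joins /endpoint j1 /=; case: (rho _).2 => /= <- <-;
  by rewrite -surjective_pairing eqxx ?orbT.
- move=> j jF; have [_ + _] := tauP j jF; rewrite incE.
  by rewrite TP // (inj_eq int_inj) => /andP[].
- move=> j jF; have [->//|/(oppE j jF)[]//] := eqVneq (S j) v.
- by move=> x xv xw; split; [apply: outF | apply: outS].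
- by move=> j jF /(oppE j jF)[].
(* Distinct i and j would give three halves at T i: its own exit and the target halves of i and
   j. *)
- move=> i j iF jF Tw TT; apply/eqP; apply: contraTT isT => ij.
  have Tv : T i != v.
    have [_ + _] := tauP i iF; rewrite incE.
    by rewrite TP // (inj_eq int_inj) => /andP[].
  have sub : [set rho (vcell e (int_ k (T i))); rho (ecell k n i); rho (ecell k n j)]
      \subset frame_halves g (T i).
    have [xE inc _] := omP (T i) Tv Tw; have [i1 _ _] := tauP i iF; have [j1 _ _] := tauP j jF.
    rewrite !subUset !sub1set !in_set !treeE xE (TP i iF) (TP j jF) i1 j1 iF jF -TT !eqxx /= !andbT.
    exact: outF.
  have := subset_leq_card sub; rewrite x2 //.
  have [i1 _ _] := tauP i iF; have [j1 _ _] := tauP j jF.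
  have rij : rho (ecell k n i) != rho (ecell k n j).
    by apply: contraNneq ij => E; rewrite -i1 -j1 E.
  have := ne_rho (T i) i Tv Tw iF; have := ne_rho (T i) j Tv Tw jF => n1 n2.
  have u3 : uniq [:: rho (vcell e (int_ k (T i))); rho (ecell k n i); rho (ecell k n j)].
    by rewrite /= !inE negb_or n1 n2 rij.
  move=> le2; have : (3 <= 2)%N; last by [].
  apply: leq_trans le2; have /= <- := card_uniqP u3.
  by apply/subset_leq_card/subsetP=> h; rewrite !inE -orbA.
- by move=> j jF; have [_ _] := tauP j jF; rewrite TP.
- by move=> x xv xw; have [] := omP x xv xw.
- rewrite map_inj_in_uniq ?enum_uniq // => h h'; rewrite !mem_enum.
  by move=> /atv[_ hE] /atv[_ hE'] E; rewrite hE hE' E.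
- by rewrite size_map -cardE.
move=> j; apply/mapP/andP => [[h]|[jF /eqP Sj]].
  rewrite mem_enum => hv ->; have [hF hE] := atv h hv; split=> //.
  apply/eqP/int_inj; rewrite -SP // -hE.
  by move: hv; rewrite in_set in_set => /andP[/eqP].
exists (opp (rho (ecell k n j))); last by have [j1 _ _] := tauP j jF.
have [j1 _ _] := tauP j jF.
by rewrite mem_enum in_set treeE /= j1 jF andbT in_set SP // Sj.
Qed.

End Directed.

(** * The three directed paths form a Theta-structure *)

Section DirectedTheta.
Variables (k n e : nat) (g : digraph k n e) (eta : 'I_k -> 'I_e) (iota : 'I_k -> 'I_n).
Variables (v w : 'I_n) (S T : 'I_e -> 'I_n) (out : 'I_n -> 'I_e) (d : cell k n e -> nat).
Variables (starts : seq 'I_e) (hx : 'I_n -> 'I_k).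
Hypothesis df : @directed_frame k n e g eta iota v w S T out d starts.
Hypothesis hxP : forall x, x \in codom iota -> iota (hx x) = x.

(** Follows outgoing edges until w. p is fuel; it suffices as soon as it bounds the distance of the
    edge j from w. *)
Fixpoint follow (p : nat) (j : 'I_e) : seq (node k n e) :=
  if p is p'.+1 then
    if T j == w then [::]
    else (T j, (hx (T j), eta (hx (T j))), out (T j)) :: follow p' (out (T j))
  else [::].

Definition frame_path p j : seq 'I_e := j :: map snd (follow p j).
Definition follow_nodes p j := strand_nodes (j, follow p j).

Lemma iota_hx x : x != v -> x != w -> iota (hx x) = x.
Proof. by move=> xv xw; apply/hxP/(df_iota df). Qed.

(** The distance d drops at each edge and at each vertex of the path, so the fuel is not exhausted
    before w. *)
Lemma follow_nodesE p j : j \notin codom eta -> (d (ecell k n j) <= p)%N ->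
  [/\ all (joins g) (strand_links (S j) j (follow p j) w),
      all (fun i => i \notin codom eta) (frame_path p j),
      map T (frame_path p j) = rcons (follow_nodes p j) w,
      frame_path p j = j :: map out (follow_nodes p j)
    & all (fun x => (x != v) && (x != w)) (follow_nodes p j)].
Proof.
elim: p j => [|p IH] j jF dj.
  by have := df_dist_edge df jF; rewrite ltnNge => /negP[]; apply: leq_trans dj _.
rewrite /frame_path /follow_nodes /strand_nodes /=.
have [Tw|Tw] := eqVneq (T j) w.
  by rewrite /= jF -Tw (df_joins df).
have Tv := df_target df jF; have [oF oS] := df_out df Tv Tw.
have dout : (d (ecell k n (out (T j))) <= p)%N.
  have := df_dist_edge df jF; have := df_dist_node df Tv Tw => H1 H2.
  by rewrite -ltnS; apply: leq_trans dj; apply: leq_ltn_trans H2; apply: ltnW.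
have [H1 H2 H3 H4 H5] := IH _ oF dout.
move: H2 H3 H4; rewrite /frame_path /follow_nodes /strand_nodes /= => H2 H3 [H4].
split; rewrite /= ?jF ?Tv ?Tw //.
- rewrite (df_joins df) //= -{2}(iota_hx Tv Tw) (df_eta df) /=.
  by rewrite oS in H1.
- by rewrite H3.
by rewrite H4.
Qed.

Let p : nat := \max_(c : cell k n e) d c.

Lemma dist_le c : (d c <= p)%N.
Proof. exact: leq_bigmax. Qed.

(** Only the edge i enters T i, so the path visits T i as often as it traverses i. *)
Lemma count_follow_nodes j i : j \in starts -> i \notin codom eta -> T i != w ->
  count_mem (T i) (follow_nodes p j) = count_mem i (frame_path p j).
Proof.
rewrite (df_starts df) => /andP[jF _] iF Tw.
have [_ H2 H3 _ _] := follow_nodesE jF (dist_le _).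
have -> : count_mem (T i) (follow_nodes p j) = count_mem (T i) (rcons (follow_nodes p j) w).
  by rewrite -cats1 count_cat /= [w == _]eq_sym (negPf Tw) !addn0.
rewrite -H3 count_map; apply: eq_in_count => i' /(allP H2) iF' /=.
by apply/eqP/eqP=> [E|->//]; apply/esym/(df_in_unique df).
Qed.

(** An edge is traversed either as the first one or on leaving its source; v is never revisited. *)
Lemma count_frame_path j i : j \in starts -> i \notin codom eta ->
  count_mem i (frame_path p j) =
    ((i == j) + (if S i == v then 0 else count_mem (S i) (follow_nodes p j)))%N.
Proof.
rewrite (df_starts df) => /andP[jF Sj] iF.
have [_ _ _ H4 H5] := follow_nodesE jF (dist_le _).
rewrite H4 /= eq_sym; congr (_ + _)%N; rewrite count_map.
have [Sv|Sv] := eqVneq (S i) v.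
  apply/eqP; rewrite -leqn0 leqNgt -has_count; apply/hasPn=> x /(allP H5)/andP[xv xw] /=.
  have [_ oS] := df_out df xv xw.
  by apply: contraNneq xv => E; rewrite -oS E Sv.
apply: eq_in_count => x /(allP H5)/andP[xv xw] /=.
apply/eqP/eqP=> [<-|->]; first by have [_ ->] := df_out df xv xw.
exact: (df_outK df).
Qed.

Lemma count_starts i : i \notin codom eta ->
  (\sum_(j <- starts) (i == j) = (S i == v))%N.
Proof.
move=> iF; have := count_uniq_mem i (df_starts_uniq df); rewrite (df_starts df) iF /= => <-.
by rewrite -sum1_count [RHS]big_mkcond /=; apply: eq_bigr => j _; rewrite eq_sym; case: eqP.
Qed.

(** Let i be the edge entering x. The three paths visit x as often as they traverse i: once if i
    starts at v, and otherwise as often as they visit S i. Since S i is farther from w than x, the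
    induction is on p - d x. *)
Lemma count_nodes x : x != v -> x != w ->
  (\sum_(j <- starts) count_mem x (follow_nodes p j) = 1)%N.
Proof.
have [q] := ubnP (p - d (vcell e (int_ k x))); elim: q x => // q IH x dq xv xw.
have [i iF Ti] := df_in df xv xw.
have Tw : T i != w by rewrite Ti.
have -> : (\sum_(j <- starts) count_mem x (follow_nodes p j) =
    \sum_(j <- starts) ((i == j) + (if S i == v then 0 else count_mem (S i) (follow_nodes p j))))%N.
  rewrite big_seq [RHS]big_seq; apply: eq_bigr => j js.
  by rewrite -count_frame_path // -count_follow_nodes // Ti.
rewrite big_split /= count_starts //; have [Sv|Sv] := eqVneq (S i) v.
  by rewrite big1.
rewrite IH ?(df_source df) //.
have := df_dist_edge df iF; rewrite Ti; have := df_dist_node df Sv (df_source df iF).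
rewrite (df_outK df) //; have := dist_le (vcell e (int_ k (S i))).
move: dq; move: (d _) (d _) (d _) => a b c; rewrite /p; clear; lia.
Qed.

Lemma count_edges i : i \notin codom eta ->
  (\sum_(j <- starts) count_mem i (frame_path p j) = 1)%N.
Proof.
move=> iF; transitivity (\sum_(j <- starts) ((i == j) +
    (if S i == v then 0 else count_mem (S i) (follow_nodes p j))))%N.
  by rewrite big_seq [RHS]big_seq; apply: eq_bigr => j js; rewrite -count_frame_path.
rewrite big_split /= count_starts //; have [Sv|Sv] := eqVneq (S i) v.
  by rewrite big1.
by rewrite count_nodes // (df_source df).
Qed.

Definition hair_of (x : 'I_n) : seq (hair k e) :=
  if [pick i | iota i == x] is Some i then [:: (i, eta i)] else [::].

Lemma count_enum (U : finType) (s : seq U) : (forall x, count_mem x s = 1%N) ->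
  perm_eq s (enum U).
Proof.
by move=> s1; apply/allP=> x _ /=; rewrite s1 count_uniq_mem ?enum_uniq // mem_enum.
Qed.

Lemma follow_exts j : strand_exts (j, follow p j) = map hx (follow_nodes p j).
Proof.
rewrite /strand_exts /follow_nodes /strand_nodes /= -map_comp.
by elim: (p) j => //= q IH j; case: ifP => //= _; rewrite IH.
Qed.

Lemma follow_word j i : count_mem i (strand_word (j, follow p j)) =
  (count_mem i (frame_path p j) + count_mem i (map eta (strand_exts (j, follow p j))))%N.
Proof.
rewrite /frame_path /strand_exts /strand_word /tail_word /=.
rewrite -addnA; congr (_ + _)%N.
elim: (p) (j) => //= q IH j'; case: ifP => //= _; rewrite IH; lia.
Qed.

Lemma directed_theta : exists t, [/\ theta_on t g, (size (source_hair t) <= 1)%N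
  & (size (sink_hair t) <= 1)%N].
Proof.
have [j1 [j2 [j3 sE]]] : exists j1 j2 j3, starts = [:: j1; j2; j3].
  by have := df_starts_size df; case: starts => [|a [|b [|c [|]]]] // _; exists a, b, c.
have in1 : j1 \in starts by rewrite sE !inE eqxx.
have in2 : j2 \in starts by rewrite sE !inE eqxx orbT.
have in3 : j3 \in starts by rewrite sE !inE eqxx !orbT.
pose t := Theta v w (hair_of v) (hair_of w) (j1, follow p j1) (j2, follow p j2) (j3, follow p j3).
have sh x : (size (hair_of x) <= 1)%N by rewrite /hair_of; case: pickP.
exists t; split; [|exact: sh|exact: sh].
have nodesE x : count_mem x (nodes t) = 1%N.
  have avoid j : j \in starts -> all (fun x => (x != v) && (x != w)) (follow_nodes p j).
    by rewrite (df_starts df) => /andP[jF _]; have [] := follow_nodesE jF (dist_le _).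
  have nov j y : j \in starts -> (y == v) || (y == w) -> count_mem y (follow_nodes p j) = 0%N.
    move=> /avoid/allP av yv; apply/count_memPn/negP=> /av.
    by case/orP: yv => /eqP->; rewrite eqxx ?andbF.
  rewrite /nodes /= !count_cat -!/(follow_nodes p _).
  have [<-|xv] := eqVneq v x.
    by rewrite !(nov _ v) ?eqxx // eq_sym (negPf (df_neq df)).
  have [<-|xw] := eqVneq w x; first by rewrite !(nov _ w) ?eqxx ?orbT.
  have := @count_nodes x; rewrite eq_sym xv eq_sym xw => /(_ isT isT).
  by rewrite sE !big_cons big_nil addn0 !add0n.
have extsE i : count_mem i (exts t) = 1%N.
  have hE x : count_mem i (unzip1 (hair_of x)) = (x == iota i).
    rewrite /hair_of; case: pickP => [i' /eqP <-|no] /=; last by rewrite eq_sym no.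
    by rewrite addn0 (inj_eq (df_iota_inj df)).
  have fE j : j \in starts -> count_mem i (strand_exts (j, follow p j)) =
      count_mem (iota i) (follow_nodes p j).
    rewrite (df_starts df) => /andP[jF _]; have [_ _ _ _ H5] := follow_nodesE jF (dist_le _).
    rewrite follow_exts count_map; apply: eq_in_count => x /(allP H5)/andP[xv xw] /=.
    apply/eqP/eqP=> [<-|->]; first by rewrite iota_hx.
    by apply: (df_iota_inj df); rewrite hxP ?codom_f.
  rewrite /exts /= !count_cat !hE !fE //; have := nodesE (iota i).
  by rewrite /nodes /= !count_cat.
have wordE i : count_mem i (word t) = 1%N.
  have -> : count_mem i (word t) = (\sum_(j <- starts) count_mem i (frame_path p j)
      + count_mem i (map eta (exts t)))%N.
    have hE x : unzip2 (hair_of x) = map eta (unzip1 (hair_of x)).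
      by rewrite /hair_of; case: pickP.
    rewrite /word /exts !map_cat !count_cat -!hE.
    cbn [t strand1 strand2 strand3 source_hair sink_hair].
    rewrite !follow_word sE !big_cons big_nil.
    have ar (a1 a2 b1 b2 b3 c1 c2 c3 : nat) : (a1 + (a2 + (b1 + c1 + (b2 + c2 + (b3 + c3))))
      = b1 + (b2 + (b3 + 0)) + (a1 + (a2 + (c1 + (c2 + c3)))))%N by clear; lia.
    exact: ar.
  have [iF|] := boolP (i \notin codom eta).
    rewrite count_edges //; have /count_memPn -> // : i \notin map eta (exts t).
    by apply: contra iF => /mapP[y _ ->]; apply: codom_f.
  rewrite negbK => /codomP[y ->].
  rewrite big1_seq ?add0n => [|j /andP[_ js]]; last first.
    move: js; rewrite (df_starts df) => /andP[jF _].
    have [_ H2 _ _ _] := follow_nodesE jF (dist_le _).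
    by apply/count_memPn/negP=> /(allP H2); rewrite codom_f.
  rewrite count_map -[RHS](extsE y); apply: eq_count => y' /=.
  by rewrite (inj_eq (df_eta_inj df)).
rewrite /theta_on !count_enum //= /links !all_cat.
have hj x : all (joins g) (hair_links x (hair_of x)).
  rewrite /hair_of; case: pickP => //= i /eqP <-.
  by rewrite andbT (df_eta df).
rewrite !hj /=.
have strandP j : j \in starts -> all (joins g) (strand_links v j (follow p j) w).
  rewrite (df_starts df) => /andP[jF /eqP Sj].
  by have [] := follow_nodesE jF (dist_le _); rewrite Sj.
by rewrite !strandP.
Qed.

End DirectedTheta.

Lemma two_loop_theta k n e (g : digraph k n e) : two_loop_hairy g ->
  exists t, [/\ theta_on t g, (size (source_hair t) <= 1)%N & (size (sink_hair t) <= 1)%N].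
Proof.
move=> g_tlh; have [eta [iota [v [w [S [T [out [d [starts df]]]]]]]]] := two_loop_directed g_tlh.
have k0 : (0 < k)%N by case/and4P: g_tlh => /and4P[].
(* The default at vertices without a hair is arbitrary; [directed_theta] consults hx only at
   hair-carrying ones. *)
have hP x : exists i, x \in codom iota -> iota i = x.
  have [/codomP[i ->]|_] := boolP (x \in codom iota); first by exists i.
  by exists (Ordinal k0).
have [hx hxP] := fin_all_exists hP.
exact: directed_theta df hxP.
Qed.

Lemma theta_defect k n e (g : digraph k n e) t : theta_on t g ->
  defect g = (size (source_hair t) + size (sink_hair t))%N.
Proof.
move=> tg; have [vw vi wi _] := nodes_uniq tg.
rewrite /defect (bigD1 (source t)) //= (bigD1 (sink t)) /= 1?eq_sym //.
rewrite (valence_source tg) (valence_sink tg) !addnK big1 ?addn0 // => x /andP[xv xw].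
by rewrite (valence_inner tg) //; have := nodes_mem x tg; rewrite (negPf xv) (negPf xw).
Qed.

(** * Theta-graphs are two-loop hairy graphs *)

Section ThetaHairy.
Variables (k n e : nat) (g : digraph k n e).
Implicit Types (t : theta k n e) (S : {set cell k n e}) (c : cell k n e).

Fixpoint strand_cells (j : 'I_e) (l : seq (node k n e)) (w : 'I_n) : seq (cell k n e) :=
  ecell k n j :: (if l is (y, h, j') :: l' then vcell e (int_ k y) :: strand_cells j' l' w
                  else [:: vcell e (int_ k w)]).

Definition touches : rel (cell k n e) := fun c d =>
  match c, d with inl x, inr j | inr j, inl x => incident g x j | _, _ => false end.

Lemma adjE S c d : adj g S c d = [&& c \in S, d \in S & touches c d].
Proof. by []. Qed.

Lemma strand_cells_path x j l w : all (joins g) (strand_links x j l w) ->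
  path touches (vcell e (int_ k x)) (strand_cells j l w).
Proof.
elim: l x j => [|[[y [i h]] j'] l IH] x j /=.
  by rewrite !andbT => H; rewrite (joins_incident H); rewrite joins_sym in H; rewrite (joins_incident H).
case/and3P=> H _ /IH ->; rewrite (joins_incident H) andbT.
by rewrite joins_sym in H; rewrite (joins_incident H).
Qed.

Lemma last_strand_cells c j l w : last c (strand_cells j l w) = vcell e (int_ k w).
Proof. by elim: l c j => [|[[y h] j'] l IH] c j //=. Qed.

Lemma sink_in_cells j l w : vcell e (int_ k w) \in strand_cells j l w.
Proof.
by elim: l j => [|[[y h] j'] l IH] j /=; rewrite !inE ?eqxx ?orbT // IH !orbT.
Qed.

Lemma path_connect_in S c p : path touches c p -> {subset c :: p <= S} ->
  {in c :: p, forall d, connect (adj g S) c d}.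
Proof.
elim: p c => [|b p IH] c /= => [_ _ d|/andP[cb pb] sub d]; first by rewrite inE => /eqP ->.
rewrite inE => /orP[/eqP->|dp]; first exact: connect0.
have sub' : {subset b :: p <= S} by move=> a ap; apply: sub; rewrite inE ap orbT.
apply: connect_trans (IH b pb sub' d dp); apply: connect1.
by rewrite adjE cb !sub ?inE ?eqxx ?orbT.
Qed.

Definition frame_edges (s : strand k n e) : seq 'I_e := s.1 :: map snd s.2.

Definition cells_of t (s : strand k n e) := strand_cells s.1 s.2 (sink t).

Lemma count_cells_edge s j w : count_mem (ecell k n j) (strand_cells s.1 s.2 w) =
  count_mem j (frame_edges s).
Proof.
case: s => i l; rewrite /frame_edges /=.
elim: l i => [|[[y h] j'] l IH] i /=; first by rewrite (inj_eq inr_inj).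
by rewrite (inj_eq inr_inj) IH.
Qed.

Lemma count_cells_int s x w : count_mem (vcell e (int_ k x)) (strand_cells s.1 s.2 w) =
  (count_mem x (strand_nodes s) + (w == x))%N.
Proof.
case: s => i l; rewrite /strand_nodes /=.
elim: l i => [|[[y h] j'] l IH] i /=; first by rewrite !(inj_eq inl_inj) (inj_eq inr_inj) addn0.
rewrite IH !(inj_eq inl_inj) (inj_eq inr_inj) add0n.
by rewrite addnA.
Qed.

Lemma count_frame_edges s j : (count_mem j (frame_edges s) <= count_mem j (strand_word s))%N.
Proof.
case: s => i l; rewrite /frame_edges /strand_word /= leq_add2l.
elim: l => //= p l IH; rewrite /tail_word /=.
by rewrite (leq_trans (leq_add (leqnn _) IH)) // leq_addl.
Qed.

(** The source is not listed, while the sink is listed once per strand; this is why both are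
    excluded or treated apart below. *)
Definition frame_cells t : seq (cell k n e) :=
  cells_of t (strand1 t) ++ cells_of t (strand2 t) ++ cells_of t (strand3 t).

Lemma frame_cells_once t c : theta_on t g -> c \in frame_cells t ->
  c != vcell e (int_ k (sink t)) -> count_mem c (frame_cells t) = 1%N.
Proof.
move=> tg cf cw; apply/eqP; rewrite eqn_leq -has_count has_pred1 cf andbT.
rewrite /frame_cells /cells_of !count_cat; case: c cf cw => [[i|x]|j] cf cw.
- have no j l w : count_mem (inl (inl i)) (strand_cells j l w) = 0%N.
    by elim: l j => [|[[y h] j'] l IH] j //=; rewrite IH.
  by rewrite !no.
- rewrite !count_cells_int; have -> : (sink t == x) = false.
    by move: cw; rewrite eq_sym (inj_eq inl_inj) (inj_eq inr_inj) => /negPf.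
  have [_ _ _ ui] := nodes_uniq tg; rewrite !addn0 -!count_cat.
  by rewrite count_uniq_mem ?ui // leq_b1.
rewrite !count_cells_edge.
apply: leq_trans (_ : count_mem j (word t) <= _)%N; last first.
  by rewrite count_uniq_mem ?(theta_on_uniq tg) // leq_b1.
rewrite /word !count_cat; apply: leq_trans (leq_addl _ _); apply: leq_trans (leq_addl _ _).
by apply: leq_add; [|apply: leq_add]; apply: count_frame_edges.
Qed.

(* Deleting a cell of the first strand leaves its two pieces attached to the
   source and, through the second strand, to the sink. *)
Lemma frame_delete_connect1 t S c : theta_on t g -> c \in cells_of t (strand1 t) ->
  c != vcell e (int_ k (sink t)) ->
  {in vcell e (int_ k (source t)) :: frame_cells t, forall d, d != c -> d \in S} ->
  c != vcell e (int_ k (source t)) ->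
  {in frame_cells t, forall d, d != c -> connect (adj g S) (vcell e (int_ k (source t))) d}.
Proof.
move=> tg c1 cw sub cv; set v := vcell e (int_ k (source t)) in sub cv *.
have [p1 p2 p3] := strand_joins tg.
have cf : c \in frame_cells t by rewrite /frame_cells mem_cat c1.
have := frame_cells_once tg cf cw; rewrite /frame_cells !count_cat.
have : (0 < count_mem c (cells_of t (strand1 t)))%N by rewrite -has_count has_pred1.
move=> pos tot.
have [n1 n2 n3] : [/\ count_mem c (cells_of t (strand1 t)) = 1%N,
    count_mem c (cells_of t (strand2 t)) = 0%N & count_mem c (cells_of t (strand3 t)) = 0%N].
  by move: pos tot; case: (count_mem c (cells_of t (strand1 t))) => // q _ /eqP;
    rewrite addSn eqSS !addn_eq0 => /and3P[/eqP-> /eqP-> /eqP->].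
have vS : v \in S by apply: sub; rewrite ?mem_head // eq_sym.
have whole s : count_mem c (cells_of t s) = 0%N -> {subset cells_of t s <= frame_cells t} ->
    all (joins g) (strand_links (source t) s.1 s.2 (sink t)) ->
    {in cells_of t s, forall d, connect (adj g S) v d}.
  move=> nc subs js d ds; apply: (path_connect_in (strand_cells_path js)); last by rewrite inE ds orbT.
  move=> a; rewrite inE => /orP[/eqP->//|as_]; apply: sub; first by rewrite inE subs ?orbT.
  by apply: contraTneq as_ => ->; apply/count_memPn.
have h2 := whole (strand2 t) n2 _ p2; have h3 := whole (strand3 t) n3 _ p3.
have s2 : {subset cells_of t (strand2 t) <= frame_cells t}.
  by move=> d dd; rewrite !mem_cat dd orbT.
have s3 : {subset cells_of t (strand3 t) <= frame_cells t}.
  by move=> d dd; rewrite !mem_cat dd !orbT.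
move=> d; rewrite !mem_cat => /or3P[d1|/(h2 s2)//|/(h3 s3)//] dc.
have vw : connect (adj g S) v (vcell e (int_ k (sink t))).
  by apply: h2; rewrite ?sink_in_cells.
move: n1 d1 (strand_cells_path p1) (last_strand_cells c (strand1 t).1 (strand1 t).2 (sink t)).
have s1 : {subset cells_of t (strand1 t) <= frame_cells t}.
  by move=> a aa; rewrite mem_cat aa.
move: c1 s1; rewrite /cells_of; move: (strand_cells _ _ _) => C c1; case/splitPr: c1 => q1 q2 s1.
rewrite count_cat /= eqxx addnCA => -[] /eqP; rewrite add0n addn_eq0.
case/andP=> /eqP/count_memPn cq1 /eqP/count_memPn cq2.
rewrite mem_cat inE (negPf dc) /= => dq; rewrite cat_path /= last_cat /=.
case/and3P=> pq1 _ pq2 lq2.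
have sq1 : {subset v :: q1 <= S}.
  move=> a; rewrite inE => /orP[/eqP->//|aq]; apply: sub.
    by rewrite inE s1 ?orbT // mem_cat aq.
  by apply: contraNneq cq1 => <-.
have sq2 : {subset q2 <= S}.
  move=> a aq; apply: sub; first by rewrite inE s1 ?orbT // mem_cat inE aq !orbT.
  by apply: contraNneq cq2 => <-.
case/orP: dq => [dq1|dq2].
  by apply: (path_connect_in pq1 sq1); rewrite inE dq1 orbT.
apply: connect_trans vw _; rewrite adj_connect_sym.
case: q2 pq2 lq2 sq2 dq2 {cq2 s1} => // b q2 /= /andP[_ pb] lb sq2 dq2.
rewrite -lb; apply: connect_trans (_ : connect _ b _); last first.
  by apply: (path_connect_in pb sq2); rewrite mem_last.
by rewrite adj_connect_sym; apply: (path_connect_in pb sq2).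
Qed.

End ThetaHairy.

Section ThetaTwoLoop.
Variables (k n e : nat) (g : digraph k n e).
Implicit Types (t : theta k n e) (S : {set cell k n e}) (c : cell k n e).

Definition hair_list t : seq ('I_n * (hair k e)) :=
  [seq (source t, h) | h <- source_hair t] ++ [seq (sink t, h) | h <- sink_hair t]
  ++ map fst (strand1 t).2 ++ map fst (strand2 t).2 ++ map fst (strand3 t).2.

Definition all_frame_edges t : seq 'I_e :=
  frame_edges (strand1 t) ++ frame_edges (strand2 t) ++ frame_edges (strand3 t).

Lemma exts_hair_list t : exts t = [seq p.2.1 | p <- hair_list t].
Proof.
by rewrite /hair_list !map_cat -!map_comp /exts /strand_exts /unzip1.
Qed.

Lemma word_perm t :
  perm_eq (word t) (all_frame_edges t ++ [seq p.2.2 | p <- hair_list t]).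
Proof.
have sE (s : strand k n e) : perm_eq (strand_word s) (frame_edges s ++ [seq p.2.2 | p <- map fst s.2]).
  case: s => j l; rewrite /strand_word /frame_edges /= perm_cons.
  elim: l => //= p l IH; apply/seq.permP=> a /=; have /seq.permP/(_ a) := IH.
  rewrite /tail_word /= !count_cat /= => ->.
  have ar (x y z u : nat) : (x + (y + (z + u)) = y + (z + (x + u)))%N by lia.
  exact: ar.
apply/seq.permP=> a; rewrite /word /all_frame_edges /hair_list !map_cat !count_cat.
have sc (s : strand k n e) : count a (strand_word s) =
   (count a (frame_edges s) + count a [seq p.2.2 | p <- map fst s.2])%N.
  by rewrite -count_cat; apply/seq.permP.
rewrite !sc -!map_comp /unzip2 /=.
have ar (a1 a2 b1 b2 b3 c1 c2 c3 : nat) : (a1 + (a2 + (b1 + c1 + (b2 + c2 + (b3 + c3)))) =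
  b1 + (b2 + b3) + (a1 + (a2 + (c1 + (c2 + c3)))))%N by lia.
exact: ar.
Qed.

Lemma hair_list_joins t p : theta_on t g -> p \in hair_list t ->
  joins g (p.2.2, (int_ k p.1, ext n p.2.1)).
Proof.
move=> tg; have [/allP t1 /allP t2 /allP t3] := strand_joins tg.
have H x w (s : strand k n e) q : q \in map fst s.2 ->
    (q.2.2, (int_ k q.1, ext n q.2.1)) \in strand_links x s.1 s.2 w.
  case: s => j l /=; elim: l x j => //= -[[y [i h]] j'] l IH x j; rewrite !inE.
  by case/orP=> [/eqP->|/IH ->]; rewrite ?eqxx ?orbT.
rewrite !mem_cat => /or3P[/mapP[h ht ->]|/mapP[h ht ->]|/or3P[]/H ps].
- exact: source_hair_joins.
- exact: (source_hair_joins (theta_on_rev tg) ht).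
- exact: t1.
- exact: t2.
exact: t3.
Qed.

Lemma hair_list_nodes t : theta_on t g -> (size (source_hair t) <= 1)%N ->
  (size (sink_hair t) <= 1)%N -> uniq (map fst (hair_list t)).
Proof.
move=> /and4P[tn _ _ _] h1 h2.
have un : uniq (nodes t) by rewrite (perm_uniq tn) enum_uniq.
apply: subseq_uniq un; rewrite /hair_list !map_cat -!map_comp /nodes.
rewrite -cat1s -[sink t :: _]cat1s; apply: cat_subseq; [|apply: cat_subseq => //].
  by case: (source_hair t) h1 => [|? [|]] //= _; rewrite ?eqxx // sub0seq.
by case: (sink_hair t) h2 => [|? [|]] //= _; rewrite ?eqxx // sub0seq.
Qed.

Lemma frame_edge_cell t j : (j \in all_frame_edges t) = (ecell k n j \in frame_cells t).
Proof.
by rewrite /all_frame_edges /frame_cells /cells_of !mem_cat -!has_pred1 !has_count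
  !count_cells_edge.
Qed.

Lemma int_cell t x : theta_on t g ->
  (vcell e (int_ k x) \in frame_cells t) = (x != source t).
Proof.
move=> tg; have [vw vi wi _] := nodes_uniq tg.
rewrite /frame_cells /cells_of !mem_cat -!has_pred1 !has_count !count_cells_int.
have := nodes_mem x tg; have [->|xv] := eqVneq x (source t).
  rewrite [sink t == _]eq_sym (negPf vw) !addn0 => _; move: vi; rewrite !mem_cat !negb_or.
  by case/and3P=> /count_memPn-> /count_memPn-> /count_memPn->.
rewrite [x == sink t]eq_sym; have [_|_] := eqVneq (sink t) x; first by rewrite addn1.
by rewrite /= !mem_cat -!has_pred1 !has_count !addn0.
Qed.

(** Exchanging strands keeps the set of cells and brings the strand of c to the first place. *)
Lemma frame_delete_connect t S c : theta_on t g -> c \in frame_cells t ->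
  c != vcell e (int_ k (sink t)) ->
  {in vcell e (int_ k (source t)) :: frame_cells t, forall d, d != c -> d \in S} ->
  {in frame_cells t, forall d, d != c -> connect (adj g S) (vcell e (int_ k (source t))) d}.
Proof.
move=> tg cf cw sub; have cv : c != vcell e (int_ k (source t)).
  by apply: contraTneq cf => ->; rewrite int_cell // eqxx.
have E12 : frame_cells (swap12 t) =i frame_cells t.
  move=> d; rewrite -[frame_cells (swap12 t)]/(cells_of t (strand2 t) ++
    cells_of t (strand1 t) ++ cells_of t (strand3 t)) !mem_cat.
  by rewrite !orbA [_ || (d \in cells_of t (strand1 t))]orbC.
have E3 : frame_cells (swap12 (swap23 t)) =i frame_cells t.
  move=> d; rewrite -[frame_cells (swap12 _)]/(cells_of t (strand3 t) ++
    cells_of t (strand1 t) ++ cells_of t (strand2 t)) !mem_cat.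
  by rewrite orbC orbA.
move: (cf); rewrite !mem_cat => /or3P[c1|c2|c3] d df dc.
- exact: (frame_delete_connect1 tg c1 cw sub cv df dc).
- apply: (frame_delete_connect1 (theta_on_swap12 tg) c2 cw _ cv _ dc); last by rewrite E12.
  by move=> a; rewrite inE E12 -in_cons; apply: sub.
have tg3 := theta_on_swap12 (theta_on_swap23 tg).
apply: (frame_delete_connect1 tg3 c3 cw _ cv _ dc); last by rewrite E3.
by move=> a; rewrite inE E3 -in_cons; apply: sub.
Qed.

Lemma hair_or_frame t j : theta_on t g ->
  (j \in all_frame_edges t) || (j \in [seq p.2.2 | p <- hair_list t]).
Proof.
case/and4P=> _ _ tw _; rewrite -mem_cat -(perm_mem (word_perm t)) (perm_mem tw).
by rewrite mem_enum.
Qed.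

Lemma hair_not_frame t j : theta_on t g -> j \in [seq p.2.2 | p <- hair_list t] ->
  j \notin all_frame_edges t.
Proof.
move=> tg jh; have := theta_on_uniq tg; rewrite (perm_uniq (word_perm t)) cat_uniq.
by case/and3P=> _ /hasPn/(_ j jh).
Qed.

Lemma connect_hairs t S : theta_on t g ->
  (forall x, vcell e (int_ k x) \in S /\ connect (adj g S) (vcell e (int_ k (source t))) (vcell e (int_ k x))) ->
  (forall i, vcell e (ext n i) \in S) ->
  {in [seq p.2.2 | p <- hair_list t], forall j, ecell k n j \in S} ->
  {in frame_cells t, forall c, c \in S -> connect (adj g S) (vcell e (int_ k (source t))) c} ->
  connected_in g S.
Proof.
move=> tg intP extP hairP frameP.
have hairC p : p \in hair_list t ->
    connect (adj g S) (vcell e (int_ k (source t))) (ecell k n p.2.2).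
  move=> pt; have [xS vx] := intP p.1; apply: connect_trans vx (connect1 _).
  rewrite adjE; apply/and3P; split; [exact: xS | exact/hairP/map_f |].
  exact: joins_incident (hair_list_joins tg pt).
apply: (connected_inP (proj1 (intP (source t)))) => c cS.
case: c cS => [[i|x]|j] cS.
- have : i \in exts t by case/and4P: tg => _ tx _ _; rewrite (perm_mem tx) mem_enum.
  rewrite exts_hair_list => /mapP[p pt iE]; apply: connect_trans (hairC p pt) (connect1 _).
  have := hair_list_joins tg pt; rewrite joins_sym => /joins_incident pj.
  rewrite adjE; apply/and3P; split; [exact/hairP/map_f | exact: extP |].
  by rewrite iE.
- exact: (proj2 (intP x)).
case/orP: (hair_or_frame j tg) => [jf|/mapP[p pt ->]]; last exact: hairC.
by apply: frameP; rewrite -?frame_edge_cell.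
Qed.

Section ThetaIsHairy.
Variable t : theta k n e.
Hypotheses (tg : theta_on t g) (h1 : (size (source_hair t) <= 1)%N)
  (h2 : (size (sink_hair t) <= 1)%N) (k_gt0 : (0 < k)%N).

Let v := vcell e (int_ k (source t)).

Lemma theta_sizes : e = (k + n).+1.
Proof.
case/and4P: tg => /perm_size + /perm_size + /perm_size + _.
rewrite size_nodes size_exts size_word !size_enum_ord; clear; lia.
Qed.

Lemma theta_delete_edge j : j \in all_frame_edges t -> connected_in g [set~ ecell k n j].
Proof.
move=> jf; have cf : ecell k n j \in frame_cells t by rewrite -frame_edge_cell.
have conn := frame_delete_connect (S := [set~ ecell k n j]) tg cf isT.
have sub : {in v :: frame_cells t, forall d, d != ecell k n j -> d \in [set~ ecell k n j]}.
  by move=> d _; rewrite !inE.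
apply: (connect_hairs tg).
- move=> x; rewrite !inE; split=> //.
  have [->|xv] := eqVneq x (source t); first exact: connect0.
  by apply: conn; rewrite ?int_cell.
- by move=> i; rewrite !inE.
- move=> i /(hair_not_frame tg) ih; rewrite !inE.
  by apply: contraNneq ih => -[->].
by move=> c cf' cS; apply: conn => //; move: cS; rewrite !inE.
Qed.

(** The graph stays connected without the first edge of a strand, and this edge is incident to the
    source. *)
Lemma theta_connected : connected_in g setT.
Proof.
have jf : (strand1 t).1 \in all_frame_edges t by rewrite inE eqxx.
have cS := theta_delete_edge jf; pose j := (strand1 t).1.
have [y jy] : exists y, joins g (j, (int_ k (source t), int_ k y)).
  by apply: (source_edgesP tg); rewrite inE eqxx.
have sub c d : connect (adj g [set~ ecell k n j]) c d -> connect (adj g setT) c d.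
  by apply: connect_sub => a b; rewrite adjE => /and3P[_ _ ab]; apply: connect1; rewrite adjE !inE.
apply: (connected_inP (r := v)); rewrite ?inE // => c _.
have [->|cj] := eqVneq c (ecell k n j); last first.
  by apply/sub/(connected_in_connect cS); rewrite !inE.
by apply: connect1; rewrite adjE !inE; apply: joins_incident jy.
Qed.

(** Deleting a frame edge does not disconnect the graph; every other edge ends at a univalent
    vertex, where [leaf_tree_type] applies. *)
Lemma theta_tree_type j : tree_type g j = (j \in [seq p.2.2 | p <- hair_list t]).
Proof.
case/orP: (hair_or_frame j tg) => [jf|jh].
  have -> : tree_type g j = false by rewrite /tree_type (theta_delete_edge jf).
  by apply/esym/negbTE/negP=> /(hair_not_frame tg); rewrite jf.
rewrite jh; case/mapP: jh => p pt ->; have := hair_list_joins tg pt.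
rewrite joins_sym; apply: leaf_tree_type theta_connected _ theta_sizes.
exact: valence_ext tg.
Qed.

Lemma theta_frame_edge j : (ecell k n j \in frame g) = (j \in all_frame_edges t).
Proof.
rewrite inE /= theta_tree_type; apply/negP/idP=> [jh|jf /(hair_not_frame tg)].
  by case/orP: (hair_or_frame j tg).
by rewrite jf.
Qed.

Lemma theta_frame_int x : vcell e (int_ k x) \in frame g.
Proof.
have H (s : strand k n e) x0 w : x \in strand_nodes s ->
    exists2 j, j \in frame_edges s & exists y, (j, (int_ k x, int_ k y)) \in strand_links x0 s.1 s.2 w.
  case: s => j l; rewrite /frame_edges; elim: l x0 j => //= -[[z [i h]] j'] l IH x0 j.
  rewrite inE => /orP[/eqP->|xl].
    have [y jy] := strand_first z j' l w; exists j'; first by rewrite !inE eqxx orbT.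
    by exists y; rewrite !inE jy !orbT.
  have [j1 j1f [y jy]] := IH z j' xl; exists j1; first by rewrite inE j1f orbT.
  by exists y; rewrite !inE jy !orbT.
have Hw (s : strand k n e) x0 : exists2 j, j \in frame_edges s &
    exists y, (j, (int_ k y, int_ k (sink t))) \in strand_links x0 s.1 s.2 (sink t).
  case: s => j l; rewrite /frame_edges; elim: l x0 j => [|[[z [i h]] j'] l IH] x0 j /=.
    by exists j; rewrite ?inE //; exists x0; rewrite inE.
  have [j1 j1f [y jy]] := IH z j'; exists j1; first by rewrite inE j1f orbT.
  by exists y; rewrite !inE jy !orbT.
have Hv t' : theta_on t' g -> exists2 j, j \in all_frame_edges t' & incident g (int_ k (source t')) j.
  move=> tg'; have j1 : (strand1 t').1 \in source_edges t' by rewrite inE eqxx.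
  have [y jy] := source_edgesP tg' j1; exists (strand1 t').1; first by rewrite inE eqxx.
  exact: joins_incident jy.
suff [j jf xj] : exists2 j, j \in all_frame_edges t & incident g (int_ k x) j.
  by rewrite frame_vertex; apply/existsP; exists j; rewrite xj andbT;
    have := theta_frame_edge j; rewrite jf inE.
case/or3P: (nodes_mem x tg) => [/eqP->|/eqP->|xi]; first exact: Hv.
  have [/allP t1 _ _] := strand_joins tg.
  have [j jf [y jy]] := Hw (strand1 t) (source t); exists j; first by rewrite mem_cat jf.
  by have := t1 _ jy; rewrite joins_sym => /joins_incident.
have [/allP t1 /allP t2 /allP t3] := strand_joins tg.
move: xi; rewrite !mem_cat => /or3P[xs|xs|xs].
- have [j jf [y jy]] := H _ (source t) (sink t) xs; exists j; first by rewrite !mem_cat jf.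
  exact: joins_incident (t1 _ jy).
- have [j jf [y jy]] := H _ (source t) (sink t) xs; exists j; first by rewrite !mem_cat jf orbT.
  exact: joins_incident (t2 _ jy).
have [j jf [y jy]] := H _ (source t) (sink t) xs; exists j; first by rewrite !mem_cat jf !orbT.
exact: joins_incident (t3 _ jy).
Qed.

(** Each strand without its final sink is a path attached to the source. The source itself is
    covered by reversing the Theta. *)
Lemma theta_cut_sink : connected_in g (frame g :\ vcell e (int_ k (sink t))).
Proof.
have [vw vi wi _] := nodes_uniq tg; set S := _ :\ _.
have vS : v \in S.
  by rewrite in_setD1 theta_frame_int andbT (inj_eq inl_inj) (inj_eq inr_inj).
have sub c : c \in frame_cells t -> c != vcell e (int_ k (sink t)) -> c \in S.
  move=> cf cw; rewrite in_setD1 cw; case: c cf {cw} => [[i|x]|j] cf.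
  - have no j l w : inl (inl i) \in strand_cells j l w = false :> bool.
      by elim: l j => [|[[y h] j'] l IH] j //=; rewrite !inE /= IH.
    by move: cf; rewrite !mem_cat !no.
  - exact: theta_frame_int.
  by rewrite -/(ecell k n j) theta_frame_edge frame_edge_cell.
have [p1 p2 p3] := strand_joins tg.
have strandC (s : strand k n e) : {subset cells_of t s <= frame_cells t} ->
    sink t \notin strand_nodes s ->
    all (joins g) (strand_links (source t) s.1 s.2 (sink t)) ->
    {in cells_of t s, forall c, c != vcell e (int_ k (sink t)) -> connect (adj g S) v c}.
  move=> ss ws js; have := strand_cells_path js.
  have : count_mem (vcell e (int_ k (sink t))) (cells_of t s) = 1%N.
    by rewrite count_cells_int (count_memPn ws) eqxx.
  have := last_strand_cells v s.1 s.2 (sink t); move: ss; rewrite /cells_of.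
  case: (lastP (strand_cells _ _ _)) => [|C c] ss; first by move=> _ /=.
  rewrite last_rcons => cE; rewrite cE in ss *.
  rewrite -cats1 count_cat /= eqxx addn0 addn1 => -[/count_memPn wC].
  rewrite cat_path => /andP[pC _] d; rewrite mem_cat inE => /orP[dC _|/eqP->]; last by rewrite eqxx.
  apply: (path_connect_in pC); last by rewrite inE dC orbT.
  move=> a; rewrite inE => /orP[/eqP->//|aC]; apply: sub.
    by apply: ss; rewrite mem_rcons inE aC orbT.
  by apply: contraNneq wC => <-.
have wn : [/\ sink t \notin strand_nodes (strand1 t), sink t \notin strand_nodes (strand2 t)
    & sink t \notin strand_nodes (strand3 t)].
  by apply/and3P; rewrite -!negb_or -!mem_cat.
have [w1 w2 w3] := wn.
apply: (connected_inP vS) => c; rewrite in_setD1 => /andP[cw cf].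
have [->|cv] := eqVneq c v; first exact: connect0.
have : c \in frame_cells t.
  case: c cf cv {cw} => [[i|x]|j] cf cv.
  - move: cf; rewrite frame_vertex => /existsP[j /andP[jF /incident_joins[z jz]]].
    have := leaf_tree_type theta_connected (valence_ext i tg) theta_sizes jz.
    by rewrite (negPf jF).
  - rewrite int_cell //; apply: contraNneq cv => ->; exact: eqxx.
  by rewrite -/(ecell k n j) -frame_edge_cell -theta_frame_edge.
rewrite !mem_cat => /or3P[] cs.
- by apply: (strandC (strand1 t)) => // a ac; rewrite mem_cat ac.
- by apply: (strandC (strand2 t)) => // a ac; rewrite !mem_cat ac orbT.
by apply: (strandC (strand3 t)) => // a ac; rewrite !mem_cat ac !orbT.
Qed.


Lemma theta_cut_inner x : x \in inner_nodes t -> connected_in g (frame g :\ vcell e (int_ k x)).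
Proof.
have [vw vi wi _] := nodes_uniq tg => xi; set S := _ :\ _.
have ne (y z : 'I_n) : (vcell e (int_ k y) != vcell e (int_ k z)) = (y != z).
  by rewrite (inj_eq inl_inj) (inj_eq inr_inj).
have xv : x != source t by apply: contraNneq vi => <-.
have xw : x != sink t by apply: contraNneq wi => <-.
have fc c : (c \in frame g) = (c \in v :: frame_cells t).
  rewrite in_cons; case: c => [[i|y]|j].
  - have -> : (inl (inl i) \in frame g) = false.
      apply/negbTE; rewrite frame_vertex; apply/negP=> /existsP[j /andP[jF /incident_joins[z jz]]].
      have := leaf_tree_type theta_connected (valence_ext i tg) theta_sizes jz.
      by rewrite (negPf jF).
    have no j l w : inl (inl i) \in strand_cells j l w = false :> bool.
      by elim: l j => [|[[y h] j'] l IH] j //=; rewrite !inE /= IH.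
    by rewrite !mem_cat !no.
  - by rewrite theta_frame_int int_cell // (inj_eq inl_inj) (inj_eq inr_inj) orbN.
  by rewrite -/(ecell k n j) theta_frame_edge frame_edge_cell.
have cf : vcell e (int_ k x) \in frame_cells t by rewrite int_cell.
have vS : v \in S by rewrite in_setD1 theta_frame_int andbT ne eq_sym.
apply: (connected_inP vS) => c; rewrite in_setD1 fc in_cons => /andP[cx].
case/orP=> [/eqP->|cfr]; first exact: connect0.
apply: (frame_delete_connect tg cf); rewrite ?ne //.
by move=> d dv dx; rewrite in_setD1 dx fc.
Qed.

End ThetaIsHairy.

Lemma theta_two_loop t : theta_on t g -> (size (source_hair t) <= 1)%N ->
  (size (sink_hair t) <= 1)%N -> (0 < k)%N -> two_loop_hairy g.
Proof.
move=> tg h1 h2 k0; apply/and4P; split.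
- apply/and4P; split=> //; first exact: theta_connected tg.
    by apply/forallP=> i; rewrite (valence_ext i tg).
  apply/forallP=> x; case/or3P: (nodes_mem x tg) => [/eqP->|/eqP->|xi].
  - by rewrite (valence_source tg) leq_addl.
  - by rewrite (valence_sink tg) leq_addl.
  by rewrite (valence_inner tg xi).
- rewrite /betti1.
  have -> : [set j | ecell k n j \in [set: cell k n e]] = setT by apply/setP=> j; rewrite !inE.
  have -> : [set x | vcell e x \in [set: cell k n e]] = setT by apply/setP=> j; rewrite !inE.
  by rewrite !cardsT card_sum !card_ord; have := theta_sizes tg => ->; apply/eqP; lia.
- apply/forallP=> -[i|x]; rewrite /cut_vertex negb_and negbK.
    apply/orP; left; rewrite frame_vertex; apply/negP=> /existsP[j /andP[jF /incident_joins[z jz]]].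
    have := leaf_tree_type (theta_connected tg) (valence_ext i tg) (theta_sizes tg) jz.
    by rewrite (negPf jF).
  apply/orP; right; case/or3P: (nodes_mem x tg) => [/eqP->|/eqP->|xi].
  - exact: theta_cut_sink (theta_on_rev tg).
  - exact: theta_cut_sink tg.
  exact: theta_cut_inner tg _ xi.
apply/forallP=> j; apply/implyP=> jt; rewrite /is_hair jt /=.
move: (jt); rewrite (theta_tree_type tg) => /mapP[p pt jE].
have pj := hair_list_joins tg pt; rewrite -jE in pj.
apply/existsP; exists (ext n p.2.1); apply/existsP; exists (int_ k p.1).
apply/and4P; split.
- by rewrite orbC; apply: pj.
- by rewrite (valence_ext _ tg).
- exact: theta_frame_int tg _.
apply/forallP=> i; apply/implyP=> /andP[].
rewrite (theta_tree_type tg) => /mapP[q qt iE] qi.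
have qj := hair_list_joins tg qt; rewrite -iE in qj.
(* As each essential vertex carries at most one hair, entries of [hair_list] have distinct vertices,
   so equal vertices give equal hairs. *)
suff pq : p.1 = q.1.
  have un := hair_list_nodes tg h1 h2.
  have : p = q; last by rewrite iE jE => ->.
  have /uniqP := un; move=> /(_ (source t)) U.
  have ip : (index p (hair_list t) < size (map fst (hair_list t)))%N by rewrite size_map index_mem.
  have iq : (index q (hair_list t) < size (map fst (hair_list t)))%N by rewrite size_map index_mem.
  have := U _ _ ip iq; rewrite !(nth_map p) ?index_mem // !nth_index // => /(_ pq) E.
  by rewrite -(nth_index p pt) E nth_index.
move: qi; rewrite /incident; move: qj; rewrite /joins /= => /orP[]/eqP-> /=.
  by rewrite orbF => /eqP[].
by move=> /eqP[].
Qed.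

End ThetaTwoLoop.

Lemma torder_exists (T : finType) : exists R : torder T, True.
Proof.
pose r : rel T := fun a b => (enum_rank a <= enum_rank b)%N.
have r_total : total r by move=> a b; apply: leq_total.
have r_anti : antisymmetric r by move=> a b /anti_leq/val_inj/enum_rank_inj.
have r_trans : transitive r by move=> b a c; apply: leq_trans.
by exists (mk_order r_total r_anti r_trans).
Qed.

Lemma map_insubd_iota m (x0 : 'I_m) : map (insubd x0) (iota 0 m) = enum 'I_m.
Proof.
apply: (inj_map val_inj); rewrite val_enum_ord -map_comp -[RHS]map_id.
by apply/eq_in_map=> i; rewrite mem_iota => /= im; rewrite val_insubd im.
Qed.

(** * Every admissible shape is realised *)

Section Existence.
Variables (k n e p q a b c : nat).
Hypotheses (k_gt0 : (0 < k)%N) (p_le1 : (p <= 1)%N) (q_le1 : (q <= 1)%N)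
  (kE : k = (p + q + (a + b + c))%N) (nE : n = (a + b + c).+2) (eE : e = (k + n).+1).

(** Numbering: vertices 0 and 1 are essential and inner vertices follow. External vertex i hangs on
    edge i; the next a + b + c edges leave the inner vertices, and the last three are the first
    edges of the strands. *)
Lemma theta_of_shape : exists t : theta k n e,
  [/\ perm_eq (nodes t) (enum 'I_n), perm_eq (exts t) (enum 'I_k),
      perm_eq (word t) (enum 'I_e) & shape t = ((p, q), (a, b, c))].
Proof.
have n0 : (0 < n)%N by rewrite nE.
have e0 : (0 < e)%N by rewrite eE.
pose fk i : 'I_k := insubd (Ordinal k_gt0) i; pose fn i : 'I_n := insubd (Ordinal n0) i.
pose fe i : 'I_e := insubd (Ordinal e0) i.
pose nd i : node k n e := (fn i.+2, (fk (p + q + i), fe (p + q + i)), fe (p + q + (a + b + c) + i))%N.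
pose st i s l : strand k n e := (fe (p + q + (a + b + c) + (a + b + c) + i)%N, map nd (iota s l)).
pose t := Theta (fn 0%N) (fn 1%N) [seq (fk i, fe i) | i <- iota 0 p] [seq (fk i, fe i) | i <- iota p q]
  (st 0 0 a)%N (st 1 a b)%N (st 2 (a + b) c)%N.
pose L := (a + b + c)%N.
have LE : iota 0 L = iota 0 a ++ iota a b ++ iota (a + b) c by rewrite /L !iotaD catA.
have pqE : iota 0 (p + q) = iota 0 p ++ iota p q by rewrite iotaD.
have shiftE (U : Type) (f : nat -> U) m l : map f (iota m l) = map (fun i => f (m + i)%N) (iota 0 l).
  by rewrite -{1}[m]addn0 iotaDl -map_comp.
exists t; split.
- have snE i s l : strand_nodes (st i s l) = map (fun i => fn i.+2) (iota s l).
    by rewrite /strand_nodes -map_comp.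
  have -> : nodes t = map fn (iota 0 n); last by rewrite map_insubd_iota.
  rewrite /nodes !snE -!map_cat -LE.
  have -> : iota 0 n = [:: 0, 1 & iota 2 L]%N by rewrite [in LHS]nE.
  by rewrite !map_cons (shiftE _ fn 2%N).
- have sxE i s l : strand_exts (st i s l) = map (fun i => fk (p + q + i)%N) (iota s l).
    by rewrite /strand_exts -map_comp.
  have -> : exts t = map fk (iota 0 k); last by rewrite map_insubd_iota.
  rewrite /exts !sxE -!map_cat -LE /unzip1 /= -!map_comp.
  have -> : iota 0 k = iota 0 (p + q) ++ iota (p + q) L by rewrite [in LHS]kE iotaD.
  by rewrite pqE -catA !map_cat (shiftE _ fk (p + q)%N).
- have swE i s l (P : pred 'I_e) : count P (strand_word (st i s l)) =
     (P (fe (p + q + L + L + i)%N) + (count (fun i => P (fe (p + q + i)%N)) (iota s l)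
      + count (fun i => P (fe (p + q + L + i)%N)) (iota s l)))%N.
    rewrite /strand_word /= -/L; congr (_ + _)%N.
    elim: l s => //= l IH s; rewrite /tail_word /= -/(tail_word _) IH.
    have ar (u1 u2 u3 u4 : nat) : (u1 + (u2 + (u3 + u4)) = u1 + u3 + (u2 + u4))%N by clear; lia.
    exact: ar.
  suff : perm_eq (word t) (map fe (iota 0 e)) by rewrite map_insubd_iota.
  have -> : iota 0 e = iota 0 (p + q) ++ iota (p + q) L ++ iota (p + q + L) L
      ++ iota (p + q + L + L) 3.
    have eE' : e = (p + q + (L + (L + 3)))%N by rewrite eE kE nE /L; clear; lia.
    by rewrite [in LHS]eE' !iotaD.
  apply/seq.permP=> P; rewrite /word !count_cat !swE pqE !map_cat !count_cat.
  rewrite (shiftE _ fe (p + q)%N) (shiftE _ fe (p + q + L)%N) (shiftE _ fe (p + q + L + L)%N).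
  rewrite /unzip2 /= -!map_comp ![count P (map _ (iota 0 L))]count_map LE !count_cat /=.
  have ar (x1 x2 y0 y1 y2 u1 u2 u3 z1 z2 z3 : nat) :
    (x1 + (x2 + (y0 + (u1 + z1) + (y1 + (u2 + z2) + (y2 + (u3 + z3))))) =
     x1 + x2 + (u1 + (u2 + u3) + (z1 + (z2 + z3) + (y0 + (y1 + (y2 + 0))))))%N by clear; lia.
  exact: ar.
by rewrite /shape /= !size_map !size_iota.
Qed.

Lemma theta_exists : exists (o : ograph k n e) t,
  theta_on t o.1 /\ shape t = ((p, q), (a, b, c)).
Proof.
have [t [tn tx tw ts]] := theta_of_shape; have [R _] := torder_exists (cell k n e).
pose g : digraph k n e := [ffun j => nth (int_ k (source t), int_ k (source t))
  (unzip2 (links t)) (index j (unzip1 (links t)))].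
exists (g, R), t; split=> //; apply/and4P; split=> //.
have ul : uniq (unzip1 (links t)) by rewrite unzip1_links (perm_uniq tw) enum_uniq.
apply/allP=> l lt; rewrite /joins ffunE.
have il : (index l (links t) < size (links t))%N by rewrite index_mem.
have -> : index l.1 (unzip1 (links t)) = index l (links t).
  have E : l.1 = nth l.1 (unzip1 (links t)) (index l (links t)).
    by rewrite (nth_map l) // nth_index.
  by rewrite {1}E index_uniq ?size_map.
by rewrite (nth_map l) // nth_index // eqxx.
Qed.

End Existence.

(** * Bases, homology and generating functions *)

Section Independence.
Variables (V W : vectType rat) (I : finType) (A : {set I}) (X : I -> V)
  (F : I -> 'Hom(V, W)) (w0 : W).
Hypothesis w0_neq0 : w0 != 0.

Lemma dual_family_dim :
  (forall x y, x \in A -> y \in A -> F x (X y) = if x == y then w0 else 0) ->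
  \dim (\sum_(x in A) <[X x]>)%VS = #|A|.
Proof.
move=> dual.
have X_neq0 x : x \in A -> X x != 0.
  move=> xA; apply: contraNneq w0_neq0 => x0; have := dual x x xA xA.
  by rewrite x0 linear0 eqxx => <-.
have /directvP /= -> : directv (\sum_(x in A) <[X x]>)%VS.
  apply/directv_sum_independent=> u uX u0 x xA.
  have [l lE] : exists l : I -> rat, forall y, y \in A -> u y = l y *: X y.
    have [y|l lE] := @fin_all_exists _ _ (fun y (r : rat) => y \in A -> u y = r *: X y).
      have [yA|] := boolP (y \in A); last by exists 0.
      by have /vlineP[r ->] := uX y yA; exists r.
    by exists l.
  have : F x (\sum_(y in A) u y) = l x *: w0.
    rewrite linear_sum (bigD1 x) //= lE // linearZ_LR /= dual // eqxx big1 ?addr0 //.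
    by move=> y /andP[yA yx]; rewrite lE // linearZ_LR /= dual // eq_sym (negPf yx) scaler0.
  rewrite u0 linear0 => /esym/eqP; rewrite scaler_eq0 (negPf w0_neq0) orbF => /eqP lx0.
  by rewrite lE // lx0 scale0r.
rewrite -sum1_card; apply: eq_bigr => x xA; by rewrite dim_vline X_neq0.
Qed.

(** Coefficients of a kernel element vanish by induction on rk: F x kills the other terms of rank at
    least rk x, and those of smaller rank have coefficient 0 already. *)
Lemma triangular_injective (U : vectType rat) (Y : I -> U) (f : 'Hom(U, V)) (rk : I -> nat) :
  (forall x y, x \in A -> y \in A -> (rk x <= rk y)%N ->
     F x (f (Y y)) = if x == y then w0 else 0) ->
  (lker f :&: \sum_(x in A) <[Y x]> = 0)%VS.
Proof.
move=> tri; apply/eqP; rewrite -subv0; apply/subvP=> u; rewrite memv_cap memv_ker.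
case/andP=> /eqP fu /memv_sumP[us usY uE]; rewrite memv0.
have [l lE] : exists l : I -> rat, forall y, y \in A -> us y = l y *: Y y.
  have [y|l lE] := @fin_all_exists _ _ (fun y (r : rat) => y \in A -> us y = r *: Y y).
    have [yA|] := boolP (y \in A); last by exists 0.
    by have /vlineP[r ->] := usY y yA; exists r.
  by exists l.
suff l0 : forall r x, (rk x < r)%N -> x \in A -> l x = 0.
  by rewrite uE big1 // => x xA; rewrite lE // (l0 (rk x).+1) // scale0r.
elim=> // r IH x xr xA; apply/eqP; move: fu; rewrite uE linear_sum => /(congr1 (F x)).
rewrite linear0 linear_sum (bigD1 x) //= lE // !linearZ_LR /= tri // eqxx big1 ?addr0 => [/eqP|y /andP[yA yx]].
  by rewrite scaler_eq0 (negPf w0_neq0) orbF.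
rewrite lE // !linearZ_LR /=; have [xy|yx'] := leqP (rk x) (rk y).
  by rewrite tri // eq_sym (negPf yx) scaler0.
by rewrite IH ?scale0r //; apply: leq_trans yx' _.
Qed.

End Independence.

Section Lengths.
Variables (k n e : nat) (g : digraph k n e).

Definition lengths (t : theta k n e) : seq nat := [seq size s.2 | s <- strands t].

Lemma same_source_lengths t t' : theta_on t g -> theta_on t' g ->
  source t' = source t -> {subset lengths t' <= lengths t}.
Proof.
move=> tg tg' vv l /mapP[s st ->].
apply: (map_f (fun s : strand k n e => size s.2)).
exact: (same_source_strands tg tg' vv st).
Qed.

Lemma lengths_subset t t' : theta_on t g -> theta_on t' g ->
  {subset lengths t' <= lengths t}.
Proof.
move=> tg tg'; have := nodes_mem (source t') tg.
rewrite (negPf (source_not_inner tg' tg)) orbF => /orP[]/eqP vv.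
  exact: same_source_lengths.
move=> l /(same_source_lengths (theta_on_rev tg) tg' vv).
by rewrite /lengths /= !size_rev_strand.
Qed.

End Lengths.

Section ThetaForms.
Variables (m N k n e : nat).
Hypotheses (N_gt0 : (0 < N)%N) (m_even : ~~ odd m) (N_even : ~~ odd N).
Variables (p q : nat).
Hypotheses (p_le1 : (p <= 1)%N) (q_le1 : (q <= 1)%N).

(** The set of strand lengths is an invariant of the graph. As a, b, c are distinct, containment in
    the lengths a', b', c' forces equality of the two sorted triples. *)
Lemma theta_form_vec a b c a' b' c' :
  (c < b < a)%N -> (c' <= b' <= a')%N -> (p = q -> ~~ odd (p * q + (a + b + c))) ->
  (exists (o : ograph k n e) t, theta_on t o.1 /\ shape t = ((p, q), (a, b, c))) ->
  theta_form m N k n e ((p, q), (a, b, c)) (theta_vec m N k n e ((p, q), (a', b', c')))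
  = if (a, b, c) == (a', b', c') then 1 else 0.
Proof.
move=> /andP[cb ba] /andP[cb' ba'] par ex.
case: eqP => [[<- <- <-]|ne].
  have [o [t [to sh]]] := ex; rewrite -sh -(theta_vecE N_gt0 m_even N_even to).
  move: (sh) => [s1 s2 s3 s4 s5].
  apply: theta_form_self => //; rewrite ?s1 ?s2 ?s3 ?s4 ?s5 //=.
  by rewrite !inE !negb_or !neq_ltn cb ba (ltn_trans cb ba) !orbT.
have [[o [t [to sh]]]|->] := theta_vec_case m N k n e ((p, q), (a', b', c')); last by rewrite linear0.
rewrite -sh -(theta_vecE N_gt0 m_even N_even to); apply: theta_form_other => // t' to' sh'.
apply: ne; have := lengths_subset to to'; rewrite /lengths /=.
case: sh => _ _ -> -> ->; case: sh' => _ _ -> -> -> sub.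
have := sub a; have := sub b; have := sub c; rewrite !inE !eqxx !orbT => /(_ isT) h1 /(_ isT) h2 /(_ isT) h3.
by congr (_, _, _); apply/eqP; move: h1 h2 h3 cb ba cb' ba'; clear; lia.
Qed.

End ThetaForms.

(* The shapes a > b > c with a + b + c = k - d, where a is determined by (b, c). *)
Definition index_set (d k : nat) : {set 'I_k.+1 * 'I_k.+1} :=
  [set x : 'I_k.+1 * 'I_k.+1 | (x.2 < x.1)%N && (2 * x.1 + x.2 + d < k)%N].

Definition index_lengths (d k : nat) (x : 'I_k.+1 * 'I_k.+1) : nat * nat * nat :=
  ((k - d - x.1 - x.2)%N, x.1 : nat, x.2 : nat).

(** * Bases of the chain spaces *)

Section Span.
Variables (m N k n e : nat).
Hypotheses (N_gt0 : (0 < N)%N) (m_even : ~~ odd m) (N_even : ~~ odd N).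
Variables (p q : nat).
Hypotheses (k_gt0 : (0 < k)%N) (q_le_p : (q <= p)%N) (p_le1 : (p <= 1)%N)
  (nE : (n + (p + q) = k.+2)%N) (eE : (e + (p + q) = (2 * k).+3)%N).

Notation tv := (theta_vec m N k n e).

Definition index_vec (x : 'I_k.+1 * 'I_k.+1) : GC m N k n e := tv ((p, q), index_lengths (p + q) x).

(** Exchanging strands sorts the lengths up to sign, and repeated lengths give 0. *)
Lemma theta_vec_sorted pq (U : {vspace GC m N k n e}) j :
  (forall a b c, (c < b < a)%N -> (a + b + c = j)%N -> tv (pq, (a, b, c)) \in U) ->
  forall a b c, (a + b + c = j)%N -> tv (pq, (a, b, c)) \in U.
Proof.
move=> sorted a b c abc.
have s12 x y z : tv (pq, (x, y, z)) \in U -> tv (pq, (y, x, z)) \in U.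
  by rewrite (theta_vec_swap12 _ _ _ N_gt0 m_even N_even) memvN.
have s23 x y z : tv (pq, (x, y, z)) \in U -> tv (pq, (x, z, y)) \in U.
  by rewrite (theta_vec_swap23 _ _ _ N_gt0 m_even N_even) memvN.
have e12 x z : tv (pq, (x, x, z)) \in U by rewrite (theta_vec_eq12 _ _ _ N_gt0 m_even N_even) mem0v.
have so x y z : (z < y)%N -> (y < x)%N -> (x + y + z = j)%N -> tv (pq, (x, y, z)) \in U.
  by move=> zy yx; apply: sorted; rewrite zy.
case: (ltngtP a b) => [ab|ba|<-]; last exact: e12.
- case: (ltngtP b c) => [bc|cb|<-]; last by apply/s12/s23/e12.
    by apply/s12/s23/s12/so => //; lia.
  case: (ltngtP a c) => [ac|ca|<-]; last by apply/s23/e12.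
    by apply/s12/s23/so => //; lia.
  by apply/s12/so => //; lia.
case: (ltngtP b c) => [bc|cb|<-]; last by apply/s12/s23/e12.
  case: (ltngtP a c) => [ac|ca|<-]; last by apply/s23/e12.
    by apply/s23/s12/so => //; lia.
  by apply/s23/so => //; lia.
exact: so.
Qed.

Lemma theta_sum t g : @theta_on k n e t g ->
  (size (strand1 t).2 + size (strand2 t).2 + size (strand3 t).2 + 2 = n)%N.
Proof.
by case/and4P=> /perm_size + _ _ _; rewrite size_nodes size_enum_ord; lia.
Qed.

Lemma theta_vec_in_two_loop abc : tv ((p, q), abc) \in two_loop m N k n e (p + q).
Proof.
have [[o [t [to sh]]]|->] := theta_vec_case m N k n e ((p, q), abc); last exact: mem0v.
rewrite -sh -(theta_vecE N_gt0 m_even N_even to) /theta_class memvZ // memvE.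
case: abc sh => [[a b] c] [s1 s2 _ _ _].
apply: (sumv_sup o) => //; rewrite (theta_defect to) s1 s2 eqxx andbT.
by apply: theta_two_loop to _ _ k_gt0; rewrite ?s1 ?s2 // (leq_trans q_le_p).
Qed.

Lemma two_loop_span :
  two_loop m N k n e (p + q) = (\sum_(x in index_set (p + q) k) <[index_vec x]>)%VS.
Proof.
apply/eqP; rewrite eqEsubv; apply/andP; split; last first.
  by apply/subv_sumP=> x xA; rewrite -memvE /index_vec theta_vec_in_two_loop.
apply/subv_sumP=> o /andP[/two_loop_theta[t [to h1 h2]] /eqP def].
rewrite -memvE; set U := (\sum_(x in _) _)%VS.
have inU a b c : (a + b + c + (p + q) = k)%N -> tv ((p, q), (a, b, c)) \in U.
  move=> abc; apply: (@theta_vec_sorted _ _ (k - (p + q))) => [a0 b0 c0 /andP[cb ba] abc'|]; last by lia.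
  move: a0 b0 c0 cb ba abc' => {abc}a {}b {}c cb ba abc.
  have xb : (b < k.+1)%N by lia.
  have xc : (c < k.+1)%N by lia.
  rewrite memvE; apply: (sumv_sup (Ordinal xb, Ordinal xc)).
    by rewrite inE /=; apply/andP; split=> //; lia.
  rewrite /index_vec /index_lengths /=.
  have -> : (k - (p + q) - b - c = a)%N by lia.
  exact: subvv.
have cls_in : theta_class m N o t \in U.
  rewrite (theta_vecE N_gt0 m_even N_even to).
  have sz := theta_sum to; have := theta_defect to; rewrite def.
  case E: (shape t) => [[p' q'] [[a b] c]].
  move: E => [s1 s2 s3 s4 s5]; rewrite s1 s2 => pq; rewrite s3 s4 s5 in sz.
  (* The defect p + q determines the pair of hair numbers up to order, and reversal exchanges the
     two orders. *)
  have [[-> ->]|[-> ->]] : (p' = p /\ q' = q) \/ (p' = q /\ q' = p).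
  - by rewrite s1 in h1; rewrite s2 in h2; move: h1 h2 pq q_le_p p_le1; clear; lia.
  - by apply: inU; lia.
  rewrite (theta_vec_rev _ _ _ N_gt0 m_even N_even p q) memvZ //.
  by apply: inU; lia.
move: cls_in; rewrite /theta_class; have := word_sign_sq (edge_rel o.2) (word t).
move: (word_sign _ _) => s ss /(memvZ s); by rewrite scalerA ss scale1r.
Qed.

Lemma index_vec_exists x : x \in index_set (p + q) k ->
  exists (o : ograph k n e) t, theta_on t o.1 /\ shape t = ((p, q), index_lengths (p + q) x).
Proof.
rewrite inE => /andP[cb bk]; by apply: theta_exists => //; move: cb bk nE eE; clear; lia.
Qed.

Lemma index_form_vec (x : 'I_k.+1 * 'I_k.+1) a' b' c' : x \in index_set (p + q) k ->
  (p = q -> ~~ odd (p + k)) -> (c' <= b' <= a')%N ->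
  theta_form m N k n e ((p, q), index_lengths (p + q) x) (tv ((p, q), (a', b', c')))
  = if index_lengths (p + q) x == (a', b', c') then 1 else 0.
Proof.
move=> xA par s'; have ex := index_vec_exists xA; move: xA; rewrite inE => /andP[cb bk].
apply: theta_form_vec => //; first by lia.
  by rewrite cb /=; lia.
have pp : (p * p = p)%N by case: (p) p_le1 => [|[|]].
by move=> pq; have := par pq; move: bk; rewrite -pq pp; clear; lia.
Qed.

(** For p = q the reversal exponent pq + a + b + c has the parity of p + k, because a + b + c = k -
    2p. The hypothesis thus says that reversal preserves the orientation. *)
Lemma two_loop_dim : (p = q -> ~~ odd (p + k)) ->
  \dim (two_loop m N k n e (p + q)) = #|index_set (p + q) k|.
Proof.
move=> par; rewrite two_loop_span.
apply: (@dual_family_dim _ _ _ _ _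
  (fun x => theta_form m N k n e ((p, q), index_lengths (p + q) x)) 1).
  exact: oner_neq0.
move=> x y xA yA; rewrite /index_vec {2}/index_lengths index_form_vec //; last first.
  by move: yA; rewrite inE; lia.
congr (if _ then _ else _); apply/eqP/eqP=> [[_ xb xc]|->//].
by case: x y xA yA xb xc => [xb xc] [yb yc] _ _ /= /val_inj -> /val_inj ->.
Qed.

Lemma two_loop_eq0 : p = q -> odd (p + k) -> two_loop m N k n e (p + q) = 0%VS.
Proof.
move=> pq par; rewrite two_loop_span big1 // => x; rewrite inE => /andP[cb bk].
have pp : (p * p = p)%N by case: (p) p_le1 => [|[|]].
rewrite /index_vec -pq (theta_vec_rev_odd _ _ _ N_gt0 m_even N_even).
  by apply/eqP; rewrite -dimv_eq0 dim_vline eqxx.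
by rewrite pp; move: bk par; rewrite -pq; clear; lia.
Qed.

End Span.

Section Differential.
Variables (m N k n e q : nat).
Hypotheses (N_gt0 : (0 < N)%N) (m_even : ~~ odd m) (N_even : ~~ odd N).
Hypotheses (k_gt0 : (0 < k)%N) (q_le1 : (q <= 1)%N) (par : q = 1%N -> odd k)
  (nE : (n + (1 + q) = k.+2)%N) (eE : (e + (1 + q) = (2 * k).+3)%N).

Notation tv' := (theta_vec m N k n.+1 e.+1).

(** For q = 1 both essential vertices contribute. Since k is odd the sign of the sink term is +1,
    and on the target shapes (0, 1) and (1, 0) agree, so the contributions are equal and add up to
    the factor q + 1. *)
Lemma diff_index_vec x : x \in index_set (1 + q) k ->
  let: (a, b, c) := index_lengths (1 + q) x in
  diff m N k n e (index_vec m N n e 1 q x) = q.+1%:R *: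
    (tv' ((q, 0), (a.+1, b, c))%N + tv' ((q, 0), (a, b.+1, c))%N + tv' ((q, 0), (a, b, c.+1))%N).
Proof.
move=> xA; have [o [t [to sh]]] := index_vec_exists k_gt0 nE eE xA.
move: xA; rewrite inE => /andP[cb bk].
rewrite /index_vec -sh -(theta_vecE N_gt0 m_even N_even to).
case E: (index_lengths _ _) => [[a b] c].
have abc : (a + b + c + (1 + q) = k)%N.
  by move: E; rewrite /index_lengths => -[<- <- <-]; lia.
move: sh; rewrite E => -[s1 s2 s3 s4 s5].
rewrite (diff_theta_class N_gt0 m_even N_even to) ?s1 ?s2 //.
rewrite /shape /= s3 s4 s5 /add_hair.
case: (q) q_le1 par abc => [|[|//]] _ par' abc.
  by rewrite mulr0 scale0r addr0.
have {}par' := par' erefl; have od : odd (1 * 1 + (a + b + c)) = false by lia.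
rewrite -signr_odd od mulr1 !scale1r -mulr2n scaler_nat.
have rv a' b' c' : odd (a' + b' + c') = false -> tv' ((0, 1), (a', b', c'))%N = tv' ((1, 0), (a', b', c'))%N.
  by move=> e'; rewrite (theta_vec_rev _ _ _ N_gt0 m_even N_even 1 0) mul1n add0n -signr_odd e' scale1r.
by rewrite !rv //; lia.
Qed.

Lemma diff_two_loop_sub :
  (diff m N k n e @: two_loop m N k n e (1 + q) <= two_loop m N k n.+1 e.+1 q)%VS.
Proof.
rewrite (two_loop_span N_gt0 m_even N_even) // limg_sum; apply/subv_sumP=> x xA.
rewrite limg_line -memvE; have := diff_index_vec xA.
case: (index_lengths (1 + q) x) => [[a b] c] ->; apply: memvZ.
have H abc : tv' ((q, 0), abc)%N \in two_loop m N k n.+1 e.+1 q.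
  rewrite -{2}[q]addn0; apply: theta_vec_in_two_loop => //.
by rewrite !memvD.
Qed.

Lemma diff_two_loop_injective : (q = 0%N -> ~~ odd k) ->
  (lker (diff m N k n e) :&: two_loop m N k n e (1 + q) = 0)%VS.
Proof.
move=> par'; rewrite (two_loop_span N_gt0 m_even N_even) //.
have nE' : (n.+1 + (q + 0) = k.+2)%N by rewrite addn0; move: nE; lia.
have eE' : (e.+1 + (q + 0) = (2 * k).+3)%N by rewrite addn0; move: eE; lia.
(* The same pair (b, c) indexes a graph and its leading term: with one essential hair less,
   [index_lengths] returns a + 1 instead of a. The rank is b + c. *)
apply: (@triangular_injective _ _ _ _ (fun x =>
  theta_form m N k n.+1 e.+1 ((q, 0%N), index_lengths (q + 0) x)) q.+1%:R _ _ _ _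
  (fun x : 'I_k.+1 * 'I_k.+1 => (x.1 + x.2)%N)).
  by rewrite pnatr_eq0.
move=> x y xA yA xy; have := diff_index_vec yA.
case E: (index_lengths (1 + q) y) => [[a b] c] ->.
have xA' : x \in index_set (q + 0) k by move: xA; rewrite !inE => /andP[-> /=]; lia.
have form a' b' c' := @index_form_vec m N k n.+1 e.+1 N_gt0 m_even N_even q 0
  k_gt0 (leq0n q) q_le1 nE' eE' x a' b' c' xA'.
have par0 : q = 0%N -> ~~ odd (q + k) by move=> q0; rewrite q0 add0n par'.
move: yA; rewrite inE => /andP[cb bk]; move: E => [aE bE cE].
move: xA; rewrite inE => /andP[cb' bk'].
have t1 : (index_lengths (q + 0) x == (a.+1, b, c)) = (x == y).
  apply/eqP/eqP=> [[_ xb xc]|xyE].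
    move: xb xc; rewrite -bE -cE; clear.
    by case: x y => [xb xc] [yb yc] /= /val_inj -> /val_inj ->.
  rewrite /index_lengths xyE bE cE in aE bk *; congr (_, _, _); move: aE bk; clear; lia.
have t2 : (index_lengths (q + 0) x == (a, b.+1, c)) = false.
  by apply/eqP=> -[_ xb xc]; move: xy; rewrite xb xc bE cE; clear; lia.
have t3 : (index_lengths (q + 0) x == (a, b, c.+1)) = false.
  by apply/eqP=> -[_ xb xc]; move: xy; rewrite xb xc bE cE; clear; lia.
rewrite bE cE in aE cb bk.
(* Moving a hair may create equal lengths, but weakly sorted triples suffice for
   [index_form_vec]. *)
have s1 : (c <= b <= a.+1)%N by move: aE cb bk; clear; lia.
have s2 : (c <= b.+1 <= a)%N by move: aE cb bk; clear; lia.
have s3 : (c.+1 <= b <= a)%N by move: aE cb bk; clear; lia.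
rewrite linearZ_LR !linearD /= bE cE aE (form _ _ _ par0 s1) (form _ _ _ par0 s2) (form _ _ _ par0 s3) t1 t2 t3.
by rewrite !addr0; case: (x == y); rewrite ?scaler0 //; apply: mulr1.
Qed.

End Differential.

(** * Counting the triples with a = b + 1 *)

Section Counting.

(** As m is odd, so is c; put c = 2i + 1, hence b = (m-1)/2 - i. Then c < b reads 6i + 3 < m, that
    is 6(i+1) <= m + 1 because m is odd. *)
Lemma card_index_slice k m : (m < k)%N -> odd m ->
  #|[set x : 'I_k.+1 * 'I_k.+1 | (x.2 < x.1)%N && (2 * x.1 + x.2 == m)%N]| = (m.+1 %/ 6)%N.
Proof.
move=> mk om; have bd i : (i < m.+1 %/ 6)%N -> ((m.-1)./2 - i < k.+1)%N /\ ((2 * i).+1 < k.+1)%N by lia.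
pose f (i : 'I_(m.+1 %/ 6)) : 'I_k.+1 * 'I_k.+1 := (inord ((m.-1)./2 - i), inord (2 * i).+1).
have fE i : ((f i).1 : nat) = ((m.-1)./2 - i)%N /\ ((f i).2 : nat) = (2 * i).+1.
  by have [b1 b2] := bd i (ltn_ord i); rewrite /f /= !inordK.
rewrite -[RHS]card_ord -(card_imset _ (f := f)); last first.
  move=> i j /(congr1 (fun x => nat_of_ord x.2)); have [_ ->] := fE i; have [_ ->] := fE j.
  by move=> ij; apply: val_inj => /=; lia.
apply: eq_card => x; rewrite !inE; apply/andP/imsetP => [[cb /eqP bm]|[i _ ->]]; last first.
  by have [-> ->] := fE i; have := ltn_ord i; split; [|apply/eqP]; move: om; lia.
have x2 : (x.2./2 < m.+1 %/ 6)%N.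
  by move: cb bm om; move: (x.1 : nat) (x.2 : nat) => b c; clear; lia.
exists (Ordinal x2) => //; apply/eqP; rewrite -pair_eqE /pair_eq -!val_eqE /=.
have [-> ->] := fE (Ordinal x2); by apply/andP; split; apply/eqP=> /=; lia.
Qed.

(** The two index sets differ by the slice 2b + c = k - d - 1, which is the condition a = b + 1. *)
Lemma card_index_set k d : (d < k)%N -> ~~ odd (k - d) ->
  #|index_set d k| = (#|index_set d.+1 k| + (k - d) %/ 6)%N.
Proof.
move=> dk par; have := @card_index_slice k (k - d).-1 _ _; rewrite prednK; last by lia.
move=> <-; [|by lia|by lia].
rewrite -cardsUI [X in (_ + #|pred_of_set X|)%N](_ : _ = set0) ?cards0 ?addn0; last first.
  by apply/setP=> x; rewrite !inE; lia.
by apply: eq_card => x; rewrite !inE; lia.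
Qed.

End Counting.

Section HomologyDimension.

Lemma dim_limg_injective (V W : vectType rat) (f : 'Hom(V, W)) (C : {vspace V}) :
  (lker f :&: C = 0)%VS -> \dim (f @: C)%VS = \dim C.
Proof. by rewrite capvC -(limg_ker_dim f C) => ->; rewrite dimv0. Qed.

Lemma homology_dim (V : vectType rat) (Z B : {vspace V}) : (B <= Z)%VS ->
  (\dim (homology Z B) + \dim B = \dim Z)%N.
Proof. by move=> BZ; rewrite -(limg_ker_dim (quot_pi B) Z) lker_quot_pi (capv_idPr BZ) addnC. Qed.

End HomologyDimension.

Section Dimensions.
Variables (m N k : nat).
Hypotheses (N_gt0 : (0 < N)%N) (m_even : ~~ odd m) (N_even : ~~ odd N) (k_gt0 : (0 < k)%N).

Lemma d1_sub : (d1 m N k @: C1 m N k <= C0 m N k)%VS.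
Proof. by apply: (@diff_two_loop_sub m N k _ _ 0) => //; lia. Qed.

Lemma dim_C1 : \dim (C1 m N k) = #|index_set 1 k|.
Proof. by apply: (@two_loop_dim m N k _ _ N_gt0 m_even N_even 1 0) => //; lia. Qed.

Lemma dim_even : ~~ odd k ->
  [/\ \dim (C2 m N k) = 0, \dim (H1 m N k) = 0, \dim (H0 m N k) = k %/ 6
    & \dim (C0 m N k) = \dim (C1 m N k) + k %/ 6]%N.
Proof.
move=> par.
have inj : (lker (d1 m N k) :&: C1 m N k = 0)%VS.
  by apply: (@diff_two_loop_injective m N k _ _ 0) => //; lia.
have c2 : C2 m N k = 0%VS.
  by apply: (@two_loop_eq0 m N k _ _ N_gt0 m_even N_even 1 1) => //; lia.
have c0 : \dim (C0 m N k) = #|index_set 0 k|.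
  by apply: (@two_loop_dim m N k _ _ N_gt0 m_even N_even 0 0) => //; lia.
have c01 : (\dim (C0 m N k) = \dim (C1 m N k) + k %/ 6)%N.
  by rewrite c0 dim_C1 card_index_set ?subn0.
split=> //; first by rewrite c2 dimv0.
  by rewrite /H1 inj /homology limg0 dimv0.
by apply/eqP; rewrite -(eqn_add2r (\dim (C1 m N k))) -{1}(dim_limg_injective inj) homology_dim ?d1_sub // addnC c01.
Qed.

Lemma dim_odd : odd k ->
  [/\ \dim (C0 m N k) = 0, \dim (H0 m N k) = 0, \dim (H1 m N k) = k %/ 6
    & \dim (C1 m N k) = \dim (C2 m N k) + k %/ 6]%N.
Proof.
move=> par.
have inj : (lker (d2 m N k) :&: C2 m N k = 0)%VS.
  by apply: (@diff_two_loop_injective m N k _ _ 1) => //; lia.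
have c0 : C0 m N k = 0%VS.
  by apply: (@two_loop_eq0 m N k _ _ N_gt0 m_even N_even 0 0) => //; lia.
have ker1 : (lker (d1 m N k) :&: C1 m N k = C1 m N k)%VS.
  by apply/capv_idPr; rewrite lkerE -subv0 -c0 d1_sub.
have sub2 : (d2 m N k @: C2 m N k <= C1 m N k)%VS.
  by apply: (@diff_two_loop_sub m N k _ _ 1) => //; lia.
have c2 : \dim (C2 m N k) = #|index_set 2 k|.
  by apply: (@two_loop_dim m N k _ _ N_gt0 m_even N_even 1 1) => //; lia.
have c12 : (\dim (C1 m N k) = \dim (C2 m N k) + k %/ 6)%N.
  (* For k = 1 both index sets are empty. Beyond that, (k - 1) %/ 6 = k %/ 6 because k is odd. *)
  have [k1|k1] := leqP k 1.
    rewrite c2 dim_C1 !eq_card0 ?divn_small //; first by lia.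
      by move=> x; rewrite !inE; lia.
    by move=> x; rewrite !inE; lia.
  by rewrite c2 dim_C1 card_index_set; lia.
split=> //; rewrite ?c0 ?dimv0 //.
  by rewrite /H0 c0 /homology limg0 dimv0.
rewrite /H1 ker1; apply/eqP; rewrite -(eqn_add2r (\dim (C2 m N k))).
by rewrite -{1}(dim_limg_injective inj) homology_dim // addnC c12.
Qed.

(** Vertices have even degree and edges odd degree, so the sign is (-1)^e with e = 2k+1, 2k+2,
    2k+3. *)
Lemma euler_charE : euler_char m N k =
  (\dim (C1 m N k))%:R - (\dim (C2 m N k))%:R - (\dim (C0 m N k))%:R.
Proof.
have deg n e : ((-1) ^ total_deg m N k n e : rat) = (-1) ^+ e.
  have even_pow j : ~~ odd j -> ((-1) ^ (j%:Z) : rat) = 1.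
    by move=> ej; rewrite -exprnP -signr_odd (negPf ej).
  have add_pow : {morph (fun z : int => (-1) ^ z : rat) : x y / x + y >-> x * y}.
    by move=> x y; rewrite expfzDr.
  rewrite /total_deg (big_morph _ add_pow (expr0z _)) !big_sumType /=.
  rewrite big1 => [|x _]; last by rewrite -invr_expz even_pow // invr1.
  rewrite big1 => [|x _]; last by rewrite -invr_expz even_pow // invr1.
  by rewrite !mul1r prodr_const card_ord expfzDr // even_pow // mul1r.
have sg e : ((-1) ^+ e : rat) = if odd e then -1 else 1 by rewrite -signr_odd; case: odd.
rewrite /euler_char !deg !sg /= !oddM /= !mulN1r !mul1r.
by rewrite [- _ + _]addrC.
Qed.

End Dimensions.

(** * Generating functions as recurrences *)

Lemma sum_coefXn (f : nat -> rat) j n :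
  \sum_(i < n.+1) ('X^j : {poly rat})`_i * f (n - i)%N = if (j <= n)%N then f (n - j)%N else 0.
Proof.
have E (i : 'I_n.+1) : ('X^j : {poly rat})`_i * f (n - i)%N = if (i : nat) == j then f (n - i)%N else 0.
  by rewrite coefXn; case: eqP; rewrite ?mul1r ?mul0r.
rewrite (eq_bigr _ (fun i _ => E i)) -big_mkcond /=.
have [jn|nj] := leqP j n; last by rewrite big1 // => i; have := ltn_ord i; lia.
have jn' : (j < n.+1)%N by [].
by rewrite (big_pred1 (Ordinal jn')).
Qed.

Lemma sum_shift (f : nat -> rat) (g : nat -> int) n : (forall j, f j = (g j)%:~R) ->
  forall j, \sum_(i < n.+1) ('X^j : {poly rat})`_i * f (n - i)%N
    = (if (j <= n)%N then g (n - j)%N else 0)%:~R.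
Proof. by move=> fg j; rewrite sum_coefXn; case: ifP; rewrite ?fg. Qed.

(** Clearing the denominator leaves a four-term recurrence; integer values g reduce it to integer
    arithmetic. *)
Lemma series_frac_X2X6 (f : series) (g : nat -> int) r : (forall j, f j = (g j)%:~R) ->
  (forall n, let s j := if (j <= n)%N then g (n - j)%N else 0 in
     s 0%N - s 2%N - s 6%N + s 8%N = (n == r)%:Z) ->
  series_frac f 'X^r ((1 - 'X^2) * (1 - 'X^6)).
Proof.
move=> fg gE; have -> : (1 - 'X^2) * (1 - 'X^6) = 'X^0 - 'X^2 - 'X^6 + 'X^8 :> {poly rat}.
  by ring.
split=> [|n]; first by rewrite !coefD !coefN !coefXn.
under eq_bigr do rewrite !coefD !coefN !mulrDl !mulNr.
by rewrite !big_split /= !sumrN !(sum_shift _ fg) coefXn -!rmorphN -!rmorphD gE.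
Qed.

Lemma series_frac_XX6 (f : series) (g : nat -> int) : (forall j, f j = (g j)%:~R) ->
  (forall n, let s j := if (j <= n)%N then g (n - j)%N else 0 in
     s 0%N + s 1%N - s 6%N - s 7%N = - (n == 6)%:Z) ->
  series_frac f (- 'X^6) ((1 + 'X) * (1 - 'X^6)).
Proof.
move=> fg gE; have -> : (1 + 'X) * (1 - 'X^6) = 'X^0 + 'X^1 - 'X^6 - 'X^7 :> {poly rat}.
  by ring.
split=> [|n]; first by rewrite !coefD !coefN !coefXn.
under eq_bigr do rewrite !coefD !coefN !mulrDl !mulNr.
by rewrite !big_split /= !sumrN !(sum_shift _ fg) coefN coefXn -!rmorphN -!rmorphD gE rmorphN.
Qed.

Theorem theorem5p8 (m N : nat) (m_gt0 : (0 < m)%N) (N_gt0 : (0 < N)%N)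
    (m_even : ~~ odd m) (N_even : ~~ odd N) :
  [/\ series_frac (gen_fun (fun k => (\dim (H0 m N k))%:R))
        'X^6 ((1 - 'X^2) * (1 - 'X^6)),
      series_frac (gen_fun (fun k => (\dim (H1 m N k))%:R))
        'X^7 ((1 - 'X^2) * (1 - 'X^6))
    & series_frac (gen_fun (euler_char m N))
        (- 'X^6) ((1 + 'X) * (1 - 'X^6))].
Proof.
split.
- apply: (series_frac_X2X6 (g := fun k => if odd k then 0 else (k %/ 6)%N : int)) => [[//|k]|]; last first.
  (* The largest shift is 8, so n <= 7 is checked case by case; from 8 on no term is cut off. *)
  by clear; do 8!case=> //; move=> n; rewrite /= !subSS !subn0 !negbK; case: (odd n) => /=; lia.
  rewrite /gen_fun; have [ok|ek] := boolP (odd k.+1).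
    by have [_ -> _ _] := dim_odd N_gt0 m_even N_even (ltn0Sn k) ok.
  by have [_ _ -> _] := dim_even N_gt0 m_even N_even (ltn0Sn k) ek.
- apply: (series_frac_X2X6 (g := fun k => if odd k then (k %/ 6)%N : int else 0)) => [[//|k]|]; last first.
  by clear; do 8!case=> //; move=> n; rewrite /= !subSS !subn0 !negbK; case: (odd n) => /=; lia.
  rewrite /gen_fun; have [ok|ek] := boolP (odd k.+1).
    by have [_ _ -> _] := dim_odd N_gt0 m_even N_even (ltn0Sn k) ok.
  by have [_ -> _ _] := dim_even N_gt0 m_even N_even (ltn0Sn k) ek.
apply: (series_frac_XX6 (g := fun k => if odd k then (k %/ 6)%N : int else - (k %/ 6)%N%:Z)) => [[//|k]|]; last first.
  by clear; do 8!case=> //; move=> n; rewrite /= !subSS !subn0 !negbK; case: (odd n) => /=; lia.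
rewrite /gen_fun (euler_charE _ m_even N_even); have [ok|ek] := boolP (odd k.+1).
  have [-> _ _ ->] := dim_odd N_gt0 m_even N_even (ltn0Sn k) ok.
  by rewrite natrD addrAC subr0 addrAC subrr add0r.
have [-> _ _ ->] := dim_even N_gt0 m_even N_even (ltn0Sn k) ek.
by rewrite natrD subr0 opprD addrA subrr add0r rmorphN.
Qed.
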